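(* Let $d\ge1$ and $[\phi]>0$. The abstract system of pointwise correlations of the fractional massless free field (fractional Gaussian field) with scaling dimension $[\phi]$, with labels in $\mathcal{A}^\infty$ and OPE coefficients $\mathcal{C}_{D_1,D_2}^E$ defined in the context, satisfies the enhanced factorized nearest neighbor bound. That is: for all $m,n,p\ge0$, all $A_1,\dots,A_m\in\mathcal{A}^\infty$, $B_1,\dots,B_{m+n+p}\in\mathcal{A}^\infty$ and $\Delta_1,\dots,\Delta_m\in\{[C]:C\in\mathcal{A}^\infty\}$, setting $$\mathrm{OPE}_i(y,x)=\mathcal{O}_{A_i}(y)\mathcal{O}_{B_i}(x)-\sum_{C_i\in\mathcal{A}^\infty,\,[C_i]\le\Delta_i}\mathcal{C}_{A_i,B_i}^{C_i}(y,x)\mathcal{O}_{C_i}(x)\quad(1\le i\le m),$$ $$\mathrm{CZ}_i(y,x)=\mathcal{O}_{B_i}(y)-\mathcal{O}_{B_i}(x)\quad(m+1\le i\le m+n),$$ there exist $\eta>0$ and $\gamma>0$ such that for all $\epsilon>0$ there exist $k\in\mathbb{N}$ and $K>0$ such that for all collections of $2m+2n+p$ distinct points $x_1,\dots,x_{m+n+p},y_1,\dots,y_{m+n}$ in $\mathbb{R}^d$, writing $\delta_i=\min_{j\ne i}|x_i-x_j|$ (minimum over $1\le j\le m+n+p$, $j\ne i$), $$\prod_{i=1}^{m+n}\mathbf{1}\{|y_i-x_i|\le\eta\,\delta_i\}\times\left|\left\langle\prod_{i=1}^m\mathrm{OPE}_i(y_i,x_i)\prod_{i=m+1}^{m+n}\mathrm{CZ}_i(y_i,x_i)\prod_{i=m+n+1}^{m+n+p}\mathcal{O}_{B_i}(x_i)\right\rangle\right|$$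 $$\le K\prod_{i=1}^{m+n+p}\langle x_i\rangle^k\prod_{i=1}^{m+n}\langle y_i\rangle^k\prod_{i=1}^m\left\{|y_i-x_i|^{\Delta_i+\gamma-[A_i]-[B_i]}\,\delta_i^{-\Delta_i-\gamma-\epsilon}\right\}\prod_{i=m+1}^{m+n}\left\{|y_i-x_i|^\gamma\,\delta_i^{-[B_i]-\gamma-\epsilon}\right\}\prod_{i=m+n+1}^{m+n+p}\delta_i^{-[B_i]-\epsilon}.$$
   Context: $\mathbb{N}=\{0,1,2,\dots\}$, $\langle x\rangle=\sqrt{1+|x|^2}$, $\mathbf{1}\{\cdots\}$ is an indicator function, $\mathrm{Conf}_n$ is the set of $n$-tuples of pairwise distinct points of $\mathbb{R}^d$. For a multiindex $\alpha\in\mathbb{N}^d$: $|\alpha|=\alpha_1+\cdots+\alpha_d$, $\alpha!=\alpha_1!\cdots\alpha_d!$, $x^\alpha=x_1^{\alpha_1}\cdots x_d^{\alpha_d}$. For $x\ne y$ in $\mathbb{R}^d$, $C(x,y)=\varkappa|x-y|^{-2[\phi]}$ with $\varkappa=\pi^{d/2}2^{2[\phi]}\Gamma([\phi])/\Gamma(\frac d2-[\phi])$ (a constant), and $C^{\alpha,\beta}(x,y)=\partial_x^\alpha\partial_y^\beta C(x,y)$; one has $C^{\beta,\alpha}(y,x)=C^{\alpha,\beta}(x,y)$. A minimum over an empty index set is read as $1$. Labels: $\mathcal{A}^\infty=\bigcup_{r\ge0}\mathcal{A}_r$ (disjoint union), where $\mathcal{A}_r$ is the set of $r$-tuples of multiindices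 in $\mathbb{N}^d$ modulo permutation, the class of $(\nu(1),\dots,\nu(r))$ being denoted $[\nu(1),\dots,\nu(r)]$. The unique element of $\mathcal{A}_0$ is $\mathbb{1}$. For a finite set $G$ and $\omega:G\to\mathbb{N}^d$, $\{G;\omega\}$ denotes the element $[\omega(a_1),\dots,\omega(a_r)]$ for any enumeration $a_1,\dots,a_r$ of $G$. The scaling dimension of $A=[\nu(1),\dots,\nu(r)]$ is $[A]=r[\phi]+|\nu(1)|+\cdots+|\nu(r)|$. For every $\Delta$ the set $\{A\in\mathcal{A}^\infty:[A]\le\Delta\}$ is finite. Correlations: for $A_i=[\nu(i,1),\dots,\nu(i,r_i)]$, $1\le i\le n$, set $F=\{(i,j):1\le i\le n,1\le j\le r_i\}$, $F_i=\{(i,j):1\le j\le r_i\}$, $\iota(i,j)=i$, and define on $\mathrm{Conf}_n$ $$\langle\mathcal{O}_{A_1}(x_1)\cdots\mathcal{O}_{A_n}(x_n)\rangle=\sum_{\mathcal{W}\text{ off-diag}}\ \prod_{\{a,b\}\in\mathcal{W}}C^{\nu(a),\nu(b)}(x_{\iota(a)},x_{\iota(b)}),$$ the sum being over perfect matchings $\mathcal{W}$ of $F$ such that no pair $\{a,b\}\in\mathcal{W}$ is contained in a single block $F_i$ (the correlation is $1$ if $F=\emptyset$; an empty sum is $0$). Correlations of products of linear combinations of symbols with function coefficients are defined by multilinear expansion, pulling the coefficient functions out of $\langle\cdot\rangle$. OPE coefficients: for $D_1=[\nu(1,1),\dots,\nu(1,r_1)]$, $D_2=[\nu(2,1),\dots,\nu(2,r_2)]$,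 let $F_i=\{(i,j):1\le j\le r_i\}$, $i=1,2$. For $E\in\mathcal{A}^\infty$ and $u_1\ne u_2$, $$\mathcal{C}_{D_1,D_2}^E(u_1,u_2)=\sum_{\mathcal{V}}\ \prod_{(a,b)\in F_1\times F_2,\ \{a,b\}\in\mathcal{V}}C^{\nu(a),\nu(b)}(u_1,u_2)\ \sum_{\beta:F_1\setminus(\cup\mathcal{V})\to\mathbb{N}^d}\frac{(u_1-u_2)^{|\beta|}}{\beta!}\,\mathbf{1}\{(\mathcal{V},\beta)\to E\},$$ where $\mathcal{V}$ runs over sets of pairwise disjoint unordered pairs $\{a,b\}$ with $a\in F_1$, $b\in F_2$ (not necessarily perfect matchings, possibly empty), $\cup\mathcal{V}$ is the set of matched elements, $\beta!=\prod_a\beta(a)!$, $|\beta|=\sum_a\beta(a)\in\mathbb{N}^d$, and $(\mathcal{V},\beta)\to E$ means $\{G;\omega\}=E$ with $G=(F_1\cup F_2)\setminus(\cup\mathcal{V})$, $\omega(a)=\nu(a)+\beta(a)$ if $a\in F_1\setminus(\cup\mathcal{V})$ and $\omega(a)=\nu(a)$ if $a\in F_2\setminus(\cup\mathcal{V})$. *)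

(* Defs.v *)
From mathcomp Require Import all_boot all_order all_algebra.
From mathcomp Require Import finmap multiset.
From mathcomp Require Import all_classical all_reals all_analysis.

Set Implicit Arguments.
Unset Strict Implicit.
Unset Printing Implicit Defensive.

Import Order.TTheory GRing.Theory Num.Theory.
Import numFieldNormedType.Exports.

Local Open Scope classical_set_scope.
Local Open Scope ring_scope.

(* The library norm on 'rV[R]_d is the sup norm; the one used here is the
   Euclidean norm. *)
Definition enorm (R : realType) (d : nat) (x : 'rV[R]_d) : R :=
  Num.sqrt (\sum_(i < d) x 0 i ^+ 2).

Definition jbracket (R : realType) (d : nat) (x : 'rV[R]_d) : R :=
  Num.sqrt (1 + enorm x ^+ 2).

Notation mindex d := {ffun 'I_d -> nat}.

Definition mdegree (d : nat) (al : mindex d) : nat := (\sum_(i < d) al i)%N.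

Definition mfactorial (d : nat) (al : mindex d) : nat := (\prod_(i < d) (al i)`!)%N.

Definition mpower (R : realType) (d : nat) (x : 'rV[R]_d) (al : mindex d) : R :=
  \prod_(i < d) x 0 i ^+ al i.

Definition partial (R : realType) (d : nat) (i : 'I_d) (f : 'rV[R]_d -> R) :
    'rV[R]_d -> R :=
  fun x => derive f x (delta_mx 0 i).

(* Partial derivative of multiindex al, as the iterated derivative
   d_0^{al 0} (d_1^{al 1} (... f)).  It is only used on functions that are
   smooth near the point considered, where the order is irrelevant. *)
Definition mpartial (R : realType) (d : nat) (al : mindex d)
    (f : 'rV[R]_d -> R) : 'rV[R]_d -> R :=
  foldr (fun i g => iter (al i) (partial i) g) f (enum 'I_d).

(* Euler's Gamma function on the real line: the integral for z > 0, continued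
   by Gamma z = Gamma (z + n) / (z (z + 1) ... (z + n - 1)), where n is the
   least natural number such that z + n > 0.  At a pole (z = 0, -1, -2, ...)
   the division by 0 gives the value 0, so that 1 / Gamma is the usual entire
   function, also vanishing there. *)
Definition EulerGamma_pos (R : realType) (z : R) : R :=
  \int[lebesgue_measure]_(t in `]0%R, +oo[) (t `^ (z - 1) * expR (- t)).

Definition EulerGamma (R : realType) (z : R) : R :=
  if 0 < z then EulerGamma_pos z
  else let n := (Num.truncn (- z)).+1 in
       EulerGamma_pos (z + n%:R) / \prod_(k < n) (z + k%:R).

Definition kappa (R : realType) (d : nat) (phi : R) : R :=
  pi `^ (d%:R / 2) * 2 `^ (2 * phi) * EulerGamma phi
  / EulerGamma (d%:R / 2 - phi).

(* phi stands for the scaling dimension of the field. *)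
Definition cov (R : realType) (d : nat) (phi : R) (x y : 'rV[R]_d) : R :=
  kappa d phi * enorm (x - y) `^ (- (2 * phi)).

Definition dcov (R : realType) (d : nat) (phi : R) (al be : mindex d)
    (x y : 'rV[R]_d) : R :=
  mpartial al (fun x' => mpartial be (fun y' => cov phi x' y') y) x.

(* Finite tuples of multiindices modulo permutation, i.e. finite multisets.
   The coercion of a multiset to seq (enum_mset) picks one enumeration
   nu(1), ..., nu(r) of the label; the definitions below do not depend on
   which one. *)
Notation label d := ({mset (mindex d)}%mset).

Definition lrank (d : nat) (A : label d) : nat := size (enum_mset A).

Definition nu (d : nat) (A : label d) (j : 'I_(lrank A)) : mindex d :=
  tnth (in_tuple (enum_mset A)) j.

Definition scdim (R : realType) (d : nat) (phi : R) (A : label d) : R :=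
  (lrank A)%:R * phi + \sum_(j < lrank A) (mdegree (nu j))%:R.

Section Correlation.
Context (R : realType) (d : nat) (phi : R).

Definition legs (n : nat) (A : 'I_n -> label d) : finType :=
  {i : 'I_n & 'I_(lrank (A i))}.

Definition leg_nu (n : nat) (A : 'I_n -> label d) (a : legs A) : mindex d :=
  nu (tagged a).

Definition perfect_matching (F : finType) (W : {set {set F}}) : bool :=
  finset.partition W [set: F]%SET && [forall e in W, #|e| == 2%N].

Definition block (n : nat) (A : 'I_n -> label d) (i : 'I_n) : {set legs A} :=
  [set a : legs A | tag a == i]%SET.

Definition off_diag (n : nat) (A : 'I_n -> label d) (W : {set {set legs A}}) : bool :=
  [forall e in W, forall i, ~~ (e \subset block A i)].

(* In an off-diagonal matching the two legs of a pair have distinct tags, so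
   each pair {a, b} is counted once, as the ordered pair with tag a < tag b;
   the summand does not depend on the orientation since
   dcov be al y x = dcov al be x y. *)
Definition corr (n : nat) (A : 'I_n -> label d) (x : 'I_n -> 'rV[R]_d) : R :=
  \sum_(W : {set {set legs A}} | perfect_matching W && off_diag W)
    \prod_(ab : legs A * legs A
             | (tag ab.1 < tag ab.2)%N && ([set ab.1; ab.2]%SET \in W))
      dcov phi (leg_nu ab.1) (leg_nu ab.2) (x (tag ab.1)) (x (tag ab.2)).

(* A finite product of symbols O_A(x), and a finite linear combination of such
   products. *)
Definition monom : Type := seq (label d * 'rV[R]_d).
Definition lincomb : Type := seq (R * monom).

Definition lone : lincomb := [:: (1, [::])].

Definition lmul (s t : lincomb) : lincomb :=
  [seq (a.1 * b.1, a.2 ++ b.2) | a <- s, b <- t].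

Definition corr_monom (w : monom) : R :=
  corr (fun i => (tnth (in_tuple w) i).1) (fun i => (tnth (in_tuple w) i).2).

Definition corr_lin (s : lincomb) : R := \sum_(t <- s) t.1 * corr_monom t.2.

End Correlation.

Section OPECoefficients.
Context (R : realType) (d : nat) (phi : R) (D1 D2 : label d).

(* A set of pairwise disjoint unordered pairs {a, b}, a in F_1, b in F_2, is
   given by the set of the ordered pairs (a, b). *)
Definition partial_matching (V : {set 'I_(lrank D1) * 'I_(lrank D2)}) : bool :=
  [forall p in V, forall q in V,
     ((p.1 == q.1) || (p.2 == q.2)) ==> (p == q)].

Definition unmatched1 (V : {set 'I_(lrank D1) * 'I_(lrank D2)})
    (a : 'I_(lrank D1)) : bool := [forall b, (a, b) \notin V].

Definition unmatched2 (V : {set 'I_(lrank D1) * 'I_(lrank D2)})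
    (b : 'I_(lrank D2)) : bool := [forall a, (a, b) \notin V].

Definition free1 (V : {set 'I_(lrank D1) * 'I_(lrank D2)}) : finType :=
  {a : 'I_(lrank D1) | unmatched1 V a}.

(* The label {G; omega}. *)
Definition residual (V : {set 'I_(lrank D1) * 'I_(lrank D2)})
    (be : {ffun free1 V -> mindex d}) : label d :=
  seq_mset ([seq nu (val a) + be a | a : free1 V]
            ++ [seq nu b | b <- enum (unmatched2 V)]).

(* The sum over be is a finitely supported sum: the indicator vanishes for all
   but finitely many be. *)
Definition ope_coef (E : label d) (u1 u2 : 'rV[R]_d) : R :=
  \sum_(V : {set 'I_(lrank D1) * 'I_(lrank D2)} | partial_matching V)
    (\prod_(p in V) dcov phi (nu p.1) (nu p.2) u1 u2) *
    \sum_(be \in [set: {ffun free1 V -> mindex d}])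
       (mpower (u1 - u2) (\sum_(a : free1 V) be a)
        / (\prod_(a : free1 V) mfactorial (be a))%N%:R
        * (residual be == E)%:R).

End OPECoefficients.

Section Fields.
Context (R : realType) (d : nat) (phi : R).

Definition field_at (A : label d) (x : 'rV[R]_d) : lincomb R d :=
  [:: (1, [:: (A, x)])].

(* fset_set enumerates the labels of scaling dimension at most Delta, which are
   finitely many when phi > 0 (fset_set of an infinite set is empty). *)
Definition OPE (A B : label d) (Delta : R) (y x : 'rV[R]_d) : lincomb R d :=
  (1, [:: (A, y); (B, x)]) ::
  [seq (- ope_coef phi A B C y x, [:: (C, x)])
     | C <- enum_fset (fset_set [set C : label d | scdim phi C <= Delta])].

Definition CZ (B : label d) (y x : 'rV[R]_d) : lincomb R d :=
  [:: (1, [:: (B, y)]); (-1, [:: (B, x)])].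

End Fields.

(* The minimum over j != i of |x_i - x_j|, and 1 if there is no such j. *)
Definition nn_dist (R : realType) (d N : nat) (x : 'I_N -> 'rV[R]_d)
    (i : 'I_N) : R :=
  if [pick j | j != i] is Some j0
  then \big[Num.min/enorm (x i - x j0)]_(j < N | j != i) enorm (x i - x j)
  else 1.

(* Main.v *)
Require Import Defs.
From mathcomp Require Import all_boot all_order all_algebra.
From mathcomp Require Import finmap multiset.
From mathcomp Require Import all_classical all_reals all_analysis.
From mathcomp Require Import ring lra zify.

(** A correlation is a hafnian: the sum, over the pairings of the legs of the
   symbols, of products of derivatives of the kernel kappa |x - y|^(-2 phi)
   ([corr_monom_haf]).  Each factor of the correlation is a cluster: a centre
   x_i and, near it, a satellite y_i.

   Algebra.  The contractions inside a cluster are summed explicitly, as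
   partial matchings ([haf_wick]).  The legs left at the satellite are then
   only contracted with other clusters, so each may be replaced by its Taylor
   polynomial at the centre plus a remainder ([leg_weight_expand],
   [haf_expand]).  This turns O_A(y) O_B(x) into a sum of terms
   ([cluster_expand]), one for each partial matching and each choice, for every
   unmatched leg of A, of a Taylor monomial or of the remainder.  The terms
   without remainder are symbols at the centre, and their coefficients are
   those in the definition of the OPE coefficients; so the expansion subtracts
   exactly the terms without remainder of dimension at most Delta ([ope_sum]).
   A difference O_B(y) - O_B(x) is the case of a trivial second symbol, with
   Delta = [B] ([cz_remainder]).

   Gap.  If the Taylor order is large enough, every surviving term has
   dimension larger than Delta; there are finitely many terms, so the excess is
   at least some gamma > 0 ([dimension_gap]).

   Size, up to constants.  If |y_i - x_i| is at most a quarter of delta_i for all i,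
   Taylor's formula in both variables bounds the contraction of two legs of the
   clusters i and j by |y_i - x_i|^k |y_j - x_j|^k' |x_i - x_j|^(- D - D'),
   where D and D' are the dimensions of the legs, counting the orders k and k'
   of the remainders ([pairing_bound]).  As |x_i - x_j| is at least delta_i and
   delta_j, this is a product of one factor for each leg
   ([leg_weight_bound]), and so is the bound on the whole hafnian
   ([haf_bound]).  Collecting the factors of a cluster, a term of dimension D is
   at most |y - x|^(D - [A] - [B]) delta^(- D), and D may be lowered to
   Delta + gamma because |y - x| <= delta ([term_bound]).

   The clusters are treated one after the other, by multilinearity
   ([evalp_replace]), which gives the estimate with epsilon = 0
   ([cluster_product_bound]).  Finally delta_i^epsilon is at most a power of
   2 times the product of the brackets of the x_j. *)

Set Implicit Arguments.
Unset Strict Implicit.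
Unset Printing Implicit Defensive.

Import Order.TTheory GRing.Theory Num.Theory.
Import numFieldNormedType.Exports.

Local Open Scope ring_scope.

(** * Multiindices *)

Section Multiindices.
Variable d : nat.

Definition munit (i : 'I_d) : mindex d := [ffun k => (k == i : nat)].

Definition mlower (i : 'I_d) (al : mindex d) : mindex d :=
  [ffun k => (al k - (k == i))%N].

Lemma maddE (al be : mindex d) k : (al + be) k = (al k + be k)%N.
Proof. by rewrite ffunE. Qed.

Lemma mdegreeD (al be : mindex d) : mdegree (al + be) = (mdegree al + mdegree be)%N.
Proof.
by rewrite /mdegree -big_split /=; apply: eq_bigr => i _; rewrite !(maddE, ffunE).
Qed.

Lemma mdegree0 : mdegree (0 : mindex d) = 0%N.
Proof. by rewrite /mdegree big1 // => i _; rewrite ffunE. Qed.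

Lemma mdegree_munit i : mdegree (munit i) = 1%N.
Proof.
rewrite /mdegree (bigD1 i) //= ffunE eqxx big1 // => k ki.
by rewrite ffunE (negbTE ki).
Qed.

Lemma mlower_munit i (al : mindex d) : (0 < al i)%N -> mlower i al + munit i = al.
Proof.
by move=> ai; apply/ffunP => k; rewrite !(maddE, ffunE); case: eqP => [->|_] /=; lia.
Qed.

Lemma munit_mlower i (al : mindex d) : mlower i (al + munit i) = al.
Proof. by apply/ffunP => k; rewrite !(maddE, ffunE); case: (k == i) => /=; lia. Qed.

End Multiindices.

(** * Formal derivatives of the kernel *)

Section Kernel.
Variables (R : realType) (d : nat) (phi : R).
Implicit Types (z u r x y : 'rV[R]_d) (al be ga : mindex d).

Definition sqnorm z : R := \sum_(i < d) z 0 i ^+ 2.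

(** The triple (c, al, j) stands for the function c z^al |z|^(-2 (phi + j)). *)
Definition kterm : Type := (R * mindex d * nat)%type.

Definition kval (l : seq kterm) z : R :=
  \sum_(t <- l) t.1.1 * mpower z t.1.2 * sqnorm z `^ (- (phi + t.2%:R)).

(** The product rule: the first term differentiates the monomial, the second one
   the power of the norm. *)
Definition kpartial1 (i : 'I_d) (t : kterm) : seq kterm :=
  [:: (t.1.1 * (t.1.2 i)%:R, mlower i t.1.2, t.2);
      (- (2 * (phi + t.2%:R)) * t.1.1, t.1.2 + munit i, t.2.+1)].

Definition kpartial (i : 'I_d) (l : seq kterm) : seq kterm :=
  flatten (map (kpartial1 i) l).

Lemma kval_cat l1 l2 z : kval (l1 ++ l2) z = kval l1 z + kval l2 z.
Proof. by rewrite /kval big_cat. Qed.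

Lemma kval_perm l1 l2 : perm_eq l1 l2 -> kval l1 = kval l2.
Proof. by move=> l12; apply/funext => z; rewrite /kval (perm_big _ l12). Qed.

Lemma kpartial_perm i l1 l2 : perm_eq l1 l2 -> perm_eq (kpartial i l1) (kpartial i l2).
Proof. by move=> l12; rewrite perm_flatten // perm_map. Qed.

Lemma kpartial_cat i l1 l2 : kpartial i (l1 ++ l2) = kpartial i l1 ++ kpartial i l2.
Proof. by rewrite /kpartial map_cat flatten_cat. Qed.

(** The four terms of a second derivative are the same in both orders, with the
   two mixed ones exchanged. *)
Lemma kpartialC i k l :
  perm_eq (kpartial i (kpartial k l)) (kpartial k (kpartial i l)).
Proof.
have [->//|neq_ik] := eqVneq i k.
elim: l => //= t l IH.
rewrite -[kpartial k (t :: l)]/(kpartial1 k t ++ kpartial k l).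
rewrite -[kpartial i (t :: l)]/(kpartial1 i t ++ kpartial i l) !kpartial_cat.
apply: perm_cat => //; case: t => [[c al] j].
rewrite /kpartial /kpartial1 /= !(maddE, ffunE).
rewrite !(inE, (negbTE neq_ik), eq_sym k i) /= !addn0 !subn0.
set a1 := (X in [:: X; _; _; _]); set a2 := (X in [:: _; X; _; _]).
set a3 := (X in [:: _; _; X; _]); set a4 := (X in [:: _; _; _; X]).
set b1 := (X in perm_eq _ [:: X; _; _; _]); set b2 := (X in perm_eq _ [:: _; X; _; _]).
set b3 := (X in perm_eq _ [:: _; _; X; _]); set b4 := (X in perm_eq _ [:: _; _; _; X]).
have nki : (k == i) = false by rewrite eq_sym (negbTE neq_ik).
have -> : a1 = b1.
  rewrite /a1 /b1; congr (_, _, _); first by rewrite mulrAC.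
  by apply/ffunP => n; rewrite !(maddE, ffunE); lia.
have -> : a2 = b3.
  rewrite /a2 /b3; congr (_, _, _); first by ring.
  by apply/ffunP => n; rewrite !(maddE, ffunE); case: (n =P i) => [->|?] /=;
     rewrite ?(negbTE neq_ik) /=; lia.
have -> : a3 = b2.
  rewrite /a3 /b2; congr (_, _, _); first by ring.
  by apply/ffunP => n; rewrite !(maddE, ffunE); case: (n =P i) => [->|?] /=;
     rewrite ?(negbTE neq_ik) /=; lia.
have -> : a4 = b4.
  by rewrite /a4 /b4 [al + _ + _]addrAC.
rewrite perm_cons; apply/permP => p /=; lia.
Qed.

Lemma scaleRE (a b : R) : a *: (b : R^o) = a * b.
Proof. by []. Qed.

Lemma is_derive_affine (a b t : R) : is_derive t 1 (fun h => a + h * b) b.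
Proof.
have -> : (fun h => a + h * b) = cst a + (id * cst b) by [].
have D := is_deriveD (is_derive_cst a t 1)
  (is_deriveM (is_derive_id t 1) (is_derive_cst b t 1)).
by apply: (is_derive_eq D); rewrite scaler0 !add0r [_ *: _]mulr1.
Qed.

(** Stated for the product over any duplicate-free list of coordinates, to which
   the product rule applies by induction. *)
Lemma is_derive_affine_prod (s : seq 'I_d) (al : mindex d) r u (t : R) : uniq s ->
  is_derive t 1 (fun h => \prod_(l <- s) (r + h *: u) 0 l ^+ al l)
    (\sum_(k <- s) u 0 k *
       ((al k)%:R * \prod_(l <- s) (r + t *: u) 0 l ^+ mlower k al l)).
Proof.
elim: s => [_|a s IH /= /andP[a_s us]].
  rewrite big_nil (_ : (fun _ => _) = cst 1); first exact: is_derive_cst.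
  by apply/funext => h; rewrite big_nil.
rewrite (_ : (fun h => _) = (fun h => r 0 a + h * u 0 a) ^+ al a *
                            (fun h => \prod_(l <- s) (r + h *: u) 0 l ^+ al l)); last first.
  apply/funext => h; rewrite big_cons fctE exprfctE !mxE //.
have {}IH := IH us.
have D1 := is_derive_affine (r 0 a) (u 0 a) t.
have D2 := is_deriveX (al a) D1.
apply: (is_derive_eq (is_deriveM D2 IH)).
rewrite big_cons big_cons !exprfctE; rewrite addrC; congr (_ + _).
  rewrite !scaleRE !(maddE, ffunE) eqxx !mxE subn1.
  rewrite (_ : \prod_(l <- s) (r + t *: u) 0 l ^+ mlower a al l =
               \prod_(l <- s) (r + t *: u) 0 l ^+ al l); first by ring.
  apply: eq_big_seq => l ls; rewrite ffunE (_ : (l == a) = false) ?subn0 //.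
  by apply: contraNF a_s => /eqP <-.
rewrite !scaleRE mulr_sumr; apply: eq_big_seq => k ks.
rewrite big_cons ffunE (_ : (a == k) = false) ?subn0; last first.
  by apply: contraNF a_s => /eqP ->.
by rewrite !mxE; ring.
Qed.

Lemma is_derive_mpower al r u (t : R) :
  is_derive t 1 (fun h => mpower (r + h *: u) al)
    (\sum_(k < d) u 0 k * ((al k)%:R * mpower (r + t *: u) (mlower k al))).
Proof. exact: is_derive_affine_prod (index_enum_uniq _). Qed.

Lemma is_derive_sqnorm r u (t : R) :
  is_derive t 1 (fun h => sqnorm (r + h *: u))
    (\sum_(k < d) u 0 k * (2 * (r + t *: u) 0 k)).
Proof.
rewrite (_ : (fun h => _) = \sum_(k < d) (fun h => (r 0 k + h * u 0 k)) ^+ 2); last first.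
  apply/funext => h; rewrite fct_sumE /sqnorm; apply: eq_bigr => k _.
  by rewrite exprfctE !mxE.
apply: is_derive_sum => k.
have D1 := is_derive_affine (r 0 k) (u 0 k) t.
by apply: (is_derive_eq (is_deriveX 2 D1)); rewrite /= expr1 !mxE !scaleRE; ring.
Qed.

Lemma mpowerD_munit z al i : mpower z (al + munit i) = z 0 i * mpower z al.
Proof.
rewrite /mpower (bigD1 i) //= [in RHS](bigD1 i) //= !(maddE, ffunE) eqxx addn1 exprS -mulrA.
congr (_ * (_ * _)); apply: eq_bigr => k ki.
by rewrite !(maddE, ffunE) (negbTE ki) addn0.
Qed.

(** Derivatives are taken along lines: the partial derivatives of the kernel and
   the Taylor formula on a segment are both instances. *)
Lemma is_derive_kval l r u (t : R) : 0 < sqnorm (r + t *: u) ->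
  is_derive t 1 (fun h => kval l (r + h *: u))
    (\sum_(k < d) u 0 k * kval (kpartial k l) (r + t *: u)).
Proof.
move=> z0; elim: l => [|[[c al] j] l IH].
  rewrite big1 => [|k _]; last by rewrite /kval big_nil mulr0.
  rewrite (_ : (fun h => _) = cst 0); first exact: is_derive_cst.
  by apply/funext => h; rewrite /kval big_nil.
set e := - (phi + j%:R).
rewrite (_ : (fun h => _) =
   cst c * ((fun h => mpower (r + h *: u) al) *
            ((fun h => h `^ e) \o (fun h => sqnorm (r + h *: u))))
   + (fun h => kval l (r + h *: u))); last first.
  by apply/funext => h; rewrite /kval big_cons /= -/(kval _ _) -mulrA.
have Dq : is_derive t 1 ((fun h => h `^ e) \o (fun h => sqnorm (r + h *: u)))
   (e * sqnorm (r + t *: u) `^ (e - 1) * (\sum_(k < d) u 0 k * (2 * (r + t *: u) 0 k))).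
  apply: is_derive1_comp; last exact: is_derive_sqnorm.
  exact: is_derive1_powR.
have Dm := is_derive_mpower al r u t.
apply: (is_derive_eq (is_deriveD (is_deriveM (is_derive_cst c t 1) (is_deriveM Dm Dq)) IH)).
rewrite scaler0 addr0 !scaleRE mulrDr !mulr_sumr -!big_split /=.
apply: eq_bigr => k _.
rewrite -[kpartial k (_ :: _)]/(kpartial1 k (c, al, j) ++ kpartial k l) kval_cat mulrDr.
congr (_ + _); rewrite /kval /kpartial1 !big_cons big_nil /= addr0 mpowerD_munit.
rewrite (_ : - (phi + j.+1%:R) = e - 1); last by rewrite /e -natr1; ring.
by rewrite -/e /e; ring.
Qed.

End Kernel.

(** * The Euclidean norm *)

Section Norm.
Variables (R : realType) (d : nat).
Implicit Types (x y z : 'rV[R]_d).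

Lemma sqnorm_ge0 z : 0 <= sqnorm z.
Proof. by apply: sumr_ge0 => i _; exact: sqr_ge0. Qed.

Lemma sqnorm_gt0 z : z != 0 -> 0 < sqnorm z.
Proof.
move=> z0; rewrite lt0r sqnorm_ge0 andbT; apply: contraNneq z0.
move=> /eqP; rewrite psumr_eq0 => [/allP z0|i _]; last exact: sqr_ge0.
apply/eqP/rowP => i; rewrite mxE; apply/eqP.
by rewrite -sqrf_eq0; apply: z0; rewrite mem_index_enum.
Qed.

Lemma enormE z : enorm z = sqnorm z `^ 2^-1.
Proof. by rewrite powR12_sqrt // sqnorm_ge0. Qed.

Lemma enorm_ge0 z : 0 <= enorm z. Proof. exact: sqrtr_ge0. Qed.

Lemma enorm_gt0 z : z != 0 -> 0 < enorm z.
Proof. by move=> z0; rewrite sqrtr_gt0 sqnorm_gt0. Qed.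

Lemma sqr_enorm z : enorm z ^+ 2 = sqnorm z.
Proof. by rewrite sqr_sqrtr // sqnorm_ge0. Qed.

Lemma sqnormN z : sqnorm (- z) = sqnorm z.
Proof. by apply: eq_bigr => i _; rewrite mxE sqrrN. Qed.

Lemma enormN z : enorm (- z) = enorm z.
Proof. by rewrite /enorm; congr Num.sqrt; exact: sqnormN. Qed.

Lemma enormB x y : enorm (x - y) = enorm (y - x).
Proof. by rewrite -enormN opprB. Qed.

Lemma enormZ (c : R) z : enorm (c *: z) = `|c| * enorm z.
Proof.
rewrite /enorm -sqrtr_sqr -sqrtrM ?sqr_ge0 //; congr Num.sqrt.
by rewrite mulr_sumr; apply: eq_bigr => i _; rewrite mxE exprMn.
Qed.

Lemma enorm0 : enorm (0 : 'rV[R]_d) = 0.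
Proof. by rewrite /enorm big1 ?sqrtr0 // => i _; rewrite mxE expr0n. Qed.

Lemma coord_le_enorm z i : `|z 0 i| <= enorm z.
Proof.
rewrite -sqrtr_sqr ler_wsqrtr // /sqnorm (bigD1 i) //= lerDl.
by apply: sumr_ge0 => k _; exact: sqr_ge0.
Qed.

(** From the positivity of the squared norm of |x|^2 y - (x . y) x. *)
Lemma cauchy_schwarz x y :
  (\sum_(i < d) x 0 i * y 0 i) ^+ 2 <= sqnorm x * sqnorm y.
Proof.
have [->|x0] := eqVneq x 0.
  rewrite big1 => [|i _]; first by rewrite expr0n mulr_ge0 ?sqnorm_ge0.
  by rewrite mxE mul0r.
have sx := sqnorm_gt0 x0; set p := \sum_(i < d) _.
have : 0 <= sqnorm (sqnorm x *: y - p *: x) by exact: sqnorm_ge0.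
rewrite (_ : sqnorm _ = sqnorm x * (sqnorm x * sqnorm y - p ^+ 2)).
  by rewrite pmulr_rge0 // subr_ge0.
suff /(_ (sqnorm x) p) -> : forall a b : R, sqnorm (a *: y - b *: x) =
    a ^+ 2 * sqnorm y - 2 * a * b * p + b ^+ 2 * sqnorm x by ring.
move=> a b; rewrite !mulr_sumr -sumrB -big_split /=.
by apply: eq_bigr => i _; rewrite !mxE; ring.
Qed.

Lemma ler_enormD x y : enorm (x + y) <= enorm x + enorm y.
Proof.
rewrite -(@ler_pXn2r _ 2) ?nnegrE ?addr_ge0 ?enorm_ge0 //.
rewrite sqrrD !sqr_enorm.
have -> : sqnorm (x + y) = sqnorm x + (\sum_(i < d) x 0 i * y 0 i) *+ 2 + sqnorm y.
  rewrite -sumrMnl -!big_split /=; apply: eq_bigr => i _.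
  by rewrite !mxE sqrrD.
rewrite lerD2r lerD2l lerMn2r /=.
apply: le_trans (ler_norm _) _.
rewrite -(@ler_pXn2r _ 2) ?nnegrE ?mulr_ge0 ?enorm_ge0 //.
by rewrite real_normK ?num_real // exprMn !sqr_enorm cauchy_schwarz.
Qed.

Lemma ler_enormB x y : enorm (x - y) <= enorm x + enorm y.
Proof. by rewrite -(enormN y) ler_enormD. Qed.

Lemma lerB_enorm x y : enorm x - enorm y <= enorm (x + y).
Proof. by rewrite lerBlDr -{1}(addrK y x); exact: ler_enormB. Qed.

Lemma mpower_le_enorm z (al : mindex d) : `|mpower z al| <= enorm z ^+ mdegree al.
Proof.
rewrite normr_prod -prodrXr ler_prod // => i _.
by rewrite normr_ge0 normrX lerXn2r ?nnegrE ?enorm_ge0 ?coord_le_enorm.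
Qed.

Lemma mpowerD z (al be : mindex d) : mpower z (al + be) = mpower z al * mpower z be.
Proof.
by rewrite /mpower -big_split /=; apply: eq_bigr => i _; rewrite maddE exprD.
Qed.

Lemma mpower0 z : mpower z (0 : mindex d) = 1.
Proof. by rewrite /mpower big1 // => i _; rewrite ffunE. Qed.

Lemma mpowerN z (al : mindex d) : mpower (- z) al = (-1) ^+ mdegree al * mpower z al.
Proof.
rewrite /mpower -prodrXr -big_split /=; apply: eq_bigr => i _.
rewrite mxE [LHS]exprNn. reflexivity.
Qed.

End Norm.

(** * Derivatives of the covariance *)

Section KernelDerivatives.
Variables (R : realType) (d : nat) (phi : R).
Implicit Types (z u r x y : 'rV[R]_d) (al be ga : mindex d) (l : seq (kterm R d)).

Definition kmpartial al l : seq (kterm R d) :=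
  foldr (fun i g => iter (al i) (kpartial phi i) g) l (enum 'I_d).

Lemma iter_kpartial_perm i n l1 l2 : perm_eq l1 l2 ->
  perm_eq (iter n (kpartial phi i) l1) (iter n (kpartial phi i) l2).
Proof. by move=> l12; elim: n => //= n IH; exact: kpartial_perm. Qed.

Lemma iter_kpartialC i k n l :
  perm_eq (kpartial phi k (iter n (kpartial phi i) l))
          (iter n (kpartial phi i) (kpartial phi k l)).
Proof.
elim: n => //= n IH; apply: perm_trans (kpartialC _ _ _ _) _.
exact: kpartial_perm.
Qed.

(** Iterated derivatives are taken in a fixed order of the coordinates; one more
   derivative moves to its place because formal derivatives commute. *)
Lemma kpartial_kmpartial i al l :
  perm_eq (kpartial phi i (kmpartial al l)) (kmpartial (al + munit i) l).
Proof.
rewrite /kmpartial; have := mem_enum 'I_d i; have := enum_uniq 'I_d.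
elim: (enum 'I_d) => //= k s IH /andP[ks us]; rewrite inE /=.
have [->{IH} _|neq_ik /= si] := eqVneq i k.
  rewrite maddE ffunE eqxx addn1 iterS; apply/kpartial_perm/iter_kpartial_perm.
  elim: s ks {us} => //= j s IH; rewrite inE negb_or => /andP[kj ks].
  rewrite maddE ffunE eq_sym (negbTE kj) addn0.
  by apply: iter_kpartial_perm; exact: IH.
rewrite maddE ffunE eq_sym (negbTE neq_ik) addn0.
apply: perm_trans (iter_kpartialC _ _ _ _) _.
by apply/iter_kpartial_perm/IH.
Qed.

Lemma iter_kpartial_kmpartial i n al l :
  perm_eq (iter n (kpartial phi i) (kmpartial al l)) (kmpartial (al + munit i *+ n) l).
Proof.
elim: n => [|n IH] /=; first by rewrite mulr0n addr0.
apply: perm_trans (kpartial_perm _ _ IH) _.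
by rewrite mulrSr addrA; exact: kpartial_kmpartial.
Qed.

Lemma mindex_sum_munit al : al = \sum_(i < d) munit i *+ al i.
Proof.
apply/ffunP => k; rewrite sum_ffunE (bigD1 k) //= big1 ?addr0 => [|i ik].
  by rewrite ffunMnE ffunE eqxx [RHS]natn.
by rewrite ffunMnE ffunE eq_sym (negbTE ik) mul0rn.
Qed.

Lemma kmpartialD al be l :
  perm_eq (kmpartial al (kmpartial be l)) (kmpartial (al + be) l).
Proof.
rewrite {2}(mindex_sum_munit al) -big_enum /= {1}/kmpartial.
elim: (enum 'I_d) => [|i s IH] /=; first by rewrite big_nil add0r.
rewrite big_cons -addrA [munit i *+ _ + _]addrC.
apply: perm_trans (iter_kpartial_perm _ _ IH) _.
exact: iter_kpartial_kmpartial.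
Qed.

Lemma derive_line (f : 'rV[R]_d -> R) x v :
  'D_v f x = 'D_1 (fun h : R => f (x + h *: v)) 0.
Proof.
rewrite /derive; set f1 := fun h => h^-1 *: _; set f2 := fun h => h^-1 *: _.
suff -> : f1 = f2 by [].
apply/funext => h; rewrite /f1 /f2 /=.
by rewrite scale0r !addr0 [_%:A]mulr1 [h *: v + x]addrC.
Qed.

Lemma near_neq x y : x != y -> \near x, x != y.
Proof.
move=> xy; have : open (~` [set y])%classic.
  exact/closed_openC/accessible_closed_set1/hausdorff_accessible/norm_hausdorff.
rewrite openE => /(_ x); rewrite /interior /=.
by move=> /(_ (elimN eqP xy)); apply: filterS => z /eqP.
Qed.

(** Off its centre, a function of this form stays of this form under every
   partial derivative, so its iterated derivatives are read off the formal
   ones.  The scale s = - 1 is the case of the second argument of the kernel. *)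
Lemma partial_kval (f : 'rV[R]_d -> R) (c s : R) x0 l i : s != 0 ->
  (forall z, z != x0 -> f z = c * kval phi l (s *: (z - x0))) ->
  forall z, z != x0 ->
    partial i f z = c * s * kval phi (kpartial phi i l) (s *: (z - x0)).
Proof.
move=> s0 fE z zx0; rewrite /partial.
rewrite (@near_eq_derive _ _ _ _ (fun z => c * kval phi l (s *: (z - x0)))); last first.
  by apply: filterS (near_neq zx0) => z' /fE.
rewrite derive_line.
have -> : (fun h : R => c * kval phi l (s *: (z + h *: delta_mx 0 i - x0))) =
   cst c * (fun h => kval phi l (s *: (z - x0) + h *: (s *: delta_mx 0 i))).
  apply/funext => h /=; congr (_ * kval _ _ _).
  by rewrite addrAC scalerDr !scalerA [h * s]mulrC.
have z0 : 0 < sqnorm (s *: (z - x0) + 0 *: (s *: delta_mx 0 i)).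
  by rewrite scale0r addr0 sqnorm_gt0 // scaler_eq0 negb_or s0 subr_eq0.
have Dk := is_deriveM (is_derive_cst c (0 : R) 1) (is_derive_kval phi l z0).
rewrite (@derive_val _ _ _ _ _ _ _ Dk) scaler0 addr0 scale0r addr0 (bigD1 i) //= big1 => [|k ki].
  by rewrite !mxE !eqxx addr0 mulr1 /cst !scaleRE mulrA.
by rewrite !mxE (negbTE ki) andbF mulr0 mul0r.
Qed.

Lemma mpartial_kval (f : 'rV[R]_d -> R) (c s : R) x0 l al : s != 0 ->
  (forall z, z != x0 -> f z = c * kval phi l (s *: (z - x0))) ->
  forall z, z != x0 ->
    mpartial al f z = c * s ^+ mdegree al * kval phi (kmpartial al l) (s *: (z - x0)).
Proof.
move=> s0 fE; rewrite /mpartial /kmpartial /mdegree -big_enum /=.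
elim: (enum 'I_d) => [|i e IH] /=; first by rewrite big_nil expr0 mulr1.
rewrite big_cons addnC exprD mulrA.
elim: (al i) => [|n IHn] /=; first by rewrite expr0 mulr1.
move=> z zx; rewrite (partial_kval i s0 IHn zx) exprSr mulrA //.
Qed.

Definition dkernel ga : seq (kterm R d) := kmpartial ga [:: (kappa d phi, 0, 0%N)].

Lemma cov_kval x y : x != y -> cov phi x y = kval phi [:: (kappa d phi, 0, 0%N)] (x - y).
Proof.
move=> xy; rewrite /cov /kval big_seq1 /= mpower0 mulr1 addr0 enormE -powRrM.
by congr (_ * _ `^ _); field.
Qed.

(** The kernel only depends on the difference of its arguments, so a derivative in
   the second one is minus a derivative in the first one. *)
Lemma dcovE nu mu x y : x != y ->
  dcov phi nu mu x y = (-1) ^+ mdegree mu * kval phi (dkernel (nu + mu)) (x - y).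
Proof.
move=> xy; rewrite /dcov.
have inner x' : x' != y -> mpartial mu (fun y' => cov phi x' y') y =
    (-1) ^+ mdegree mu * kval phi (dkernel mu) (1 *: (x' - y)).
  move=> x'y; rewrite (@mpartial_kval _ 1 (-1) x' [:: (kappa d phi, 0, 0%N)]).
  - by rewrite mul1r scaleN1r opprB scale1r.
  - by rewrite oppr_eq0 oner_eq0.
  - by move=> z zx'; rewrite mul1r scaleN1r opprB cov_kval // eq_sym.
  - by rewrite eq_sym.
rewrite (mpartial_kval nu (oner_neq0 _) inner xy) expr1n mulr1 scale1r.
by rewrite (kval_perm _ (kmpartialD nu mu _)).
Qed.

(** Homogeneity of degree - 2 phi - n; terms whose coefficient vanishes are
   allowed to have the wrong degree. *)
Definition khomogeneous (n : nat) l : bool :=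
  all (fun t => (t.1.1 == 0) || (mdegree t.1.2 + n == 2 * t.2)%N) l.

Lemma khomogeneous_partial n l i :
  khomogeneous n l -> khomogeneous n.+1 (kpartial phi i l).
Proof.
rewrite /khomogeneous; elim: l => //= -[[c al] j] l IH /andP[/= h /IH].
rewrite -/(kpartial phi i l) => ->; rewrite mdegreeD mdegree_munit.
case/orP: h => [/eqP->|/eqP h]; first by rewrite mul0r mulr0 eqxx.
rewrite andbT; apply/andP; split; last by apply/orP; right; apply/eqP; lia.
case: (posnP (al i)) => [->|ai]; first by rewrite mulr0 eqxx.
apply/orP; right; apply/eqP; have := mdegreeD (mlower i al) (munit i).
by rewrite mlower_munit // mdegree_munit; lia.
Qed.

Lemma khomogeneous_dkernel ga : khomogeneous (mdegree ga) (dkernel ga).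
Proof.
rewrite /dkernel /kmpartial /mdegree -big_enum /=.
elim: (enum 'I_d) => [|i s IH] /=.
  by rewrite big_nil mdegree0 /= orbT.
rewrite big_cons; elim: (ga i) => //= n IHn; rewrite addSn.
exact: khomogeneous_partial.
Qed.

(** The norm is even, and the monomials of a homogeneous list all have the parity
   of n. *)
Lemma kvalN n l z : khomogeneous n l -> kval phi l (- z) = (-1) ^+ n * kval phi l z.
Proof.
rewrite /kval; elim: l => [_|[[c al] j] l IH /= /andP[h /IH]].
  by rewrite !big_nil mulr0.
rewrite !big_cons /= => ->; rewrite mulrDr; congr (_ + _).
case/orP: h => [/eqP->|/eqP h]; first by rewrite !mul0r mulr0.
rewrite sqnormN mpowerN !mulrA; congr (_ * _ * _).
rewrite mulrC; congr (_ * _); rewrite -signr_odd -[in RHS]signr_odd.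
have := congr1 odd h; rewrite oddD mul2n odd_double.
by case: (odd _); case: (odd _).
Qed.

Lemma kval_bound n l z : khomogeneous n l -> z != 0 ->
  `|kval phi l z| <= (\sum_(t <- l) `|t.1.1|) * enorm z `^ (- (2 * phi + n%:R)).
Proof.
move=> + z0; rewrite /kval; elim: l => [_|[[c al] j] l IH /= /andP[h /IH {}IH]].
  by rewrite !big_nil normr0 mul0r.
rewrite !big_cons /= mulrDl; apply: le_trans (ler_normD _ _) _; apply: lerD IH.
rewrite !normrM (ger0_norm (powR_ge0 _ _)).
case/orP: h => [/eqP->|/eqP h]; first by rewrite normr0 !mul0r.
rewrite -mulrA ler_wpM2l //.
apply: le_trans (ler_wpM2r (powR_ge0 _ _) (mpower_le_enorm z al)) _.
have ez := enorm_gt0 z0.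
rewrite -sqr_enorm -powR_mulrn ?enorm_ge0 // -[enorm z ^+ 2]powR_mulrn ?enorm_ge0 //.
rewrite -powRrM -powRD ?(gt_eqF ez) ?implybT //.
rewrite (_ : mdegree al = (2 * j - n)%N); last by lia.
rewrite natrB; last by lia.
by rewrite natrM le_eqVlt; apply/orP; left; apply/eqP; congr (_ `^ _); ring.
Qed.

Lemma dcovC nu mu x y : x != y -> dcov phi nu mu x y = dcov phi mu nu y x.
Proof.
move=> xy; have yx : y != x by rewrite eq_sym.
rewrite (dcovE nu mu xy) (dcovE mu nu yx).
rewrite -[y - x]opprB (kvalN _ (khomogeneous_dkernel _)) addrC mdegreeD.
rewrite exprD mulrA; congr (_ * _).
by rewrite mulrCA -expr2 sqrr_sign mulr1.
Qed.

Definition dcov_const nu mu : R := \sum_(t <- dkernel (nu + mu)) `|t.1.1|.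

Lemma dcov_const_ge0 nu mu : 0 <= dcov_const nu mu.
Proof. exact: sumr_ge0. Qed.

Lemma dcov_bound nu mu x y : x != y ->
  `|dcov phi nu mu x y| <= dcov_const nu mu *
    enorm (x - y) `^ (- (2 * phi + (mdegree nu)%:R + (mdegree mu)%:R)).
Proof.
move=> xy; rewrite (dcovE nu mu xy) normrM normrX normrN1 expr1n mul1r.
apply: le_trans (kval_bound (khomogeneous_dkernel _) _) _; first by rewrite subr_eq0.
by rewrite mdegreeD natrD addrA.
Qed.

Lemma near_line_neq x u y (t : R) : x + t *: u != y -> \near t, x + t *: u != y.
Proof.
move=> xy; have cvg_line : (x + h *: u @[h --> t] --> x + t *: u)%classic.
  by apply: cvgD; [exact: cvg_cst|apply: cvgZr_tmp; exact: cvg_id].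
exact: (cvg_line _ (near_neq xy)).
Qed.

Lemma is_derive_dcov nu mu x u y (t : R) : x + t *: u != y ->
  is_derive t 1 (fun h => dcov phi nu mu (x + h *: u) y)
    (\sum_(k < d) u 0 k * dcov phi (nu + munit k) mu (x + t *: u) y).
Proof.
move=> xy; pose c : R := (-1) ^+ mdegree mu.
have nz : 0 < sqnorm ((x - y) + t *: u).
  by rewrite sqnorm_gt0 // addrAC subr_eq0.
have Dk := is_deriveM (is_derive_cst (c : R) t 1) (is_derive_kval phi (dkernel (nu + mu)) nz).
apply: (near_eq_is_derive (f := cst c * (fun h => kval phi (dkernel (nu + mu)) (x - y + h *: u)))).
  by apply: filterS (near_line_neq xy) => h hy; rewrite (dcovE nu mu hy) addrAC.
apply: (is_derive_eq Dk); rewrite scaler0 addr0 /cst !scaleRE mulr_sumr.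
apply: eq_bigr => k _; rewrite (dcovE _ mu xy) mulrCA addrAC.
congr (_ * (_ * _)); rewrite [in RHS]addrAC.
by rewrite (kval_perm _ (kpartial_kmpartial _ _ _)).
Qed.

Lemma is_derive_dcov_r nu mu x u y (t : R) : x + t *: u != y ->
  is_derive t 1 (fun h => dcov phi mu nu y (x + h *: u))
    (\sum_(k < d) u 0 k * dcov phi mu (nu + munit k) y (x + t *: u)).
Proof.
move=> xy; apply: (near_eq_is_derive (f := fun h : R => dcov phi nu mu (x + h *: u) y)).
  by apply: filterS (near_line_neq xy) => h hy; rewrite (dcovC nu mu hy).
apply: (is_derive_eq (is_derive_dcov nu mu xy)); apply: eq_bigr => k _.
by rewrite (dcovC _ mu xy).
Qed.

End KernelDerivatives.

(** * Taylor's formula *)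

Section Taylor1.
Variable R : realType.

(** By induction: the difference between f 0 and its Taylor polynomial vanishes at
   0, and its derivative is the same difference for f 1, so that the mean value
   theorem applies. *)
Lemma taylor_bound1 (n : nat) (f : nat -> R -> R) (M : R) :
  (forall k (t : R), (k < n)%N -> 0 <= t <= 1 -> is_derive t 1 (f k) (f k.+1 t)) ->
  (forall t : R, 0 <= t <= 1 -> `|f n t| <= M) ->
  forall t : R, 0 <= t <= 1 ->
    `|f 0%N t - \sum_(k < n) f k 0 * (t ^+ k / k`!%:R)| <= M.
Proof.
elim: n f => [|n IH] f fD fM t t01.
  by rewrite big_ord0 subr0 fM.
pose h (k : nat) (s : R) := f k.+1 0 * (s ^+ k.+1 / k.+1`!%:R).
pose g (s : R) := f 0%N s - (f 0%N 0 + \sum_(k < n) h k s).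
pose dg (s : R) := f 1%N s - \sum_(k < n) f k.+1 0 * (s ^+ k / k`!%:R).
have hD k (s : R) : is_derive s 1 (h k) (f k.+1 0 * (s ^+ k / k`!%:R)).
  have -> : h k = cst (f k.+1 0 / k.+1`!%:R) * (id ^+ k.+1).
    apply/funext => z; rewrite /h -[RHS]/(_ * (id ^+ k.+1) z) exprfctE /cst.
    by rewrite mulrA mulrAC.
  have D := is_deriveM (is_derive_cst (f k.+1 0 / k.+1`!%:R) s 1)
              (is_deriveX k.+1 (is_derive_id s 1)).
  apply: (is_derive_eq D); rewrite scaler0 addr0 !scaleRE mulr1 /cst factS natrM /=.
  have : (k`!%:R : R) != 0 by rewrite pnatr_eq0 -lt0n fact_gt0.
  have : (k.+1%:R : R) != 0 by rewrite pnatr_eq0.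
  by move: (k.+1%:R : R) (k`!%:R : R) => a b a0 b0; field; rewrite a0 b0.
have gD (s : R) : 0 <= s <= 1 -> is_derive s 1 g (dg s).
  move=> s01.
  have -> : g = f 0%N - (cst (f 0%N 0) + \sum_(k < n) h k).
    by apply/funext => z; rewrite /g fctE /= fct_sumE.
  have D := is_deriveB (fD 0%N s isT s01)
    (is_deriveD (is_derive_cst (f 0%N 0) s 1)
       (is_derive_sum (fun k : 'I_n => hD k s))).
  by apply: (is_derive_eq D); rewrite add0r.
have t0 : 0 <= t by case/andP: t01.
have sub (s : R) : s \in `[0, t] -> 0 <= s <= 1.
  rewrite in_itv /= => /andP[-> st] /=.
  by apply: le_trans st _; case/andP: t01.
have [||s /sub s01 eg] := @MVT_segment _ g dg 0 t t0.
- move=> s; rewrite in_itv /= => /andP[/ltW s0 /ltW st]; apply: gD.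
  by apply: sub; rewrite in_itv /= s0.
- apply: derivable_within_continuous => s /sub /gD Dg.
  by case: Dg.
have g0 : g 0 = 0.
  rewrite /g big1 => [|k _]; first by rewrite addr0 subrr.
  by rewrite /h expr0n mul0r mulr0.
rewrite big_ord_recl expr0 fact0 divr1 mulr1 -/(g t).
move: eg; rewrite g0 !subr0 => ->.
rewrite normrM; apply: le_trans (_ : M * 1 <= _); last by rewrite mulr1.
apply: ler_pM => //.
  apply: (IH (fun k => f k.+1)) => // k z kn z01; exact: fD.
by rewrite ger0_norm //; case/andP: t01.
Qed.

End Taylor1.

Section MultiindexLists.
Variable d : nat.
Implicit Types al be : mindex d.

(** The coordinates of a multiindex of degree k are at most k, whence this
   enumeration. *)
Definition mcomp (k : nat) : seq (mindex d) :=
  [seq al <- [seq [ffun i => val (b i)] | b : {ffun 'I_d -> 'I_k.+1}]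
     | mdegree al == k].

Lemma coord_le_mdegree al i : (al i <= mdegree al)%N.
Proof. by rewrite /mdegree (bigD1 i) //= leq_addr. Qed.

Lemma mem_mcomp k al : (al \in mcomp k) = (mdegree al == k).
Proof.
rewrite mem_filter andb_idr // => /eqP dk.
apply/mapP; exists [ffun i => inord (al i)]; first by rewrite mem_enum.
by apply/ffunP => i; rewrite !ffunE /= inordK // ltnS -dk coord_le_mdegree.
Qed.

Lemma mcomp_uniq k : uniq (mcomp k).
Proof.
apply: filter_uniq; rewrite map_inj_uniq ?enum_uniq // => b b' /ffunP bb'.
by apply/ffunP => i; apply: val_inj; have := bb' i; rewrite !ffunE.
Qed.

Definition mcomp_le (n : nat) : seq (mindex d) :=
  flatten [seq mcomp k | k <- iota 0 n.+1].

Lemma mem_mcomp_le n al : (al \in mcomp_le n) = (mdegree al <= n)%N.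
Proof.
apply/flattenP/idP => [[s /mapP[k]]|aln].
  by rewrite mem_iota /= add0n ltnS => kn -> ; rewrite mem_mcomp => /eqP->.
exists (mcomp (mdegree al)); last by rewrite mem_mcomp.
by apply/mapP; exists (mdegree al); rewrite // mem_iota /= add0n ltnS.
Qed.

Lemma mcomp_le0 n : 0 \in mcomp_le n.
Proof. by rewrite mem_mcomp_le mdegree0. Qed.

Lemma mcomp_le_uniq n : uniq (mcomp_le n).
Proof.
rewrite /mcomp_le; have := iota_uniq 0 n.+1; elim: (iota _ _) => //= k s IH /andP[ks us].
rewrite cat_uniq mcomp_uniq IH // andbT; apply/hasPn => al /flattenP[t /mapP[j js ->]].
rewrite !mem_mcomp => /eqP alj; apply: contra ks => /eqP <-.
by rewrite alj.
Qed.

Lemma mfactorial_gt0 al : (0 < mfactorial al)%N.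
Proof. by apply: prodn_gt0 => i; exact: fact_gt0. Qed.

Lemma mfactorialD_munit al i : mfactorial (al + munit i) = ((al i).+1 * mfactorial al)%N.
Proof.
rewrite /mfactorial (bigD1 i) //= [in RHS](bigD1 i) //= maddE ffunE eqxx addn1 factS.
rewrite -mulnA; congr (_ * (_ * _))%N; apply: eq_bigr => k ki.
by rewrite maddE ffunE (negbTE ki) addn0.
Qed.

Lemma mcomp_munit k (i : 'I_d) :
  perm_eq [seq be <- mcomp k.+1 | (0 < (be : mindex d) i)%N]
          [seq al + munit i | al <- mcomp k].
Proof.
apply: uniq_perm; first by rewrite filter_uniq ?mcomp_uniq.
  by rewrite map_inj_uniq ?mcomp_uniq //; apply: can_inj (munit_mlower i).
move=> be; rewrite mem_filter mem_mcomp; apply/andP/mapP => [[bi /eqP db]|[al]].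
  exists (mlower i be); last by rewrite mlower_munit.
  rewrite mem_mcomp -eqSS -db -[in X in _ == X](mlower_munit bi).
  by rewrite mdegreeD mdegree_munit addn1.
rewrite mem_mcomp => /eqP <- ->.
by rewrite maddE ffunE eqxx addn1 mdegreeD mdegree_munit addn1.
Qed.

End MultiindexLists.

Section Taylor.
Variables (R : realType) (d : nat).
Implicit Types (x u : 'rV[R]_d) (al be ga nu : mindex d).

(** The multinomial recursion behind the Taylor formula: each multiindex of
   degree k + 1 is reached from degree k by raising one of its coordinates. *)
Lemma sum_mcompS (k : nat) (G : mindex d -> R) :
  \sum_(al <- mcomp d k) (\sum_(i < d) G (al + munit i)) / (mfactorial al)%:R =
  k.+1%:R * \sum_(be <- mcomp d k.+1) G be / (mfactorial be)%:R.
Proof.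
transitivity (\sum_(i < d) \sum_(al <- mcomp d k) G (al + munit i) / (mfactorial al)%:R).
  by rewrite exchange_big; apply: eq_bigr => al _; rewrite mulr_suml.
transitivity (\sum_(i < d) \sum_(be <- mcomp d k.+1) (be i)%:R * (G be / (mfactorial be)%:R)).
  apply: eq_bigr => i _.
  rewrite [RHS](bigID (fun be : mindex d => (0 < be i)%N)) /= [X in _ + X]big1 ?addr0.
    rewrite -[RHS]big_filter (perm_big _ (mcomp_munit k i)) big_map.
    apply: eq_bigr => al _; rewrite mfactorialD_munit maddE ffunE eqxx addn1 natrM.
    have : ((mfactorial al)%:R : R) != 0 by rewrite pnatr_eq0 -lt0n mfactorial_gt0.
    have : ((al i).+1%:R : R) != 0 by rewrite pnatr_eq0.
    move: ((al i).+1%:R : R) ((mfactorial al)%:R : R) => a b a0 b0.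
    by field; rewrite a0 b0.
  by move=> be; rewrite -leqNgt leqn0 => /eqP->; rewrite mul0r.
rewrite exchange_big mulr_sumr; apply: eq_big_seq => be.
by rewrite mem_mcomp => /eqP <-; rewrite -mulr_suml -natr_sum.
Qed.

Definition taylor_coef u al : R := mpower u al / (mfactorial al)%:R.

Lemma taylor_coef_bound u al : `|taylor_coef u al| <= enorm u ^+ mdegree al.
Proof.
rewrite normrM normfV normr_nat; apply: le_trans (mpower_le_enorm u al).
by rewrite ler_pdivrMr ?ltr0n ?mfactorial_gt0 // ler_peMr // ler1n mfactorial_gt0.
Qed.

Definition taylor_const (n : nat) : R := n`!%:R * (size (mcomp d n))%:R.

Lemma taylor_const_ge0 n : 0 <= taylor_const n.
Proof. by rewrite mulr_ge0. Qed.

(** The restriction to the segment from x to x + u reduces this to one variable.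
   A family Psi stands for a function together with its derivatives: for
   contractions with a second leg these are known in closed form. *)
Lemma taylor_bound (Psi : mindex d -> 'rV[R]_d -> R) nu x u (n : nat) (M : R) :
  (forall ga (t : R), 0 <= t <= 1 ->
     is_derive t 1 (fun h => Psi ga (x + h *: u))
       (\sum_(i < d) u 0 i * Psi (ga + munit i) (x + t *: u))) ->
  (forall al (t : R), mdegree al = n.+1 -> 0 <= t <= 1 -> `|Psi (nu + al) (x + t *: u)| <= M) ->
  `|Psi nu (x + u) - \sum_(al <- mcomp_le d n) taylor_coef u al * Psi (nu + al) x|
    <= taylor_const n.+1 * enorm u ^+ n.+1 * M.
Proof.
move=> PsiD PsiM.
pose f (k : nat) (t : R) := k`!%:R *
  \sum_(al <- mcomp d k) taylor_coef u al * Psi (nu + al) (x + t *: u).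
have fD k (t : R) : (k < n.+1)%N -> 0 <= t <= 1 -> is_derive t 1 (f k) (f k.+1 t).
  move=> _ t01; rewrite /f.
  suff D s : is_derive t 1
     (fun h => \sum_(al <- s) taylor_coef u al * Psi (nu + al) (x + h *: u))
     (\sum_(al <- s) (\sum_(i < d) mpower u (al + munit i) *
         Psi (nu + (al + munit i)) (x + t *: u)) / (mfactorial al)%:R).
    have D' := is_deriveM (is_derive_cst (k`!%:R : R) t 1) (D (mcomp d k)).
    apply: (is_derive_eq D'); rewrite scaler0 addr0 !scaleRE.
    rewrite (sum_mcompS k (fun be => mpower u be * Psi (nu + be) (x + t *: u))).
    rewrite mulrA -natrM mulnC -factS; congr (_ * _).
    by apply: eq_bigr => be _; rewrite /taylor_coef mulrAC.
  elim: s => [|al s IH].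
    rewrite big_nil (_ : (fun h => _) = cst 0); first exact: is_derive_cst.
    by apply/funext => h; rewrite big_nil.
  rewrite big_cons.
  have -> : (fun h : R => \sum_(be <- al :: s) taylor_coef u be * Psi (nu + be) (x + h *: u)) =
    cst (taylor_coef u al) * (fun h => Psi (nu + al) (x + h *: u)) +
    (fun h => \sum_(be <- s) taylor_coef u be * Psi (nu + be) (x + h *: u)).
    by apply/funext => h; rewrite big_cons.
  apply: (is_derive_eq (is_deriveD
    (is_deriveM (is_derive_cst (taylor_coef u al) t 1) (PsiD (nu + al) t t01)) IH)).
  rewrite scaler0 addr0 !scaleRE; congr (_ + _).
  rewrite /taylor_coef /cst mulr_sumr mulr_suml; apply: eq_bigr => i _.
  by rewrite mpowerD_munit addrA; ring.
have M_ge0 : (mcomp d n.+1 != [::]) -> 0 <= M.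
  case E : (mcomp d n.+1) => [//|al s] _.
  have : al \in mcomp d n.+1 by rewrite E mem_head.
  rewrite mem_mcomp => /eqP al_n.
  by apply: le_trans (PsiM al 0 al_n _); rewrite // lexx ler01.
have fM (t : R) : 0 <= t <= 1 -> `|f n.+1 t| <= taylor_const n.+1 * enorm u ^+ n.+1 * M.
  move=> t01; rewrite /f normrM normr_nat /taylor_const -!mulrA ler_wpM2l //.
  apply: le_trans (ler_norm_sum _ _ _) _.
  have -> : (size (mcomp d n.+1))%:R * (enorm u ^+ n.+1 * M) =
            \sum_(al <- mcomp d n.+1) (enorm u ^+ n.+1 * M).
    by rewrite big_const_seq count_predT iter_addr_0 mulr_natl.
  rewrite big_seq_cond [leRHS]big_seq_cond; apply: ler_sum => al.
  rewrite andbT mem_mcomp => /eqP al_n.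
  rewrite normrM ler_pM //; last exact: PsiM.
  by rewrite -al_n taylor_coef_bound.
have := taylor_bound1 fD fM (t := 1); rewrite ler01 lexx => /(_ isT).
congr (`|_ - _| <= _).
  rewrite /f fact0 mul1r scale1r.
  have -> : mcomp d 0 = [:: 0].
    apply: perm_small_eq => //; apply: uniq_perm => // [|al]; first exact: mcomp_uniq.
    rewrite mem_mcomp inE; apply/eqP/eqP => [al0|->]; last exact: mdegree0.
    apply/ffunP => i; rewrite ffunE; apply/eqP; rewrite -leqn0 -al0.
    exact: coord_le_mdegree.
  rewrite big_seq1 addr0 /taylor_coef mpower0 /mfactorial big1 ?divr1 ?mul1r // => i _.
  by rewrite ffunE.
rewrite /mcomp_le -(big_mkord predT (fun k => f k 0 * (1 ^+ k / k`!%:R))) big_flatten big_map.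
rewrite /index_iota subn0; apply: eq_bigr => k _.
by rewrite /f expr1n scale0r addr0 mul1r mulrAC mulfV ?mul1r.
Qed.

End Taylor.

(** * Contraction of two clusters *)

Section Legs.
Variables (R : realType) (d : nat) (phi : R) (N : nat).
Hypothesis phi_gt0 : 0 < phi.
Implicit Types (x y u z : 'rV[R]_d) (al be ga nu mu : mindex d).

Lemma ler_powRN (a b e : R) : 0 < a -> a <= b -> 0 <= e -> b `^ (- e) <= a `^ (- e).
Proof.
move=> a0 ab e0; have b0 : 0 < b by apply: lt_le_trans ab.
rewrite !powRN lef_pV2 ?posrE ?powR_gt0 //.
by apply: ge0_ler_powR; rewrite // nnegrE ltW.
Qed.

Lemma ler_sum_mem (T : eqType) (s : seq T) (F : T -> R) a :
  a \in s -> (forall b, 0 <= F b) -> F a <= \sum_(b <- s) F b.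
Proof.
move=> a_s F0; rewrite (perm_big _ (perm_to_rem a_s)) big_cons lerDl.
by apply: sumr_ge0.
Qed.

(** The four kinds of legs of a symbol placed near the centre x of a cluster
   with satellite y: a leg at the centre; the Taylor remainder of a leg at the
   satellite; a leg at the satellite that is not contracted within its
   cluster; and a leg at the satellite that may be contracted with a leg at the
   centre.  The kinds at most 1 are those left after expansion of the cluster. *)
Definition Kcentre := 0%N.
Definition Kremainder := 1%N.
Definition Kwick := 2%N.
Definition Kraw := 3%N.

(** A leg acts on functions on space as a finite combination (c, nu, z) of
   derivatives c d^nu at points z. *)
Definition leg_rep x y nu (K : nat) : seq (R * mindex d * 'rV[R]_d) :=
  if K == Kcentre then [:: (1, nu, x)]
  else if K == Kremainder then
    (1, nu, y) :: [seq (- taylor_coef (y - x) al, nu + al, x) | al <- mcomp_le d N]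
  else [:: (1, nu, y)].

Definition pairing (s t : seq (R * mindex d * 'rV[R]_d)) : R :=
  \sum_(a <- s) \sum_(b <- t) a.1.1 * b.1.1 * dcov phi a.1.2 b.1.2 a.2 b.2.

Definition korder (K : nat) : nat := if K == Kremainder then N.+1 else 0%N.

Definition kconst (K : nat) : R := if K == Kremainder then taylor_const R d N.+1 else 1.

Lemma kconst_ge0 K : 0 <= kconst K.
Proof. by rewrite /kconst; case: ifP => // _; exact: taylor_const_ge0. Qed.

(** A leg at the centre counts as a remainder of order 0, so that both kinds obey
   the same bound. *)
Lemma leg_rep_bound (Psi : mindex d -> 'rV[R]_d -> R) nu x y K (M : R) :
  (K <= 1)%N ->
  (forall ga (t : R), 0 <= t <= 1 ->
     is_derive t 1 (fun h => Psi ga (x + h *: (y - x)))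
       (\sum_(i < d) (y - x) 0 i * Psi (ga + munit i) (x + t *: (y - x)))) ->
  (forall al (t : R), mdegree al = korder K -> 0 <= t <= 1 ->
     `|Psi (nu + al) (x + t *: (y - x))| <= M) ->
  `|\sum_(a <- leg_rep x y nu K) a.1.1 * Psi a.1.2 a.2|
    <= kconst K * enorm (y - x) ^+ korder K * M.
Proof.
case: K => [|[|//]] _ PsiD PsiM; rewrite /leg_rep /kconst /=.
  rewrite big_seq1 mul1r expr0 !mul1r.
  have := PsiM 0 0 (mdegree0 d); rewrite lexx ler01 scale0r !addr0; exact.
rewrite big_cons big_map /= mul1r.
have := taylor_bound PsiD PsiM; rewrite (addrC x) subrK; congr (`|_ + _| <= _).
by rewrite -sumrN; apply: eq_bigr => al _; rewrite mulNr.
Qed.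

(** The power of 2 is there because points of two clusters may be at only half
   the distance of the centres. *)
Definition edge_const nu K mu K' : R :=
  kconst K * kconst K' *
  (\sum_(al <- mcomp d (korder K)) \sum_(be <- mcomp d (korder K'))
     dcov_const phi (nu + al) (mu + be)) *
  2 `^ (2 * phi + (mdegree nu + korder K)%:R + (mdegree mu + korder K')%:R).

Lemma edge_const_ge0 nu K mu K' : 0 <= edge_const nu K mu K'.
Proof.
rewrite !mulr_ge0 ?kconst_ge0 ?powR_ge0 //.
by apply: sumr_ge0 => al _; apply: sumr_ge0 => be _; exact: dcov_const_ge0.
Qed.

Section TwoClusters.
Variables (x1 y1 x2 y2 : 'rV[R]_d).
Hypotheses (x12 : x1 != x2) (near1 : enorm (y1 - x1) <= enorm (x1 - x2) / 4)
  (near2 : enorm (y2 - x2) <= enorm (x1 - x2) / 4).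

(** Each end moves by at most a quarter of the distance of the centres. *)
Lemma segment_distance (t t' : R) : 0 <= t <= 1 -> 0 <= t' <= 1 ->
  enorm (x1 - x2) / 2 <= enorm (x1 + t *: (y1 - x1) - (x2 + t' *: (y2 - x2))).
Proof.
move=> /andP[t0 t1] /andP[t'0 t'1].
have -> : x1 + t *: (y1 - x1) - (x2 + t' *: (y2 - x2)) =
          (x1 - x2) + (t *: (y1 - x1) - t' *: (y2 - x2)).
  by rewrite opprD addrACA.
apply: le_trans (lerB_enorm _ _).
have := ler_enormB (t *: (y1 - x1)) (t' *: (y2 - x2)).
rewrite !enormZ !ger0_norm //.
have := ler_piMl (enorm_ge0 (y1 - x1)) t1.
have := ler_piMl (enorm_ge0 (y2 - x2)) t'1.
move: near1 near2 => + +; lra.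
Qed.

Lemma segment_neq (t t' : R) : 0 <= t <= 1 -> 0 <= t' <= 1 ->
  x1 + t *: (y1 - x1) != x2 + t' *: (y2 - x2).
Proof.
move=> t01 t'01; rewrite -subr_eq0; apply/eqP => e0.
have := segment_distance t01 t'01; rewrite e0 enorm0.
have := enorm_gt0 (z := x1 - x2); rewrite subr_eq0 => /(_ x12); lra.
Qed.

(** Taylor's formula in both variables: the first remainder is controlled by
   derivatives of the contraction with the second leg, which are themselves
   remainders in the second variable. *)
Lemma pairing_bound nu K mu K' : (K <= 1)%N -> (K' <= 1)%N ->
  `|pairing (leg_rep x1 y1 nu K) (leg_rep x2 y2 mu K')| <=
  edge_const nu K mu K' * enorm (y1 - x1) ^+ korder K * enorm (y2 - x2) ^+ korder K' *
  enorm (x1 - x2) `^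
     (- (2 * phi + (mdegree nu + korder K)%:R + (mdegree mu + korder K')%:R)).
Proof.
move=> K1 K'1; set e := 2 * phi + _ + _.
set S := \sum_(al <- mcomp d (korder K)) \sum_(be <- mcomp d (korder K'))
     dcov_const phi (nu + al) (mu + be).
have r0 : 0 < enorm (x1 - x2) by rewrite enorm_gt0 // subr_eq0.
have e0 : 0 <= e by rewrite !addr_ge0 // mulr_ge0 // ltW.
have I0 : 0 <= (0 : R) <= 1 by rewrite lexx ler01.
have I1 : 0 <= (1 : R) <= 1 by rewrite lexx ler01.
pose Psi ga z := \sum_(b <- leg_rep x2 y2 mu K') b.1.1 * dcov phi ga b.1.2 z b.2.
have -> : pairing (leg_rep x1 y1 nu K) (leg_rep x2 y2 mu K') =
  \sum_(a <- leg_rep x1 y1 nu K) a.1.1 * Psi a.1.2 a.2.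
  apply: eq_bigr => a _; rewrite mulr_sumr; apply: eq_bigr => b _; by rewrite mulrA.
have rep2 b : b \in leg_rep x2 y2 mu K' -> exists2 t : R, (0 <= t <= 1) & b.2 = x2 + t *: (y2 - x2).
  have yE : y2 = x2 + 1 *: (y2 - x2) by rewrite scale1r addrC subrK.
  have xE : x2 = x2 + 0 *: (y2 - x2) by rewrite scale0r addr0.
  rewrite /leg_rep; case: ifP => _; first by rewrite inE => /eqP ->; exists 0.
  case: ifP => _; last by rewrite inE => /eqP ->; exists 1.
  by rewrite inE => /orP[/eqP ->|/mapP[al _ ->]]; [exists 1|exists 0].
have PsiD ga (t : R) : 0 <= t <= 1 ->
     is_derive t 1 (fun h => Psi ga (x1 + h *: (y1 - x1)))
       (\sum_(i < d) (y1 - x1) 0 i * Psi (ga + munit i) (x1 + t *: (y1 - x1))).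
  move=> t01; rewrite /Psi; elim: (leg_rep x2 y2 mu K') rep2 => [|b s IH] rep2.
    rewrite big1 => [|i _]; last by rewrite big_nil mulr0.
    rewrite (_ : (fun h => _) = cst 0); first exact: is_derive_cst.
    by apply/funext => h; rewrite big_nil.
  have [t' t'01 b2E] := rep2 b (mem_head _ _).
  have -> : (fun h : R => \sum_(c <- b :: s) c.1.1 * dcov phi ga c.1.2 (x1 + h *: (y1 - x1)) c.2) =
    cst b.1.1 * (fun h => dcov phi ga b.1.2 (x1 + h *: (y1 - x1)) b.2) +
    (fun h : R => \sum_(c <- s) c.1.1 * dcov phi ga c.1.2 (x1 + h *: (y1 - x1)) c.2).
    by apply/funext => h; rewrite big_cons.
  have nb : x1 + t *: (y1 - x1) != b.2 by rewrite b2E segment_neq.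
  apply: (is_derive_eq (is_deriveD
    (is_deriveM (is_derive_cst b.1.1 t 1) (is_derive_dcov phi ga b.1.2 nb)) (IH _))).
    by move=> c cs; apply: rep2; rewrite inE cs orbT.
  rewrite scaler0 addr0 scaleRE /cst mulr_sumr -big_split /=.
  by apply: eq_bigr => i _; rewrite big_cons mulrDr mulrCA.
apply: le_trans (leg_rep_bound K1 PsiD (M := kconst K' * enorm (y2 - x2) ^+ korder K' *
   (S * (enorm (x1 - x2) / 2) `^ (- e))) _) _; last first.
  rewrite /edge_const -/e -/S powRM ?invr_ge0 ?enorm_ge0 //.
  have -> : 2^-1 `^ (- e) = 2 `^ e :> R.
    by rewrite -powR_inv1 // -powRrM mulN1r opprK.
  rewrite le_eqVlt; apply/orP; left; apply/eqP; ring.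
move=> al t alK t01; rewrite /Psi; set z := x1 + _.
apply: (leg_rep_bound (Psi := fun ga z' => dcov phi (nu + al) ga z z')) => //.
- move=> ga t' t'01.
  have nz : x2 + t' *: (y2 - x2) != z by rewrite eq_sym segment_neq.
  exact: is_derive_dcov_r.
- move=> be t' beK t'01.
  have nz : z != x2 + t' *: (y2 - x2) by rewrite segment_neq.
  apply: le_trans (dcov_bound _ _ _ nz) _.
  rewrite !mdegreeD alK beK; apply: ler_pM; rewrite ?dcov_const_ge0 ?powR_ge0 //.
    apply: le_trans (ler_sum_mem (s := mcomp d (korder K'))
      (F := fun be => dcov_const phi (nu + al) (mu + be)) _ _) _.
    - by rewrite mem_mcomp; apply/eqP; exact: beK.
    - by move=> ?; exact: dcov_const_ge0.
    apply: (ler_sum_mem (F := fun al => \sum_(be <- mcomp d (korder K'))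
       dcov_const phi (nu + al) (mu + be))).
      by rewrite mem_mcomp; apply/eqP; exact: alK.
    by move=> ?; apply: sumr_ge0 => ? _; exact: dcov_const_ge0.
  apply: ler_powRN => //; first by rewrite divr_gt0.
  exact: segment_distance.
Qed.

End TwoClusters.

End Legs.

(** * Hafnians *)

Section Hafnian.
Variables (R : comNzRingType) (T : eqType) (w : T -> T -> R).
Implicit Types (a b : T) (L : seq T).

(** The recursion is on a bound for the number of entries, since removing b from
   L does not give a structural subterm. *)
Fixpoint haf_rec (n : nat) L : R :=
  if n isn't n'.+1 then 1 else
  if L isn't a :: L' then 1 else \sum_(b <- L') w a b * haf_rec n' (rem b L').

(** The hafnian, expanded along its first row: the sum over all pairings of
   the entries of L of the product of the weights of the pairs. *)
Definition haf L : R := haf_rec (size L) L.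

Lemma size_remS a L : a \in L -> (size (rem a L)).+1 = size L.
Proof. by move=> aL; rewrite (perm_size (perm_to_rem aL)). Qed.

Lemma rem_cons_perm a b L : a \in L -> perm_eq (rem a (b :: L)) (b :: rem a L).
Proof.
move=> aL; rewrite -(perm_cons a); apply: perm_trans (_ : perm_eq (b :: L) _).
  by rewrite perm_sym perm_to_rem // inE aL orbT.
apply: perm_trans (_ : perm_eq (b :: a :: rem a L) _).
  by rewrite perm_cons perm_to_rem.
by apply/permP => q /=; lia.
Qed.

Lemma rem_remC a b L : perm_eq (rem b (rem a L)) (rem a (rem b L)).
Proof. by apply/allP => c _ /=; rewrite !count_mem_rem subnAC. Qed.

Lemma size_rem_le a L : (size (rem a L) <= size L)%N.
Proof. exact: size_subseq (rem_subseq _ _). Qed.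

Lemma perm_rem a L1 L2 : perm_eq L1 L2 -> perm_eq (rem a L1) (rem a L2).
Proof.
move=> p12; have [aL|aL] := boolP (a \in L1); last first.
  by rewrite !rem_id // -?(perm_mem p12).
rewrite -(perm_cons a); apply: perm_trans (_ : perm_eq L1 _).
  by rewrite perm_sym perm_to_rem.
by apply: (perm_trans p12 (perm_to_rem _)); rewrite -(perm_mem p12).
Qed.

Lemma haf_rec_size n m L : (size L <= n)%N -> (size L <= m)%N ->
  haf_rec n L = haf_rec m L.
Proof.
elim: n m L => [|n IH] [|m] [|a L] //= Ln Lm.
apply: eq_big_seq => b bL; congr (_ * _); apply: IH;
  have := size_remS bL; lia.
Qed.

Lemma haf_nil : haf [::] = 1. Proof. by []. Qed.

Lemma haf_cons a L : haf (a :: L) = \sum_(b <- L) w a b * haf (rem b L).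
Proof.
rewrite [LHS]/=; apply: eq_big_seq => b bL; congr (_ * _).
by apply: haf_rec_size => //; rewrite -ltnS (size_remS bL).
Qed.

Lemma sum_rem_swap (s : seq T) (f : T -> T -> R) :
  \sum_(b <- s) \sum_(c <- rem b s) f b c = \sum_(c <- s) \sum_(b <- rem c s) f b c.
Proof.
have remE b (h : T -> R) : b \in s -> \sum_(c <- rem b s) h c = \sum_(c <- s) h c - h b.
  move=> bs; rewrite [in RHS](perm_big _ (perm_to_rem bs)) /= big_cons.
  by rewrite addrAC subrr add0r.
transitivity (\sum_(b <- s) (\sum_(c <- s) f b c - f b b)).
  by apply: eq_big_seq => b bs; rewrite remE.
transitivity (\sum_(c <- s) (\sum_(b <- s) f b c - f c c)); last first.
  by apply: eq_big_seq => c cs; rewrite (remE c (f^~ c)).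
by rewrite !sumrB exchange_big.
Qed.

Hypothesis wC : forall a b, w a b = w b a.

(** The expansion along the first two rows is symmetric in these rows. *)
Lemma haf_perm L1 L2 : perm_eq L1 L2 -> haf L1 = haf L2.
Proof.
have [n] := ubnP (size L1); elim: n => // n IH in L1 L2 *.
case: L1 => [|a L1]; first by move=> _; rewrite perm_sym => /perm_nilP ->.
move=> /= Ln p12.
have hd c L L' : perm_eq L L' -> (size L <= n)%N -> haf (c :: L) = haf (c :: L').
  move=> LL' Lsz; rewrite !haf_cons (perm_big _ LL') /=; apply: eq_big_seq => b bL'.
  congr (_ * _); apply: IH; last exact: perm_rem.
  by rewrite size_remS // (perm_mem LL').
case: L2 p12 => [/perm_nilP //|b L2] p12.
have [ab|ab] := eqVneq a b.
  by rewrite -ab; apply: hd; [rewrite -(perm_cons a) {2}ab|exact: ltnW].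
have bL1 : b \in L1.
  by have := perm_mem p12 b; rewrite !inE eqxx eq_sym (negbTE ab).
pose M := rem b L1.
have L1E : perm_eq L1 (b :: M) by exact: perm_to_rem.
have szM := size_remS bL1.
have L2E : perm_eq L2 (a :: M).
  rewrite -(perm_cons b) perm_sym; apply: perm_trans p12.
  rewrite perm_sym; apply: perm_trans (_ : perm_eq (a :: b :: M) _).
    by rewrite perm_cons.
  by apply/permP => q /=; lia.
transitivity (haf (a :: b :: M)); first by apply: hd => //; exact: ltnW.
transitivity (haf (b :: a :: M)); last first.
  by symmetry; apply: hd => //; have /= := perm_size p12; lia.
have expand c e :
   \sum_(f <- M) w c f * haf (rem f (e :: M)) =
   \sum_(f <- M) \sum_(g <- rem f M) w c f * w e g * haf (rem g (rem f M)).
  apply: eq_big_seq => f fM; under eq_bigr do rewrite -mulrA.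
  rewrite -mulr_sumr -haf_cons; congr (_ * _).
  apply: IH; last exact: rem_cons_perm.
  by have := perm_size (rem_cons_perm e fM); have /= := size_remS fM; rewrite /M in szM *; lia.
rewrite (haf_cons a) (haf_cons b) !big_cons wC.
rewrite /= !eqxx; congr (_ + _).
rewrite (expand a b) (expand b a) sum_rem_swap.
apply: eq_big_seq => g gM; apply: eq_big_seq => f fM.
rewrite [w a f * _]mulrC; congr (_ * _); apply: IH.
  have := size_rem_le g (rem f M); have := size_rem_le f M.
  by rewrite /M in szM *; lia.
exact: rem_remC.
Qed.
End Hafnian.

Section HafnianTransfer.
Variable R : comNzRingType.

Lemma perm_rem_map (T T' : eqType) (f : T -> T') b (L : seq T) : b \in L ->
  perm_eq (rem (f b) (map f L)) (map f (rem b L)).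
Proof.
move=> bL; rewrite -(perm_cons (f b)); apply: perm_trans (_ : perm_eq (map f L) _).
  by rewrite perm_sym perm_to_rem // map_f.
by rewrite -map_cons perm_map // perm_to_rem.
Qed.

(** The two sides remove the partner of the first entry from a list and from its
   image; when f is not injective these removals only agree up to permutation,
   whence the symmetry of the weights. *)
Lemma haf_map (T T' : eqType) (w : T -> T -> R) (w' : T' -> T' -> R) (f : T -> T') L :
  (forall a b, w' a b = w' b a) ->
  {in L &, forall a b, w' (f a) (f b) = w a b} ->
  haf w' (map f L) = haf w L.
Proof.
move=> w'C; have [n] := ubnP (size L); elim: n L => // n IH [|a L] //= Ln ww'.
rewrite !haf_cons big_map; apply: eq_big_seq => b bL.
rewrite ww' ?mem_head ?inE ?bL ?orbT //; congr (_ * _).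
rewrite (haf_perm w'C (perm_rem_map f bL)); apply: IH.
  by have := size_rem_le b L; lia.
move=> c e cL eL; apply: ww'; rewrite inE ?(mem_rem cL) ?(mem_rem eL) orbT //.
Qed.

End HafnianTransfer.

Lemma ler_sum_in (R : numDomainType) (T : eqType) (s : seq T) (F G : T -> R) :
  {in s, forall a, F a <= G a} -> \sum_(a <- s) F a <= \sum_(a <- s) G a.
Proof.
move=> FG; rewrite big_seq [leRHS]big_seq; exact: ler_sum.
Qed.

(** There are at most (size L)! pairings, and each uses every entry once. *)
Lemma haf_bound (R : realFieldType) (T : eqType) (w : T -> T -> R) (B : T -> R) L :
  {in L, forall a, 0 <= B a} ->
  {in L &, forall a b, `|w a b| <= B a * B b} ->
  `|haf w L| <= (size L)`!%:R * \prod_(a <- L) B a.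
Proof.
have [n] := ubnP (size L); elim: n L => // n IH [|a L] /= Ln B0 wB.
  by rewrite haf_nil big_nil fact0 mulr1 normr1.
rewrite haf_cons factS natrM big_cons.
have B0L b : b \in L -> 0 <= B b by move=> bL; apply: B0; rewrite inE bL orbT.
have P0 : 0 <= \prod_(b <- L) B b.
  by rewrite big_seq_cond; apply: prodr_ge0 => b; rewrite andbT => /B0L.
apply: le_trans (ler_norm_sum _ _ _) _.
apply: le_trans (_ : \sum_(b <- L) ((size L)`!%:R * (B a * \prod_(b <- L) B b)) <= _); last first.
  rewrite big_const_seq count_predT iter_addr_0 -[leLHS]mulr_natl mulrA; apply: ler_wpM2r.
    by rewrite mulr_ge0 // B0 // mem_head.
  by apply: ler_wpM2r => //; rewrite ler_nat.
apply: ler_sum_in => b bL.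
rewrite normrM (perm_big _ (perm_to_rem bL)) /= big_cons !mulrA.
have aB : 0 <= B a by rewrite B0 // mem_head.
have wab : `|w a b| <= B a * B b by apply: wB; rewrite ?mem_head // inE bL orbT.
rewrite mulrC; apply: le_trans (_ : (size (rem b L))`!%:R * (\prod_(c <- rem b L) B c) *
   (B a * B b) <= _).
  apply: ler_pM => //; apply: IH.
  - by have := size_rem_le b L; lia.
  - by move=> c /mem_rem; exact: B0L.
  - by move=> c e /mem_rem cL /mem_rem eL; apply: wB; rewrite inE ?cL ?eL orbT.
have Q0 : 0 <= \prod_(c <- rem b L) B c.
  by rewrite big_seq_cond; apply: prodr_ge0 => c; rewrite andbT => /mem_rem/B0L.
rewrite [leRHS](_ : _ =
   (size L)`!%:R * (B a * (B b * \prod_(c <- rem b L) B c))); last by ring.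
rewrite [leLHS](_ : _ = (size (rem b L))`!%:R *
   (B a * (B b * \prod_(c <- rem b L) B c))); last by ring.
apply: ler_wpM2r.
  by apply: mulr_ge0 => //; apply: mulr_ge0 => //; exact: B0L.
by rewrite ler_nat -(size_remS bL) factS leq_pmull.
Qed.

(** * Correlations as hafnians *)

Section PairPartitions.
Variables (R : comNzRingType) (F : finType) (g : {set F} -> R).
Implicit Types (S : {set F}) (W : {set {set F}}) (a b : F).

Definition pairing_of S W : bool :=
  finset.partition W S && [forall e in W, #|e| == 2%N].

Definition pairing_sum S : R := \sum_(W | pairing_of S W) \prod_(e in W) g e.

Lemma pairing_sum0 : pairing_sum finset.set0 = 1.
Proof.
rewrite /pairing_sum (big_pred1 finset.set0) ?big_set0 // => W.
rewrite /pairing_of /= finset.partition_set0; case: eqP => //= ->.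
by apply/forall_inP => e; rewrite inE.
Qed.

Lemma pairing_of_mem S W a : pairing_of S W -> a \in S ->
  exists2 b, b \in (S :\ a)%SET & [set a; b]%SET \in W.
Proof.
case/andP=> /and3P[/eqP covW tW _] /forall_inP W2 aS.
have aW : a \in finset.cover W by rewrite covW.
have eW := pblock_mem aW; have ae : a \in finset.pblock W a by rewrite mem_pblock.
have /cards2P[x [y [xy eE]]] := W2 _ eW.
have eS : finset.pblock W a \subset S.
  apply/fintype.subsetP => z ze; rewrite -covW; apply/finset.bigcupP.
  by exists (finset.pblock W a).
have [xe ye] : x \in finset.pblock W a /\ y \in finset.pblock W a.
  by rewrite eE !inE !eqxx orbT.
move: ae; rewrite {1}eE !inE => /orP[] /eqP aE.
  exists y; first by rewrite !inE aE eq_sym xy (fintype.subsetP eS).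
  by rewrite aE -eE.
exists x; first by rewrite !inE aE xy (fintype.subsetP eS).
by rewrite aE finset.setUC -eE.
Qed.

Lemma pairing_of_inj S W a b c : pairing_of S W -> a != b ->
  [set a; b]%SET \in W -> [set a; c]%SET \in W -> b = c.
Proof.
case/andP=> /and3P[_ tW _] _ ab abW acW.
have e1 := finset.def_pblock (x := a) tW abW; have e2 := finset.def_pblock (x := a) tW acW.
have : b \in [set a; c]%SET.
  by rewrite -e2 ?e1 ?inE ?eqxx ?orbT.
by rewrite !inE eq_sym (negbTE ab) => /eqP.
Qed.

(** The block that contains a is {a, b} for exactly one b, and removing it leaves
   a pairing of the remaining elements. *)
Lemma pairing_sum_rec S a : a \in S ->
  pairing_sum S = \sum_(b in (S :\ a)%SET) g [set a; b]%SET * pairing_sum (S :\ a :\ b)%SET.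
Proof.
move=> aS.
transitivity (\sum_(W | pairing_of S W)
   \sum_(b in (S :\ a)%SET | [set a; b]%SET \in W) \prod_(e in W) g e).
  apply: eq_bigr => W SW; have [b bS abW] := pairing_of_mem SW aS.
  rewrite (big_pred1 b) // => c; apply/andP/eqP => [[cS acW]|-> //].
  apply: (pairing_of_inj SW _ acW abW).
  by move: cS; rewrite !inE eq_sym; case/andP.
rewrite (exchange_big_dep (fun b => b \in (S :\ a)%SET)) /=; last by move=> W b _ /andP[].
apply: eq_bigr => b bSa.
have [bS ba] : b \in S /\ b != a by move: bSa; rewrite !inE => /andP[].
have ab2 : #|[set a; b]%SET| = 2%N by rewrite finset.cards2 eq_sym ba.
have SabE : (S :\: [set a; b] = S :\ a :\ b)%SET.
  by apply/finset.setP => c; rewrite !inE; case: (c == a); case: (c == b); rewrite ?andbF.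
have SE : S = ([set a; b] :|: (S :\ a :\ b))%SET.
  apply/finset.setP => c; rewrite !inE.
  by case: eqP => [->|_]; case: eqP => [->|_].
rewrite /pairing_sum mulr_sumr.
rewrite (reindex_onto (fun W => [set a; b] |: W)%SET (fun W => W :\ [set a; b])%SET) /=; last first.
  by move=> W /andP[_ /andP[_ abW]]; rewrite finset.setD1K.
have abW' W : pairing_of (S :\ a :\ b)%SET W -> [set a; b]%SET \notin W.
  case/andP=> /and3P[/eqP covW _ _] _; apply/negP => abW.
  have : a \in (S :\ a :\ b)%SET.
    by rewrite -covW; apply/finset.bigcupP; exists [set a; b]%SET => //; rewrite !inE eqxx.
  by rewrite !inE eqxx andbF.
apply: eq_big => W.
  apply/idP/idP => [/andP[/andP[/andP[part W2] _] /eqP WE]|SW].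
    have abW : [set a; b]%SET \notin W by rewrite -WE !inE eqxx.
    apply/andP; split.
      rewrite -SabE -WE; apply: finset.partitionD1 => //; by rewrite !inE eqxx.
    apply/forall_inP => e eW; move/forall_inP: W2; apply.
    by rewrite !inE eW orbT.
  have nW := abW' _ SW; case/andP: SW => part /forall_inP W2.
  rewrite bSa finset.setU1K // eqxx andbT !inE eqxx /= andbT.
  apply/andP; split; last first.
    by apply/forall_inP => e; rewrite !inE => /orP[/eqP ->|/W2 //]; rewrite ab2.
  rewrite [in X in finset.partition _ X]SE; apply: finset.partitionU1 => //.
    by apply/finset.set0Pn; exists a; rewrite !inE eqxx.
  by rewrite -finset.setI_eq0 -SabE finset.setIDA finset.setDIl finset.setDv finset.set0I.
by case/andP=> /andP[_ _] /eqP WE; rewrite finset.big_setU1 // -WE !inE eqxx.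
Qed.

Lemma pairing_sum_haf (L : seq F) : uniq L ->
  pairing_sum [set a in L]%SET = haf (fun a b => g [set a; b]%SET) L.
Proof.
have [n] := ubnP (size L); elim: n L => // n IH [|a L] /= Ln.
  by move=> _; rewrite haf_nil -pairing_sum0; congr pairing_sum; apply/finset.setP => a; rewrite !inE.
case/andP=> aL uL; rewrite (pairing_sum_rec (a := a)) ?inE ?eqxx // haf_cons.
rewrite big_uniq //; apply: eq_big => b.
  by rewrite !inE; case: eqP => [->|_]; rewrite ?(negbTE aL).
rewrite !inE => /andP[ba]; rewrite (negbTE ba) /= => bL; congr (_ * _).
rewrite -IH ?rem_uniq //; last exact: leq_ltn_trans (size_rem_le b L) Ln.
congr pairing_sum; apply/finset.setP => c; rewrite !inE mem_rem_uniq // inE.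
by case: (c == b); case: eqP => [->|_] //=; rewrite (negbTE aL).
Qed.

End PairPartitions.

Section Correlations.
Variables (R : realType) (d : nat) (phi : R).

(** The weight of a contraction between two derivative legs (nu, z); legs at
   the same point belong to the same symbol and are not contracted. *)
Definition point_weight (p q : mindex d * 'rV[R]_d) : R :=
  if p.2 == q.2 then 0 else dcov phi p.1 q.1 p.2 q.2.

Lemma point_weightC p q : point_weight p q = point_weight q p.
Proof.
rewrite /point_weight eq_sym; case: eqP => [//|/eqP qp].
by rewrite dcovC // eq_sym.
Qed.

(** Pairs contained in a block have weight 0, which encodes the off-diagonal
   condition. *)
Lemma corr_haf n (A : 'I_n -> label d) (x : 'I_n -> 'rV[R]_d) : injective x ->
  corr phi A x =
  haf point_weight [seq (leg_nu a, x (tag a)) | a <- enum (legs A)].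
Proof.
move=> x_inj.
pose f (a : legs A) := (leg_nu a, x (tag a)).
pose ord (ab : legs A * legs A) := (tag ab.1 < tag ab.2)%N.
pose v (ab : legs A * legs A) :=
  dcov phi (leg_nu ab.1) (leg_nu ab.2) (x (tag ab.1)) (x (tag ab.2)).
pose g (e : {set legs A}) : R :=
  if [exists i, e \subset block A i] then 0 else
  \prod_(ab : legs A * legs A | ord ab && ([set ab.1; ab.2]%SET == e)) v ab.
have gE a b : g [set a; b]%SET = point_weight (f a) (f b).
  rewrite /g /point_weight /= (inj_eq x_inj).
  have blockE : [exists i, [set a; b]%SET \subset block A i] = (tag a == tag b).
    apply/existsP/eqP => [[i /fintype.subsetP abi]|ab].
      have := abi a; have := abi b; rewrite !inE !eqxx orbT /=.
      by move=> /(_ isT)/eqP -> /(_ isT)/eqP ->.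
    exists (tag a); apply/fintype.subsetP => c.
    by rewrite !inE => /orP[/eqP->|/eqP->] //; rewrite ab.
  rewrite blockE; case: ifP => // /negbT tab.
  wlog lt_ab : a b tab {blockE} / (tag a < tag b)%N.
    move=> H; case: (ltngtP (tag a) (tag b)) => [|lt_ba|/val_inj e].
    - exact: H.
    - rewrite finset.setUC dcovC ?(inj_eq x_inj) //; apply: H => //.
      by rewrite eq_sym.
    - by rewrite e eqxx in tab.
  rewrite (big_pred1 (a, b)) // => -[a' b'] /=; rewrite /ord /=.
  apply/andP/eqP => [[lt_ab' /eqP e]|[-> ->]] //.
  have : b \in [set a'; b']%SET by rewrite e !inE eqxx orbT.
  have : a \in [set a'; b']%SET by rewrite e !inE eqxx.
  rewrite !inE => /orP[] /eqP aE /orP[] /eqP bE; first 1 last.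
  - by rewrite aE bE.
  - by move: lt_ab lt_ab'; rewrite aE bE; case: ltngtP.
  - by rewrite aE bE eqxx in tab.
  - by rewrite aE bE eqxx in tab.
rewrite (haf_map (w := fun a b => g [set a; b]%SET)); first last.
- by move=> a b _ _; rewrite gE.
- exact: point_weightC.
rewrite -pairing_sum_haf ?enum_uniq //.
have -> : [set a in enum (legs A)]%SET = [set: legs A]%SET.
  by apply/finset.setP => a; rewrite !inE mem_enum.
rewrite /corr /pairing_sum [RHS](bigID (fun W => off_diag W)) /= [X in _ + X]big1 ?addr0.
  apply: eq_bigr => W /andP[pW oW].
  rewrite (partition_big (fun ab : legs A * legs A => [set ab.1; ab.2]%SET)
             (fun e => e \in W)) /=; last by move=> ab /andP[].
  apply: eq_bigr => e eW; rewrite /g ifF; last first.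
    apply/negbTE; rewrite negb_exists; exact: (forall_inP oW).
  apply: eq_bigl => ab; rewrite /ord.
  by case: eqP => [->|_]; rewrite ?andbF // eW !andbT.
move=> W /andP[_ /forall_inPn[e eW]].
rewrite negb_forall => /existsP[i]; rewrite negbK => ei.
rewrite (bigD1 e) //= /g ifT ?mul0r //.
by apply/existsP; exists i.
Qed.

Definition point_legs (s : monom R d) : seq (mindex d * 'rV[R]_d) :=
  flatten [seq [seq (nu, b.2) | nu <- enum_mset b.1] | b <- s].

Lemma corr_monom_haf (s : monom R d) : uniq [seq b.2 | b <- s] ->
  corr_monom phi s = haf point_weight (point_legs s).
Proof.
move=> us; rewrite /corr_monom corr_haf; last first.
  move=> i j /=; rewrite -!(tnth_map snd); apply/tuple_uniqP; exact: us.
apply: haf_perm; first exact: point_weightC.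
apply/permP => p; rewrite count_map -sum1_count big_enum_cond /=.
rewrite /point_legs count_flatten sumnE !big_map [RHS]big_tnth.
rewrite (eq_bigr (fun i => \sum_(j < lrank (tnth (in_tuple s) i).1 |
   p (nu j, (tnth (in_tuple s) i).2)) 1)%N).
  by rewrite sig_big_dep /=; apply: eq_bigl => a.
move=> i _; rewrite count_map -sum1_count big_tnth.
by apply: eq_bigl => j.
Qed.

End Correlations.

(** * Partial matchings *)

Section PartialMatchings.
Variables (F1 F2 : finType).
Implicit Types (V : {set F1 * F2}) (a : F1) (b : F2) (s : seq F1) (S : {set F2}).

Definition pmatching V : bool :=
  [forall p in V, forall q in V, ((p.1 == q.1) || (p.2 == q.2)) ==> (p == q)].

Definition free_fst V a : bool := [forall b, (a, b) \notin V].
Definition free_snd V b : bool := [forall a, (a, b) \notin V].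

Definition within V s S : bool := [forall p in V, (p.1 \in s) && (p.2 \in S)].

Lemma pmatchingP V : reflect
  (forall a b a' b', (a, b) \in V -> (a', b') \in V -> a = a' \/ b = b' ->
     a = a' /\ b = b') (pmatching V).
Proof.
apply: (iffP forall_inP) => [H a b a' b' abV abV' E|H [a b] abV].
  have /forall_inP/(_ _ abV')/implyP := H _ abV.
  have Eb : (a == a') || (b == b') by case: E => ->; rewrite eqxx ?orbT.
  by move=> /(_ Eb)/eqP[].
apply/forall_inP => -[a' b'] abV' /=; apply/implyP => E.
have [|-> -> //] := H _ _ _ _ abV abV'.
by case/orP: E => /eqP ->; [left|right].
Qed.

Lemma withinP V s S : reflect
  (forall a b, (a, b) \in V -> a \in s /\ b \in S) (within V s S).
Proof.
apply: (iffP forall_inP) => [H a b /H /andP[]//|H [a b] /H [/= -> ->]//].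
Qed.

Variables (R : comNzRingType) (c : F1 -> F2 -> R).

(** Psi receives the unmatched elements.  Those of the first kind form a list,
   along which the sum is unfolded, those of the second kind a set, from which
   any element may be taken. *)
Definition pmatching_sum s S (Psi : seq F1 -> {set F2} -> R) : R :=
  \sum_(V | pmatching V && within V s S)
     (\prod_(p in V) c p.1 p.2) *
     Psi [seq a <- s | free_fst V a] [set b in S | free_snd V b]%SET.

Lemma pmatching_sum_nil S Psi : pmatching_sum [::] S Psi = Psi [::] S.
Proof.
rewrite /pmatching_sum (big_pred1 finset.set0) /=.
  rewrite big_set0 mul1r; congr Psi; apply/finset.setP => b.
  by rewrite !inE andb_idr // => _; apply/forallP => a; rewrite inE.
move=> V; apply/andP/eqP => [[_ /withinP V0]|->].
  by apply/finset.setP => -[a b]; rewrite inE; apply/negbTE/negP => /V0[].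
by split; [apply/pmatchingP|apply/withinP] => a b; [move=> ? ?|]; rewrite inE.
Qed.

(** The first entry is either left unmatched or matched with some b. *)
Lemma pmatching_sum_cons a s S Psi : uniq (a :: s) ->
  pmatching_sum (a :: s) S Psi =
    pmatching_sum s S (fun U1 U2 => Psi (a :: U1) U2) +
    \sum_(b in S) c a b * pmatching_sum s (S :\ b)%SET Psi.
Proof.
case/andP=> a_s us; rewrite {1}/pmatching_sum (bigID (fun V => free_fst V a)) /=.
congr (_ + _).
  apply: eq_big => V.
    apply/andP/andP => [[/andP[pV /withinP wV] fV]|[pV /withinP wV]].
      split=> //; apply/withinP => a' b' abV; have [] := wV _ _ abV.
      rewrite inE => /predU1P[e|]; last by [].
      by move/forallP: fV => /(_ b'); rewrite -e abV.
    split; last first.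
      apply/forallP => b; apply/negP => /wV[]; by rewrite (negbTE a_s).
    rewrite pV; apply/withinP => a' b' /wV[a's b'S]; by rewrite inE a's orbT.
  by case/andP=> _ ->.
transitivity (\sum_(V | pmatching V && within V (a :: s) S) \sum_(b in S | (a, b) \in V)
  (\prod_(p in V) c p.1 p.2) *
     Psi [seq a <- s | free_fst V a] [set b in S | free_snd V b]%SET).
  rewrite big_mkcondr /=; apply: eq_bigr => V /andP[pV wV].
  case: (boolP (free_fst V a)) => /= [fV|].
    rewrite big1 // => b /andP[_ abV].
    by move/forallP: fV => /(_ b); rewrite abV.
  rewrite /free_fst negb_forall => /existsP[b]; rewrite negbK => abV.
  rewrite (big_pred1 b) // => b'; apply/andP/eqP => [[_ abV']|->].
    by have [|] := (elimT (pmatchingP V) pV) _ _ _ _ abV' abV; first by left.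
  by split=> //; have [] := (elimT (withinP V (a :: s) S) wV) _ _ abV.
rewrite (exchange_big_dep (fun b => b \in S)) /=; last by move=> V b _ /andP[].
apply: eq_bigr => b bS.
rewrite /pmatching_sum mulr_sumr.
rewrite (reindex_onto (fun V => (a, b) |: V)%SET (fun V => V :\ (a, b))%SET) /=; last first.
  by move=> V /andP[_ /andP[_ abV]]; rewrite finset.setD1K.
have nab V : within V s (S :\ b)%SET -> (a, b) \notin V.
  move=> /withinP wV; apply/negP => /wV[].
  by rewrite (negbTE a_s).
have frees V : within V s (S :\ b)%SET ->
   [seq a' <- s | free_fst ((a, b) |: V)%SET a'] = [seq a' <- s | free_fst V a'] /\
   [set b' in S | free_snd ((a, b) |: V) b']%SET = [set b' in S :\ b | free_snd V b']%SET.
  move=> /withinP wV; split.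
    apply: eq_in_filter => a' a's; apply: eq_forallb => b'.
    rewrite !inE xpair_eqE (_ : (a' == a) = false) //.
    by apply: contraNF a_s => /eqP <-.
  apply/finset.setP => b'; rewrite !inE; case: eqP => [->|nb] /=.
    apply/negbTE; rewrite negb_and; apply/orP; right.
    by rewrite /free_snd negb_forall; apply/existsP; exists a; rewrite !inE eqxx.
  congr (_ && _); apply: eq_forallb => a'.
  by rewrite !inE xpair_eqE; move/eqP/negbTE: nb => ->; rewrite andbF.
apply: eq_big => V; last first.
  case/andP=> /andP[/andP[pV wV] _] /eqP VE.
  have nV : (a, b) \notin V by rewrite -VE !inE eqxx.
  have wV' : within V s (S :\ b)%SET.
    apply/withinP => a' b' abV.
    have abV' : (a', b') \in ((a, b) |: V)%SET by rewrite inE abV orbT.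
    have [] := (elimT (withinP _ _ _) wV) _ _ abV'; rewrite !inE => a's b'S.
    have H := (elimT (pmatchingP _) pV) _ _ a b abV'; rewrite !inE eqxx in H.
    have ne : ~ (a' = a /\ b' = b) by case=> e1 e2; rewrite -e1 -e2 abV in nV.
    split; last by rewrite b'S andbT; apply/eqP => e; apply/ne/H; [|right].
    by case/predU1P: a's => // e; case: ne; apply: H; [|left].
  have [-> ->] := frees _ wV'; rewrite finset.big_setU1 //= mulrA.
  by [].
apply/idP/idP => [/andP[/andP[/andP[pV wV] _] /eqP VE]|/andP[pV wV]].
  have nV : (a, b) \notin V by rewrite -VE !inE eqxx.
  apply/andP; split.
    apply/pmatchingP => a1 b1 a2 b2 m1 m2; apply: (elimT (pmatchingP _) pV).
      by rewrite inE m1 orbT.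
    by rewrite inE m2 orbT.
  apply/withinP => a' b' abV.
  have abV' : (a', b') \in ((a, b) |: V)%SET by rewrite inE abV orbT.
  have [] := (elimT (withinP _ _ _) wV) _ _ abV'; rewrite !inE => a's b'S.
  have H := (elimT (pmatchingP _) pV) _ _ a b abV'; rewrite !inE eqxx in H.
  have ne : ~ (a' = a /\ b' = b) by case=> e1 e2; rewrite -e1 -e2 abV in nV.
  split; last by rewrite b'S andbT; apply/eqP => e; apply/ne/H; [|right].
  by case/predU1P: a's => // e; case: ne; apply: H; [|left].
have nV := nab _ wV; have {}wV := elimT (withinP _ _ _) wV.
rewrite bS finset.setU1K // eqxx andbT !inE eqxx /= andbT.
apply/andP; split; last first.
  apply/withinP => a' b'; rewrite !inE xpair_eqE => /orP[/andP[/eqP -> /eqP ->]|/wV[]].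
    by rewrite eqxx.
  by rewrite !inE => -> /andP[_ ->]; rewrite orbT.
apply/pmatchingP => a1 b1 a2 b2; rewrite !inE !xpair_eqE.
have sep a' b' : (a', b') \in V -> a' <> a /\ b' <> b.
  move=> /wV[a's]; rewrite !inE => /andP[/eqP nb _]; split=> // e.
  by rewrite -e a's in a_s.
case/orP=> [/andP[/eqP -> /eqP ->]|m1] /orP[/andP[/eqP -> /eqP ->]|m2] //.
- by have [n1 n2] := sep _ _ m2; case=> e; [case: n1|case: n2].
- by have [n1 n2] := sep _ _ m1; case=> e; [case: n1|case: n2].
- exact: (elimT (pmatchingP _) pV).
Qed.

End PartialMatchings.

(** * Wick's theorem and Taylor expansion in a cluster *)

Lemma perm_cons_cat (T : eqType) (a : T) (s1 s2 s3 : seq T) :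
  perm_eq (a :: s1 ++ s2 ++ s3) (s1 ++ s2 ++ a :: s3).
Proof. by apply/permP => p; rewrite /= !count_cat /=; lia. Qed.

Lemma big_seq_sub (R : nmodType) (T : choiceType) (s : seq T) (F : T -> R) :
  uniq s -> \sum_(b : seq_sub s) F (val b) = \sum_(b <- s) F b.
Proof.
move=> us; rewrite -(big_map val xpredT F); apply: perm_big; apply: uniq_perm => //.
  by rewrite map_inj_uniq ?index_enum_uniq //; exact: val_inj.
move=> b; apply/mapP/idP => [[e _ ->]|bs]; first exact: ssvalP.
by exists (SeqSub bs); rewrite // mem_index_enum.
Qed.

Section HafnianMultilinear.
Variables (R : comNzRingType) (T : eqType) (w : T -> T -> R).
Hypothesis wC : forall a b, w a b = w b a.
Variables (X K : finType) (f : X -> T) (g : X -> K -> T) (c : X -> K -> R)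
  (k0 : K) (P : pred T).
Hypotheses (fP : forall a, P (f a)) (gP : forall a k, P (g a k)).
Hypothesis fE : forall a l, P l -> w (f a) l = \sum_k c a k * w (g a k) l.

(** A leg that decomposes as a combination of legs, as far as its contractions
   are concerned, may be expanded inside the hafnian; here for all legs of a
   family at once.  Off s the choice function ka is fixed at k0, so that each
   choice of terms is counted once. *)
Lemma haf_expand_seq (s : seq X) L : uniq s -> all P L ->
  haf w (map f s ++ L) =
  \sum_(ka : {ffun X -> K} | [forall a, (a \notin s) ==> (ka a == k0)])
     (\prod_(a <- s) c a (ka a)) * haf w ([seq g a (ka a) | a <- s] ++ L).
Proof.
elim: s L => [|a s IH] L /=.
  move=> _ _; rewrite (big_pred1 [ffun=> k0]) => [|ka]; first by rewrite big_nil mul1r.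
  apply/forallP/eqP => [H|-> b]; last by rewrite ffunE eqxx.
  by apply/ffunP => b; rewrite ffunE; apply/eqP/(H b).
case/andP=> a_s us PL.
have PsL : all P (map f s ++ L).
  by rewrite all_cat PL andbT; apply/allP => _ /mapP[b _ ->].
have -> : haf w (f a :: map f s ++ L) =
          \sum_k c a k * haf w (map f s ++ (g a k :: L)).
  transitivity (\sum_k c a k * haf w (g a k :: map f s ++ L)); last first.
    apply: eq_bigr => k _; congr (_ * _); apply: haf_perm => //.
    by rewrite -cat1s perm_catCA.
  rewrite haf_cons; transitivity (\sum_(b <- map f s ++ L)
      \sum_k c a k * (w (g a k) b * haf w (rem b (map f s ++ L)))).
    apply: eq_big_seq => b bL; rewrite fE ?(allP PsL) // mulr_suml.
    by apply: eq_bigr => k _; rewrite mulrA.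
  by rewrite exchange_big; apply: eq_bigr => k _; rewrite -mulr_sumr haf_cons.
rewrite (partition_big (fun ka : {ffun X -> K} => ka a) xpredT) //=.
apply: eq_bigr => k _; rewrite IH //=; last by rewrite gP.
rewrite mulr_sumr.
pose upd (ka : {ffun X -> K}) k' : {ffun X -> K} := [ffun b => if b == a then k' else ka b].
rewrite [RHS](reindex_onto (fun ka => upd ka k) (fun ka => upd ka k0)) /=; last first.
  move=> ka /andP[/forallP H /eqP <-]; apply/ffunP => b; rewrite !ffunE.
  by case: eqP => [->|].
apply: eq_big => ka.
  apply/forallP/andP => [H|[/andP[/forallP H _] /eqP E] b].
    split; last first.
      apply/eqP/ffunP => b; rewrite !ffunE; case: eqP => [->|//].
      by apply/esym/eqP/(implyP (H a)).
    apply/andP; split; last by rewrite ffunE eqxx.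
    apply/forallP => b; rewrite inE negb_or ffunE; apply/implyP => /andP[/negbTE -> bs].
    exact: (implyP (H b)).
  apply/implyP => bs; rewrite -E ffunE; have [//|ba] := eqVneq b a.
  by have := H b; rewrite inE negb_or ba bs.
move=> _; rewrite big_cons ffunE eqxx -mulrA.
have updE b : b \in s -> upd ka k b = ka b.
  by move=> bs; rewrite ffunE; case: eqP => // e; rewrite -e bs in a_s.
congr (_ * (_ * _)); first by apply: eq_big_seq => b /updE ->.
rewrite (_ : [seq g b (upd ka k b) | b <- s] = [seq g b (ka b) | b <- s]).
  by apply: haf_perm => //; rewrite -cat1s perm_sym -cat1s perm_catCA.
by apply/eq_in_map => b /updE ->.
Qed.

Lemma haf_expand L : all P L ->
  haf w ([seq f a | a : X] ++ L) =
  \sum_(ka : {ffun X -> K})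
     (\prod_a c a (ka a)) * haf w ([seq g a (ka a) | a : X] ++ L).
Proof.
move=> PL; rewrite haf_expand_seq ?enum_uniq //; apply: eq_big => ka.
  by apply/forallP => a; rewrite mem_enum.
by move=> _; rewrite big_enum.
Qed.

End HafnianMultilinear.

Section Clusters.
Variables (R : realType) (d : nat) (phi : R) (N : nat) (I : finType).
Variables (x y : I -> 'rV[R]_d).

(** A leg is given by its cluster, its multiindex and its kind. *)
Definition leg : Type := (I * mindex d * nat)%type.

Definition leg_at (l : leg) : seq (R * mindex d * 'rV[R]_d) :=
  leg_rep N (x l.1.1) (y l.1.1) l.1.2 l.2.

(** Inside a cluster, only a raw leg at the satellite and a leg at the centre
   are contracted. *)
Definition leg_weight (l l' : leg) : R :=
  if l.1.1 == l'.1.1 then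
    if (l.2 == Kraw) && (l'.2 == Kcentre) then
      dcov phi l.1.2 l'.1.2 (y l.1.1) (x l.1.1)
    else if (l.2 == Kcentre) && (l'.2 == Kraw) then
      dcov phi l'.1.2 l.1.2 (y l.1.1) (x l.1.1)
    else 0
  else pairing phi (leg_at l) (leg_at l').

Hypothesis sep : forall i j, i != j -> [/\ x i != x j, x i != y j & y i != y j].

Lemma leg_at_point l b : b \in leg_at l -> b.2 = x l.1.1 \/ b.2 = y l.1.1.
Proof.
rewrite /leg_at /leg_rep; case: ifP => _; first by rewrite inE => /eqP ->; left.
case: ifP => _; last by rewrite inE => /eqP ->; right.
by rewrite inE => /orP[/eqP ->|/mapP[al _ ->]]; [right|left].
Qed.

Lemma leg_weightC l l' : leg_weight l l' = leg_weight l' l.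
Proof.
rewrite /leg_weight [l'.1.1 == _]eq_sym; case: eqP => [->|/eqP ij].
  case: l l' => [[i nu] K] [[j mu] K'] /=.
  by do 4!case: eqP => [?|?] //=; subst.
rewrite /pairing exchange_big /=; apply: eq_big_seq => b bl'.
apply: eq_big_seq => a al; rewrite [a.1.1 * _]mulrC dcovC //.
have [s1 s2 s3] := sep ij.
have [_ s4 _] : [/\ x l'.1.1 != x l.1.1, x l'.1.1 != y l.1.1 & y l'.1.1 != y l.1.1].
  by apply: sep; rewrite eq_sym.
by case: (leg_at_point al) => ->; case: (leg_at_point bl') => -> //; rewrite eq_sym.
Qed.

Let H := haf leg_weight.

Section Wick.
Variables (i : I) (F1 F2 : finType) (n1 : F1 -> mindex d) (n2 : F2 -> mindex d).

Let raw a : leg := (i, n1 a, Kraw).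
Let wick a : leg := (i, n1 a, Kwick).
Let cen b : leg := (i, n2 b, Kcentre).

(** Expanding the hafnian along a raw leg either contracts this leg inside the
   cluster or leaves it for the other clusters, as a Wick leg: this is the
   recursion satisfied by sums over partial matchings. *)
Lemma haf_wick s (S : {set F2}) L : uniq s ->
  (forall l : leg, l \in L -> (l.1.1 != i) || (l.2 == Kwick)) ->
  H (map raw s ++ map cen (enum S) ++ L) =
  pmatching_sum (fun a b => dcov phi (n1 a) (n2 b) (y i) (x i)) s S
    (fun U1 U2 => H (map wick U1 ++ map cen (enum U2) ++ L)).
Proof.
elim: s S L => [|a s IH] S L.
  by move=> _ _; rewrite pmatching_sum_nil.
move=> us HL; rewrite pmatching_sum_cons //; case/andP: us => a_s us.
have -> : H (map raw (a :: s) ++ map cen (enum S) ++ L) =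
   H (wick a :: map raw s ++ map cen (enum S) ++ L) +
   \sum_(b in S) dcov phi (n1 a) (n2 b) (y i) (x i) *
      H (map raw s ++ map cen (enum (S :\ b)%SET) ++ L).
  rewrite /H map_cons cat_cons !haf_cons; set rest := map raw s ++ _ ++ _.
  have sumE (h : leg -> R) : \sum_(l <- rest) h l =
      \sum_(a' <- s) h (raw a') + (\sum_(b in S) h (cen b) + \sum_(l <- L) h l).
    by rewrite /rest !big_cat !big_map big_enum.
  rewrite !sumE big1 => [|a' _]; last by rewrite /leg_weight eqxx mul0r.
  rewrite [X in _ = _ + (X + _) + _]big1 => [|b _]; last by rewrite /leg_weight eqxx mul0r.
  rewrite !add0r addrC; congr (_ + _).
    apply: eq_big_seq => l /HL lL; congr (_ * _); rewrite /leg_weight /leg_at /=.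
    by case: (i =P l.1.1) lL => [<-|//]; rewrite eqxx /= => /eqP ->.
  apply: eq_bigr => b bS; rewrite {1}/leg_weight eqxx /=.
  congr (_ * _); apply: haf_perm; first exact: leg_weightC.
  have bin : cen b \in rest.
    by rewrite !mem_cat (map_f cen) ?orbT // mem_enum.
  rewrite -(perm_cons (cen b)); apply: perm_trans (_ : perm_eq rest _).
    by rewrite perm_sym perm_to_rem.
  rewrite /rest -cat1s perm_sym perm_catCA perm_cat2l cat1s -cat_cons perm_cat2r perm_sym.
  rewrite -(map_cons cen); apply: perm_map.
  apply: uniq_perm; rewrite /= ?enum_uniq ?mem_enum ?inE ?eqxx //.
  by move=> e; rewrite !(inE, mem_enum); case: eqP => [->|].
congr (_ + _); last first.
  by apply: eq_bigr => b _; rewrite IH.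
transitivity (H (map raw s ++ map cen (enum S) ++ wick a :: L)).
  apply: haf_perm; first exact: leg_weightC.
  exact: perm_cons_cat.
rewrite IH //; last first.
  by move=> l; rewrite inE => /orP[/eqP ->|/HL //]; rewrite eqxx orbT.
apply: eq_bigr => V _; congr (_ * _); apply: haf_perm; first exact: leg_weightC.
by rewrite map_cons perm_sym perm_cons_cat.
Qed.

End Wick.

Section Expansion.
Variable i : I.

(** The index of a term in the Taylor expansion, around the centre, of a leg at
   the satellite: a Taylor monomial, or the remainder. *)
Definition tindex : finType := option (seq_sub (mcomp_le d N)).

Definition tcoef (k : tindex) : R :=
  if k is Some be then taylor_coef (y i - x i) (val be) else 1.

Definition tleg (nu : mindex d) (k : tindex) : leg :=
  if k is Some be then (i, nu + val be, Kcentre) else (i, nu, Kremainder).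

(** Within the cluster both sides vanish; elsewhere the Taylor monomials at the
   centre cancel those subtracted in the remainder. *)
Lemma leg_weight_expand nu (l : leg) : (l.1.1 != i) || (l.2 != Kraw) ->
  leg_weight (i, nu, Kwick) l = \sum_k tcoef k * leg_weight (tleg nu k) l.
Proof.
move=> Hl; have [il|il] := eqVneq i l.1.1.
  rewrite il eqxx /= in Hl.
  rewrite {1}/leg_weight /= il eqxx big1 // => k _; rewrite /leg_weight.
  by case: k => [be|] /=; rewrite il eqxx /= ?(negbTE Hl) mulr0.
have cl k : (tleg nu k).1.1 = i by case: k.
rewrite {1}/leg_weight /= (negbTE il).
under eq_bigr do rewrite /leg_weight cl (negbTE il).
pose h (p : mindex d * 'rV[R]_d) : R :=
  \sum_(b <- leg_at l) b.1.1 * dcov phi p.1 b.1.2 p.2 b.2.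
have pE s : pairing phi s (leg_at l) = \sum_(a <- s) a.1.1 * h (a.1.2, a.2).
  apply: eq_bigr => a _; rewrite mulr_sumr; apply: eq_bigr => b _; by rewrite mulrA.
under eq_bigr do rewrite pE.
rewrite pE /leg_at /= /leg_rep /= big_seq1 mul1r.
rewrite (bigD1 None) //= big_cons big_map !mul1r -addrA.
rewrite [X in _ = _ + X](_ : _ = 0) ?addr0 //.
rewrite (reindex_onto Some (odflt (SeqSub (mcomp_le0 d N)))) /=; last by case.
under [X in _ + X]eq_bigl do rewrite eqxx.
have -> : \sum_(be : seq_sub (mcomp_le d N)) tcoef (Some be) *
   \sum_(a <- leg_rep N (x i) (y i) (tleg nu (Some be)).1.2 (tleg nu (Some be)).2)
      a.1.1 * h (a.1.2, a.2) =
   \sum_(be <- mcomp_le d N) taylor_coef (y i - x i) be * h (nu + be, x i).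
  rewrite -(big_seq_sub _ (mcomp_le_uniq d N)).
  by apply: eq_bigr => be _; rewrite big_seq1 mul1r.
by rewrite -big_split big1 // => be _; rewrite /= mulNr addNr.
Qed.

End Expansion.

End Clusters.

(** * The operator product expansion *)

Section ScalingDimension.
Variables (R : realType) (d : nat) (phi : R).
Hypothesis phi_gt0 : 0 < phi.

Lemma enum_mset_nu (A : label d) : enum_mset A = [seq nu j | j <- enum 'I_(lrank A)].
Proof. by rewrite /nu map_tnth_enum. Qed.

Lemma scdimE (A : label d) : scdim phi A = \sum_(al <- enum_mset A) (phi + (mdegree al)%:R).
Proof.
rewrite [in RHS]enum_mset_nu big_map big_enum big_split /=; congr (_ + _).
by rewrite sumr_const card_ord mulr_natl.
Qed.

Lemma mdegree_scdim (A : label d) al : al \in enum_mset A -> (mdegree al)%:R <= scdim phi A.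
Proof.
move=> alA; rewrite scdimE.
apply: le_trans (ler_sum_mem (F := fun al : mindex d => phi + (mdegree al)%:R) alA _).
  by rewrite lerDr ltW.
by move=> b; rewrite addr_ge0 // ltW.
Qed.

(** A label of bounded dimension has boundedly many entries, of bounded
   degree. *)
Lemma finite_scdim (Delta : R) : finite_set [set C : label d | scdim phi C <= Delta]%classic.
Proof.
pose m := Num.truncn (Delta / phi); pose n := Num.truncn Delta.
pose T := {k : 'I_m.+1 & k.-tuple (seq_sub (mcomp_le d n))}.
pose f (t : T) : label d := seq_mset (map val (tagged t)).
apply: (@sub_finite_set _ _ (f @` setT)%classic); last exact/finite_image/finite_finset.
move=> C /= CD.
have D0 : 0 <= Delta.
  apply: le_trans CD; rewrite scdimE; apply: sumr_ge0 => al _.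
  by rewrite addr_ge0 // ltW.
have szC : (size (enum_mset C) < m.+1)%N.
  rewrite ltnS truncn_ge_nat; last by rewrite divr_ge0 // ltW.
  rewrite ler_pdivlMr //.
  apply: le_trans CD; rewrite /scdim lerDl; apply: sumr_ge0 => j _; exact: ler0n.
have inC al : al \in enum_mset C -> al \in mcomp_le d n.
  by move=> alC; rewrite mem_mcomp_le truncn_ge_nat // (le_trans (mdegree_scdim alC)).
pose s := pmap (insub : mindex d -> option (seq_sub (mcomp_le d n))) (enum_mset C).
have sE : map val s = enum_mset C.
  rewrite /s pmap_filter; last exact: insubK.
  by apply/all_filterP/allP => al /inC alN; rewrite isSome_insub.
have szs : size s == Ordinal szC by rewrite -(size_map val) sE.
exists (existT (fun k : 'I_m.+1 => k.-tuple (seq_sub (mcomp_le d n))) (Ordinal szC) (Tuple szs)) => //.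
by rewrite /f /= sE seq_mset_id.
Qed.

Lemma mem_low_labels (Delta : R) (C : label d) :
  (C \in enum_fset (fset_set [set C : label d | scdim phi C <= Delta]%classic)) =
  (scdim phi C <= Delta).
Proof.
rewrite -[LHS]/(C \in fset_set _) in_fset_set; last exact: finite_scdim.
by apply/idP/idP => [/set_mem //|CD]; exact/mem_set.
Qed.

End ScalingDimension.

Section ClusterExpansion.
Variables (R : realType) (d : nat) (phi : R) (N : nat) (I : finType).
Variables (x y : I -> 'rV[R]_d).
Hypothesis phi_gt0 : 0 < phi.
Hypothesis sep : forall i j, i != j -> [/\ x i != x j, x i != y j & y i != y j].

Let H := haf (leg_weight phi N x y).

Definition centre_legs (i : I) (C : label d) : seq (leg d I) :=
  [seq (i, al, Kcentre) | al <- enum_mset C].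

Definition raw_legs (i : I) (A : label d) : seq (leg d I) :=
  [seq (i, al, Kraw) | al <- enum_mset A].

(** A Taylor remainder of order k trades a factor |y - x|^k for k more
   derivatives, so its order counts in the dimension. *)
Definition leg_dim (l : leg d I) : R := phi + (mdegree l.1.2)%:R + (korder N l.2)%:R.

Definition legs_dim (L : seq (leg d I)) : R := \sum_(l <- L) leg_dim l.

Lemma legs_dim_perm L1 L2 : perm_eq L1 L2 -> legs_dim L1 = legs_dim L2.
Proof. exact: perm_big. Qed.

Lemma legs_dim_centre i C : legs_dim (centre_legs i C) = scdim phi C.
Proof.
by rewrite scdimE /legs_dim big_map; apply: eq_bigr => al _; rewrite /leg_dim addr0.
Qed.

Section OneCluster.
Variables (i : I) (A B : label d).
Notation matching := {set 'I_(lrank A) * 'I_(lrank B)}.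

Definition matching_coef (V : matching) : R :=
  \prod_(p in V) dcov phi (nu p.1) (nu p.2) (y i) (x i).

(** The legs left after contracting along V, those of A being replaced by the
   terms ka of their Taylor expansions. *)
Definition term_legs (V : matching) (ka : {ffun free1 V -> tindex d N}) : seq (leg d I) :=
  [seq tleg i (nu (val a)) (ka a) | a : free1 V] ++
  [seq (i, nu b, Kcentre) | b <- enum (unmatched2 V)].

Definition term_coef (V : matching) (ka : {ffun free1 V -> tindex d N}) : R :=
  matching_coef V * \prod_a tcoef x y i (ka a).

(** Wick's theorem, then the Taylor expansion of all the legs left at the
   satellite. *)
Lemma cluster_expand L : (forall l, l \in L -> l.1.1 != i) ->
  H (raw_legs i A ++ centre_legs i B ++ L) =
  \sum_(V : matching | partial_matching V)
    \sum_(ka : {ffun free1 V -> tindex d N}) term_coef ka * H (term_legs ka ++ L).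
Proof.
move=> HL.
have -> : raw_legs i A = [seq (i, nu a, Kraw) | a <- enum 'I_(lrank A)].
  by rewrite /raw_legs enum_mset_nu -map_comp.
have -> : centre_legs i B = [seq (i, nu b, Kcentre) | b <- enum [set: 'I_(lrank B)]%SET].
  rewrite /centre_legs enum_mset_nu -map_comp; congr map.
  by apply: eq_enum => b; rewrite !inE.
rewrite {1}/H (@haf_wick R d phi N I x y sep i _ _ (@nu d A) (@nu d B)) ?enum_uniq //; last first.
  by move=> l /HL ->.
apply: eq_big => V.
  by rewrite andb_idr // => _; apply/withinP => a b _; rewrite mem_enum inE.
move=> _.
have wC := leg_weightC phi N sep.
transitivity (matching_coef V *
   H ([seq (i, nu (val a), Kwick) | a : free1 V] ++
      ([seq (i, nu b, Kcentre) | b <- enum (unmatched2 V)] ++ L))).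
  congr (_ * _); apply: haf_perm => //; apply: perm_cat; last apply: perm_cat => //.
    rewrite [X in perm_eq _ X](map_comp (fun a => (i, nu a, Kwick)) val); apply: perm_map.
    apply: uniq_perm; first by rewrite filter_uniq ?enum_uniq.
      by rewrite map_inj_uniq ?enum_uniq //; exact: val_inj.
    move=> a; rewrite mem_filter mem_enum andbT; apply/idP/mapP => [Va|[e _ ->]].
      by exists (Sub a Va); rewrite ?mem_enum.
    exact: valP e.
  apply: perm_map; apply: uniq_perm; rewrite ?enum_uniq // => b.
  by rewrite !mem_enum !inE.
rewrite /H (haf_expand wC (X := free1 V) (K := tindex d N)
   (g := fun a k => tleg i (nu (val a)) k) (c := fun a k => tcoef x y i k) None
   (P := fun l => (l.1.1 != i) || (l.2 != Kraw))); first last.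
- rewrite all_cat; apply/andP; split; last by apply/allP => l /HL ->.
  by apply/allP => _ /mapP[b _ ->]; rewrite orbT.
- by move=> a l Hl; apply: leg_weight_expand.
- by move=> a [be|] /=; rewrite orbT.
- by move=> a; rewrite orbT.
rewrite mulr_sumr; apply: eq_bigr => ka _.
by rewrite mulrA catA.
Qed.

Variable Delta : R.
Hypothesis Delta_N : Delta < N.+1%:R.

(** The terms that the operator product expansion subtracts; the coercion of
   ka a to bool is false on the remainder None. *)
Definition ope_term (V : matching) (ka : {ffun free1 V -> tindex d N}) : bool :=
  [forall a, ka a : bool] && (legs_dim (term_legs ka) <= Delta).

Lemma taylor_coef_prod (F : finType) (u : 'rV[R]_d) (be : F -> mindex d) :
  mpower u (\sum_a be a) / (\prod_a mfactorial (be a))%N%:R =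
  \prod_a taylor_coef u (be a).
Proof.
rewrite natr_prod prodf_div; congr (_ / _).
by apply: (big_morph (fun al => mpower u al) (@mpowerD _ _ u) (mpower0 u)).
Qed.

Lemma residual_legs (V : matching) (be : {ffun free1 V -> mindex d}) :
  perm_eq (centre_legs i (residual be))
    ([seq (i, nu (val a) + be a, Kcentre) | a : free1 V] ++
     [seq (i, nu b, Kcentre) | b <- enum (unmatched2 V)]).
Proof.
apply: perm_trans (perm_map _ (perm_eq_seq_mset _)) _.
by rewrite map_cat; apply: perm_cat; rewrite -[X in perm_eq X _]map_comp.
Qed.

Lemma scdim_residual_bound (V : matching) (be : {ffun free1 V -> mindex d}) a :
  (mdegree (be a))%:R <= scdim phi (residual be).
Proof.
have m : nu (val a) + be a \in enum_mset (residual be).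
  rewrite (perm_mem (perm_eq_seq_mset _)) mem_cat; apply/orP; left.
  by apply/mapP; exists a; rewrite ?mem_enum.
apply: le_trans (mdegree_scdim phi_gt0 m).
by rewrite ler_nat mdegreeD leq_addl.
Qed.

Lemma sum_eq_mul (T : eqType) (s : seq T) (r : T) (h : T -> R) : uniq s ->
  \sum_(C <- s) (r == C)%:R * h C = if r \in s then h r else 0.
Proof.
move=> us; case: ifP => rs.
  rewrite (bigD1_seq r) //= eqxx mul1r big1 ?addr0 // => C Cr.
  by rewrite eq_sym (negbTE Cr) mul0r.
rewrite big_seq big1 // => C Cs; case: eqP => [e|_]; last by rewrite mul0r.
by rewrite -e rs in Cs.
Qed.

(** Grouping the terms by the label of their legs gives the OPE coefficients.
   As Delta < N + 1, every multiindex that occurs in a label of dimension at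
   most Delta belongs to the Taylor expansion of order N. *)
Lemma ope_sum L :
  \sum_(C <- enum_fset (fset_set [set C : label d | scdim phi C <= Delta]%classic))
     ope_coef phi A B C (y i) (x i) * H (centre_legs i C ++ L) =
  \sum_(V : matching | partial_matching V)
    \sum_(ka : {ffun free1 V -> tindex d N} | ope_term ka)
       term_coef ka * H (term_legs ka ++ L).
Proof.
set low := enum_fset _.
have wC := leg_weightC phi N sep.
pose bex (V : matching) (kb : {ffun free1 V -> seq_sub (mcomp_le d N)}) : {ffun free1 V -> mindex d} :=
  [ffun a => val (kb a)].
have bexE (V : matching) C : C \in low ->
  \sum_(be \in [set: {ffun free1 V -> mindex d}]%classic)
       (mpower (y i - x i) (\sum_(a : free1 V) be a)
        / (\prod_(a : free1 V) mfactorial (be a))%N%:R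
        * (residual be == C)%:R) =
  \sum_(kb : {ffun free1 V -> seq_sub (mcomp_le d N)})
     (\prod_a taylor_coef (y i - x i) (val (kb a))) * (residual (bex V kb) == C)%:R.
  rewrite mem_low_labels // => CD.
  rewrite (fsbigE [seq bex V kb | kb : {ffun free1 V -> seq_sub (mcomp_le d N)}]) //; first last.
  - move=> be _ beS; case: eqP => [e|_]; last by rewrite mulr0.
    case/negP: beS; apply/mapP.
    have beN a : be a \in mcomp_le d N.
      rewrite mem_mcomp_le -ltnS -(ltr_nat R); apply: le_lt_trans Delta_N.
      by apply: le_trans CD; rewrite -e scdim_residual_bound.
    exists [ffun a => SeqSub (beN a)]; first by rewrite mem_enum.
    by apply/ffunP => a; rewrite !ffunE.
  - rewrite map_inj_uniq ?enum_uniq // => kb kb' /ffunP e; apply/ffunP => a.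
    by apply: val_inj; have := e a; rewrite !ffunE.
  rewrite big_map big_enum_cond /=; apply: eq_big => kb; first by rewrite in_setT.
  move=> _; rewrite taylor_coef_prod; congr (_ * _).
  by apply: eq_bigr => a _; rewrite ffunE.
transitivity (\sum_(C <- low) \sum_(V : matching | partial_matching V)
   \sum_(kb : {ffun free1 V -> seq_sub (mcomp_le d N)})
     matching_coef V * (\prod_a taylor_coef (y i - x i) (val (kb a))) *
     ((residual (bex V kb) == C)%:R * H (centre_legs i C ++ L))).
  apply: eq_big_seq => C Clow; rewrite /ope_coef mulr_suml; apply: eq_bigr => V _.
  rewrite bexE // -/(matching_coef V) mulr_sumr mulr_suml.
  by apply: eq_bigr => kb _; rewrite !mulrA.
rewrite exchange_big; apply: eq_bigr => V pV; rewrite exchange_big /=.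
pose dflt := SeqSub (mcomp_le0 d N).
pose som (kb : {ffun free1 V -> seq_sub (mcomp_le d N)}) : {ffun free1 V -> tindex d N} :=
  [ffun a => Some (kb a)].
rewrite (reindex_onto som (fun ka => [ffun a => odflt dflt (ka a)])) /=; last first.
  move=> ka /andP[/forallP kaS _]; apply/ffunP => a; rewrite !ffunE.
  by have := kaS a; case: (ka a).
have legsE kb : perm_eq (centre_legs i (residual (bex V kb))) (term_legs (som kb)).
  apply: perm_trans (residual_legs _) _; rewrite /term_legs perm_cat2r.
  rewrite (_ : [seq _ | a : free1 V] = [seq tleg i (nu (val a)) (som kb a) | a : free1 V]) //.
  by apply: eq_map => a; rewrite !ffunE.
rewrite [RHS]big_mkcond; apply: eq_bigr => kb _.
rewrite -mulr_sumr sum_eq_mul ?fset_uniq // mem_low_labels //.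
rewrite -(legs_dim_centre i) (legs_dim_perm (legsE kb)).
have -> : [ffun a => odflt dflt (som kb a)] == kb.
  by apply/eqP/ffunP => a; rewrite !ffunE.
rewrite andbT /ope_term.
have -> : [forall a, som kb a : bool] by apply/forallP => a; rewrite ffunE.
rewrite /=; case: ifP => _; last by rewrite mulr0.
rewrite /term_coef; congr (_ * _ * _).
  by apply: eq_bigr => a _; rewrite ffunE.
apply: haf_perm => //; by rewrite perm_cat2r.
Qed.

End OneCluster.
End ClusterExpansion.

(** * Size of a term *)

Section PowerProducts.
Variable R : realType.

Lemma powR_sum (T : Type) (s : seq T) (P : pred T) (e : T -> R) (a : R) : 0 < a ->
  a `^ (\sum_(b <- s | P b) e b) = \prod_(b <- s | P b) a `^ e b.
Proof.
move=> a0; apply: (big_morph (fun e => a `^ e)); last exact: powRr0.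
by move=> e1 e2; rewrite powRD // (gt_eqF a0) implybT.
Qed.

End PowerProducts.

Section LegBounds.
Variables (R : realType) (d : nat) (phi : R) (N : nat) (I : finType).
Variables (x y : I -> 'rV[R]_d) (delta : I -> R).
Hypothesis phi_gt0 : 0 < phi.
Hypothesis delta_gt0 : forall i, 0 < delta i.
Hypothesis deltaP : forall i j, i != j -> delta i <= enorm (x i - x j).
Hypothesis near_centre : forall i, enorm (y i - x i) <= delta i / 4.

Let s i := enorm (y i - x i).

Lemma leg_dim_ge0 (l : leg d I) : 0 <= leg_dim phi N l.
Proof. by rewrite !addr_ge0 // ltW. Qed.

(** The share of a leg in the bound on each of its contractions. *)
Definition leg_bound (c : R) (l : leg d I) : R :=
  c * s l.1.1 ^+ korder N l.2 * delta l.1.1 `^ (- leg_dim phi N l).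

Lemma leg_bound_ge0 c l : 0 <= c -> 0 <= leg_bound c l.
Proof. by move=> c0; rewrite !mulr_ge0 ?powR_ge0 ?exprn_ge0 ?enorm_ge0. Qed.

(** The distance of the centres is at least the radius delta of each cluster, so
   its power can be divided between the two legs. *)
Lemma leg_weight_bound c (l l' : leg d I) : 1 <= c -> (l.2 <= 1)%N -> (l'.2 <= 1)%N ->
  edge_const phi N l.1.2 l.2 l'.1.2 l'.2 <= c ->
  `|leg_weight phi N x y l l'| <= leg_bound c l * leg_bound c l'.
Proof.
move=> c1 K1 K1' lec; have c0 : 0 <= c by apply: le_trans c1.
rewrite /leg_weight; case: eqP => [e|/eqP ij].
  rewrite (_ : (l.2 == Kraw) = false); last by case: (l.2) K1 => [|[]].
  rewrite (_ : (l'.2 == Kraw) = false); last by case: (l'.2) K1' => [|[]].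
  by rewrite andbF normr0 mulr_ge0 ?leg_bound_ge0.
have r_i := deltaP ij.
have r_j : delta l'.1.1 <= enorm (x l.1.1 - x l'.1.1).
  by rewrite enormB; apply: deltaP; rewrite eq_sym.
have r0 : 0 < enorm (x l.1.1 - x l'.1.1) by apply: lt_le_trans r_i.
have xij : x l.1.1 != x l'.1.1.
  by apply: contraTneq r0 => ->; rewrite subrr enorm0 ltxx.
have n1 : s l.1.1 <= enorm (x l.1.1 - x l'.1.1) / 4.
  by apply: le_trans (near_centre _) _; rewrite ler_pM2r.
have n2 : s l'.1.1 <= enorm (x l.1.1 - x l'.1.1) / 4.
  by apply: le_trans (near_centre _) _; rewrite ler_pM2r.
apply: le_trans (pairing_bound N phi_gt0 xij n1 n2 l.1.2 l'.1.2 K1 K1') _.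
have -> : - (2 * phi + (mdegree l.1.2 + korder N l.2)%:R + (mdegree l'.1.2 + korder N l'.2)%:R) =
   - leg_dim phi N l + - leg_dim phi N l'.
  by rewrite /leg_dim !natrD; ring.
rewrite powRD ?(gt_eqF r0) ?implybT // -!/(s _).
have b1 := ler_powRN (delta_gt0 _) r_i (leg_dim_ge0 l).
have b2 := ler_powRN (delta_gt0 _) r_j (leg_dim_ge0 l').
rewrite /leg_bound.
rewrite [leRHS](_ : _ = c * c * s l.1.1 ^+ korder N l.2 * s l'.1.1 ^+ korder N l'.2 *
  (delta l.1.1 `^ (- leg_dim phi N l) * delta l'.1.1 `^ (- leg_dim phi N l'))); last by ring.
have sk i k : 0 <= s i ^+ k by rewrite exprn_ge0 ?enorm_ge0.
have := edge_const_ge0 phi N l.1.2 l.2 l'.1.2 l'.2.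
move: (edge_const _ _ _ _ _ _) lec => E Ec E0.
apply: ler_pM; rewrite ?mulr_ge0 ?powR_ge0 ?sk //.
  rewrite !ler_wpM2r ?sk //; apply: le_trans Ec _.
  by rewrite ler_peMl.
by apply: ler_pM; rewrite ?powR_ge0.
Qed.

Lemma prod_leg_bound c i (L : seq (leg d I)) : (forall l, l \in L -> l.1.1 = i) ->
  \prod_(l <- L) leg_bound c l =
  c ^+ size L * s i ^+ (\sum_(l <- L) korder N l.2)%N * delta i `^ (- legs_dim phi N L).
Proof.
elim: L => [|l L IH] HL.
  by rewrite !big_nil /legs_dim big_nil oppr0 powRr0 !expr0 !mulr1.
rewrite !big_cons /legs_dim big_cons IH => [|l' l'L]; last by apply: HL; rewrite inE l'L orbT.
rewrite opprD powRD ?(gt_eqF (delta_gt0 i)) ?implybT // /leg_bound (HL l) ?mem_head //.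
rewrite exprS exprD -/(legs_dim phi N L); ring.
Qed.

Section OneCluster.
Variables (i : I) (A B : label d).
Hypothesis xy : x i != y i.
Notation matching := {set 'I_(lrank A) * 'I_(lrank B)}.

Definition tdegree (k : tindex d N) : nat := if k is Some be then mdegree (val be) else N.+1.

Lemma sum_matched (V : matching) (f : 'I_(lrank A) -> R) : partial_matching V ->
  \sum_a f a = \sum_(p in V) f p.1 + \sum_(a : free1 V) f (val a).
Proof.
move=> /pmatchingP pV; rewrite (bigID (fun a => unmatched1 V a)) /= addrC; congr (_ + _).
  rewrite -(big_imset (h := fst) (A := V)) /=; last first.
    move=> [a b] [a' b'] abV abV' /= e.
    by have [|-> ->] := pV _ _ _ _ abV abV'; first by left.
  apply: eq_bigl => a; apply/idP/imsetP => [|[[a' b] abV /= ->]].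
    rewrite /unmatched1 negb_forall => /existsP[b]; rewrite negbK => abV.
    by exists (a, b).
  by rewrite /unmatched1 negb_forall; apply/existsP; exists b; rewrite negbK.
rewrite (reindex_omap (val : free1 V -> _) insub) /=; last first.
  by move=> a fa; rewrite insubT.
by apply: eq_bigl => a; rewrite (valP a) valK eqxx.
Qed.

Lemma sum_matched2 (V : matching) (f : 'I_(lrank B) -> R) : partial_matching V ->
  \sum_b f b = \sum_(p in V) f p.2 + \sum_(b in unmatched2 V) f b.
Proof.
move=> /pmatchingP pV; rewrite (bigID (fun b => unmatched2 V b)) /= addrC; congr (_ + _).
rewrite -(big_imset (h := snd) (A := V)) /=; last first.
  move=> [a b] [a' b'] abV abV' /= e.
  by have [|-> ->] := pV _ _ _ _ abV abV'; first by right.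
apply: eq_bigl => b; apply/idP/imsetP => [|[[a b'] abV /= ->]].
  rewrite /unmatched2 negb_forall => /existsP[a]; rewrite negbK => abV.
  by exists (a, b).
by rewrite /unmatched2 negb_forall; apply/existsP; exists a; rewrite negbK.
Qed.

Definition pair_dim (p : 'I_(lrank A) * 'I_(lrank B)) : R :=
  2 * phi + (mdegree (nu p.1))%:R + (mdegree (nu p.2))%:R.

Lemma scdim_nu (C : label d) : scdim phi C = \sum_(j < lrank C) (phi + (mdegree (nu j))%:R).
Proof. by rewrite scdimE enum_mset_nu big_map big_enum. Qed.

(** Dimension count: contractions remove the dimension of the contracted pairs
   and each Taylor term adds its order. *)
Lemma legs_dim_term (V : matching) (ka : {ffun free1 V -> tindex d N}) : partial_matching V ->
  legs_dim phi N (term_legs i ka) =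
  scdim phi A + scdim phi B - \sum_(p in V) pair_dim p + \sum_a (tdegree (ka a))%:R.
Proof.
move=> pV; rewrite !scdim_nu (sum_matched _ pV) (sum_matched2 _ pV).
rewrite /legs_dim big_cat !big_map /= !big_enum /=.
have -> : \sum_(p in V) pair_dim p = \sum_(p in V) (phi + (mdegree (nu p.1))%:R) +
   \sum_(p in V) (phi + (mdegree (nu p.2))%:R).
  by rewrite -big_split; apply: eq_bigr => p _; rewrite /pair_dim /=; ring.
have -> : \sum_a leg_dim phi N (tleg i (nu (val a)) (ka a)) =
   \sum_(a : free1 V) (phi + (mdegree (nu (val a)))%:R) + \sum_a (tdegree (ka a))%:R.
  rewrite -big_split; apply: eq_bigr => a _; rewrite /leg_dim /tdegree.
  by case: (ka a) => [be|] /=; rewrite ?mdegreeD ?natrD ?addr0 ?addrA.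
have -> : \sum_(b in unmatched2 V) leg_dim phi N (i, nu b, Kcentre) =
  \sum_(b in unmatched2 V) (phi + (mdegree (nu b))%:R).
  by apply: eq_bigr => b _; rewrite /leg_dim addr0.
pose f1 := \sum_(a : free1 V) (phi + (mdegree (nu (val a)))%:R).
rewrite [X in X + _ + _ = _](_ : _ = f1) // [X in _ = _ + X + _ - _ + _](_ : _ = f1) //.
move: f1 (\sum_a (tdegree (ka a))%:R : R) => f1 f2.
move: (\sum_(b in unmatched2 V) _ : R) => f3.
move: (\sum_(p in V) (phi + (mdegree (nu p.1))%:R) : R) => g1.
move: (\sum_(p in V) (phi + (mdegree (nu p.2))%:R) : R) => g2.
ring.
Qed.

Definition term_const (V : matching) : R :=
  \prod_(p in V) dcov_const phi (nu p.1) (nu p.2).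

Lemma term_const_ge0 (V : matching) : 0 <= term_const V.
Proof. by apply: prodr_ge0 => p _; exact: dcov_const_ge0. Qed.

Let s0 : 0 < s i.
Proof. by rewrite enorm_gt0 // subr_eq0 eq_sym. Qed.

(** By the dimension count, the contractions inside the cluster and the Taylor
   factors together give |y - x| to the power dim - [A] - [B].  As |y - x| is at
   most delta, the dimension may be lowered to D. *)
Lemma term_bound c (V : matching) (ka : {ffun free1 V -> tindex d N}) (D : R) :
  0 <= c -> partial_matching V -> D <= legs_dim phi N (term_legs i ka) ->
  `|term_coef phi x y i ka| * \prod_(l <- term_legs i ka) leg_bound c l <=
  term_const V * c ^+ size (term_legs i ka) *
    (s i `^ (D - scdim phi A - scdim phi B) * delta i `^ (- D)).
Proof.
move=> c0 pV De; set dim := legs_dim phi N _ in De *.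
have tV : `|matching_coef phi x y i V| <= term_const V * s i `^ (- \sum_(p in V) pair_dim p).
  rewrite /matching_coef normr_prod -sumrN powR_sum // -big_split /=.
  apply: ler_prod => p _; rewrite normr_ge0 /=; apply: dcov_bound; by rewrite eq_sym.
have tT : `|\prod_a tcoef x y i (ka a)| * s i ^+ (\sum_(l <- term_legs i ka) korder N l.2)%N
   <= s i `^ (\sum_a (tdegree (ka a))%:R).
  rewrite powR_sum // big_cat !big_map /= !big_enum /= [X in (_ + X)%N]big1 // addn0.
  rewrite normr_prod -prodrXr -big_split /=; apply: ler_prod => a _.
  rewrite mulr_ge0 ?exprn_ge0 ?enorm_ge0 //= powR_mulrn ?enorm_ge0 // /tcoef /tdegree.
  case: (ka a) => [be|] /=; last by rewrite normr1 mul1r.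
  by rewrite mulr1 taylor_coef_bound.
rewrite (@prod_leg_bound c i); last first.
  move=> l; rewrite mem_cat => /orP[] /mapP[a _ ->] //.
  by rewrite /tleg; case: (ka a).
rewrite -/dim /term_coef normrM.
have regroup1 (a b C w e : R) : a * b * (C * w * e) = a * (b * w) * C * e by ring.
have regroup2 (a b e C f : R) : a * b * e * C * f = a * C * (b * e * f) by ring.
have regroup3 (a b e f : R) : a * b * (e * f) = a * e * (b * f) by ring.
rewrite regroup1.
apply: le_trans (_ : term_const V * s i `^ (- \sum_(p in V) pair_dim p) *
   s i `^ (\sum_a (tdegree (ka a))%:R) * c ^+ size (term_legs i ka) * delta i `^ (- dim) <= _).
  rewrite !ler_wpM2r ?powR_ge0 ?exprn_ge0 //; apply: ler_pM => //.
  by rewrite mulr_ge0 ?exprn_ge0 ?enorm_ge0.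
have s0' : s i != 0 by rewrite gt_eqF.
have d0' : delta i != 0 by rewrite gt_eqF.
rewrite regroup2.
rewrite ler_wpM2l ?mulr_ge0 ?term_const_ge0 ?exprn_ge0 //.
rewrite -powRD ?s0' ?implybT //.
have -> : - \sum_(p in V) pair_dim p + \sum_a (tdegree (ka a))%:R =
   (dim - D) + (D - scdim phi A - scdim phi B).
  by rewrite /dim legs_dim_term //; ring.
have -> : - dim = - (dim - D) + - D by ring.
have : 0 <= dim - D by rewrite subr_ge0.
move: (dim - D) (D - scdim phi A - scdim phi B) => e1 e2 e1_ge0.
rewrite !powRD ?s0' ?d0' ?implybT //.
rewrite regroup3 ler_piMl ?mulr_ge0 ?powR_ge0 // powRN ler_pdivrMr ?powR_gt0 // mul1r.
apply: ge0_ler_powR; rewrite ?nnegrE ?subr_ge0 ?enorm_ge0 ?(ltW (delta_gt0 i)) //.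
apply: le_trans (near_centre i) _; rewrite ler_pdivrMr //.
by rewrite ler_peMr ?(ltW (delta_gt0 i)) // ler1n.
Qed.

End OneCluster.
End LegBounds.

(** * Products of formal combinations *)

Section Evaluation.
Variable R : realType.

Definition eval (T : Type) (s : seq (R * T)) (F : T -> R) : R :=
  \sum_(t <- s) t.1 * F t.2.

(** The value of a multilinear function of sequences on a product of formal
   combinations of sequences. *)
Fixpoint evalp (J T : Type) (r : seq J) (G : J -> seq (R * seq T)) (F : seq T -> R) : R :=
  if r is j :: r' then eval (G j) (fun a => evalp r' G (fun b => F (a ++ b)))
  else F [::].

Lemma eval_in (T : eqType) (s : seq (R * T)) (F F' : T -> R) :
  (forall t, t \in s -> F t.2 = F' t.2) -> eval s F = eval s F'.
Proof. by move=> FF'; apply: eq_big_seq => t ts; rewrite FF'. Qed.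

Lemma evalp_in (J T : eqType) (r : seq J) (G : J -> seq (R * seq T)) (P : J -> pred T)
    (F F' : seq T -> R) :
  (forall j t, j \in r -> t \in G j -> all (P j) t.2) ->
  (forall b, all (fun l => has (P^~ l) r) b -> F b = F' b) ->
  evalp r G F = evalp r G F'.
Proof.
elim: r F F' => [|j r IH] F F' PG FF' /=; first by apply: FF'.
apply: eval_in => t tj; apply: IH => [k u kr uG|b Pb].
  by apply: (PG k) => //; rewrite inE kr orbT.
apply: FF'; rewrite all_cat; apply/andP; split; apply/allP => l lin /=.
  by rewrite (allP (PG j t _ tj)) // mem_head.
by rewrite (allP Pb l lin) orbT.
Qed.

Lemma eval_evalp (J S T : Type) (s : seq (R * S)) (r : seq J)
    (G : J -> seq (R * seq T)) (F : S -> seq T -> R) :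
  eval s (fun a => evalp r G (F a)) = evalp r G (fun b => eval s (F^~ b)).
Proof.
elim: r F => [|j r IH] F //=.
transitivity (eval (G j) (fun c => eval s (fun a => evalp r G (fun b => F a (c ++ b))))).
  rewrite /eval; under eq_bigr do rewrite mulr_sumr.
  rewrite exchange_big; apply: eq_bigr => c _; rewrite mulr_sumr.
  by apply: eq_bigr => a _; rewrite mulrCA.
by apply: eq_bigr => c _; rewrite (IH (fun a b => F a (c.2 ++ b))).
Qed.

Lemma evalp_cat (J T : Type) (r1 r2 : seq J) (G : J -> seq (R * seq T)) F :
  evalp (r1 ++ r2) G F = evalp r1 G (fun a => evalp r2 G (fun b => F (a ++ b))).
Proof.
elim: r1 F => [|j r1 IH] F //=; apply: eq_bigr => t _; congr (_ * _).
rewrite IH; congr evalp; apply/funext => a; congr evalp; apply/funext => b.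
by rewrite catA.
Qed.

Lemma evalp_map (J K T : Type) (h : K -> J) (r : seq K) (G : J -> seq (R * seq T)) F :
  evalp (map h r) G F = evalp r (G \o h) F.
Proof. by elim: r F => //= k r IH F; apply: eq_bigr => t _; rewrite IH. Qed.

Lemma eval_lmul (d : nat) (s t : lincomb R d) (F : monom R d -> R) :
  eval (lmul s t) F = eval s (fun a => eval t (fun b => F (a ++ b))).
Proof.
rewrite /eval /lmul big_allpairs_dep; apply: eq_bigr => a _.
by rewrite mulr_sumr; apply: eq_bigr => b _; rewrite mulrA.
Qed.

Lemma eval_big_lmul (d : nat) (J : Type) (r : seq J) (G : J -> lincomb R d) F :
  eval (\big[@lmul R d/lone R d]_(j <- r) G j) F = evalp r G F.
Proof.
elim: r F => [|j r IH] F; first by rewrite big_nil /eval big_seq1 mul1r.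
by rewrite big_cons eval_lmul /=; apply: eq_bigr => t _; rewrite IH.
Qed.

(** By multilinearity the factors are replaced one at a time; the legs L that
   surround factor i at this moment are those of the other factors and L0. *)
Lemma evalp_replace (J : eqType) (T : eqType) (tagof : T -> J) (h : seq T -> R)
    (r : seq J) (S E : J -> seq (R * seq T)) L0 :
  (forall L L', perm_eq L L' -> h L = h L') ->
  uniq r ->
  (forall i t, i \in r -> t \in S i -> all (fun l => tagof l == i) t.2) ->
  (forall i t, i \in r -> t \in E i -> all (fun l => tagof l == i) t.2) ->
  (forall i L, i \in r -> (forall l, l \in L -> tagof l != i) ->
     eval (S i) (fun a => h (a ++ L)) = eval (E i) (fun a => h (a ++ L))) ->
  (forall l, l \in L0 -> tagof l \notin r) ->
  evalp r S (fun b => h (L0 ++ b)) = evalp r E (fun b => h (L0 ++ b)).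
Proof.
move=> h_perm; elim: r L0 => //= i r IH L0 /andP[ir ur] tS tE SE tL0.
transitivity (eval (S i) (fun a => evalp r E (fun b => h (L0 ++ (a ++ b))))).
  apply: eval_in => t ti.
  have := IH (L0 ++ t.2) ur; under eq_fun do rewrite -catA; apply.
  - by move=> j u jr; apply: tS; rewrite inE jr orbT.
  - by move=> j u jr; apply: tE; rewrite inE jr orbT.
  - by move=> j L jr; apply: SE; rewrite inE jr orbT.
  move=> l; rewrite mem_cat => /orP[/tL0|lt].
    by rewrite inE negb_or => /andP[].
  by rewrite (eqP (allP (tS i t (mem_head _ _) ti) l lt)).
rewrite (eval_evalp (S i) r E (fun a b => h (L0 ++ (a ++ b)))).
rewrite (eval_evalp (E i) r E (fun a b => h (L0 ++ (a ++ b)))).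
apply: (evalp_in (P := fun j l => tagof l == j)).
  by move=> j t jr; apply: tE; rewrite inE jr orbT.
move=> b /allP rb.
have shuffle a : h (L0 ++ (a ++ b)) = h (a ++ (L0 ++ b)).
  by apply: h_perm; rewrite perm_catCA.
have := SE i (L0 ++ b) (mem_head _ _).
rewrite /eval; under eq_bigr do rewrite -shuffle.
under [in X in _ = X]eq_bigr do rewrite -shuffle; apply.
move=> l; rewrite mem_cat => /orP[/tL0|/rb /hasP[j jr /eqP ->]].
  by rewrite inE negb_or => /andP[].
by apply: contraNneq ir => <-.
Qed.

(** After expansion of the product, every hafnian that occurs has at most M
   entries. *)
Lemma evalp_haf_bound (J : eqType) (T : eqType) (w : T -> T -> R) (B : T -> R) (P : pred T)
    (r : seq J) (E : J -> seq (R * seq T)) (msz : J -> nat) (M : nat) L0 :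
  (forall a, P a -> 0 <= B a) ->
  (forall a b, P a -> P b -> `|w a b| <= B a * B b) ->
  (forall i t, i \in r -> t \in E i -> all P t.2 && (size t.2 <= msz i)%N) ->
  all P L0 -> (size L0 + \sum_(i <- r) msz i <= M)%N ->
  `|evalp r E (fun b => haf w (L0 ++ b))| <=
  M`!%:R * \prod_(l <- L0) B l *
    \prod_(i <- r) \sum_(t <- E i) `|t.1| * \prod_(l <- t.2) B l.
Proof.
move=> B0 wB; elim: r L0 => [|i r IH] L0 PE PL0 szL0 /=.
  rewrite big_nil mulr1 cats0.
  apply: le_trans (haf_bound (B := B) _ _) _.
  - by move=> a /(allP PL0)/B0.
  - by move=> a b /(allP PL0) Pa /(allP PL0) Pb; exact: wB.
  rewrite ler_wpM2r //.
    by rewrite big_seq; apply: prodr_ge0 => l /(allP PL0)/B0.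
  by rewrite ler_nat leq_fact //; move: szL0; rewrite big_nil addn0.
have P0 L : all P L -> 0 <= \prod_(l <- L) B l.
  by move=> /allP PL; rewrite big_seq; apply: prodr_ge0 => l /PL/B0.
rewrite big_cons /eval.
apply: le_trans (ler_norm_sum _ _ _) _.
rewrite [leRHS](_ : _ = \sum_(t <- E i) `|t.1| * (M`!%:R * \prod_(l <- L0 ++ t.2) B l *
   \prod_(j <- r) \sum_(u <- E j) `|u.1| * \prod_(l <- u.2) B l)); last first.
  rewrite mulr_suml mulr_sumr; apply: eq_bigr => t _; rewrite big_cat /=.
  move: (\prod_(l <- L0) _) (\prod_(l <- t.2) _) (\prod_(j <- r) _) => a b e.
  by move: (M`!%:R : R) => f; ring.
apply: ler_sum_in => t ti; rewrite normrM ler_wpM2l //.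
have /andP[Pt szt] := PE i t (mem_head _ _) ti.
under eq_fun do rewrite catA; apply: IH.
- by move=> j u jr; apply: PE; rewrite inE jr orbT.
- by rewrite all_cat PL0.
- by apply: leq_trans szL0; rewrite size_cat big_cons -addnA leq_add2l leq_add2r.
Qed.

End Evaluation.

(** * From correlations to expanded clusters *)

Section Transfer.
Variables (R : realType) (d : nat) (phi : R) (N : nat) (I : finType).
Variables (x y : I -> 'rV[R]_d).
Hypothesis phi_gt0 : 0 < phi.
Hypothesis sep : forall i j, i != j -> [/\ x i != x j, x i != y j & y i != y j].

Let H := haf (leg_weight phi N x y).

Definition leg_point (l : leg d I) : mindex d * 'rV[R]_d :=
  (l.1.2, if l.2 == Kraw then y l.1.1 else x l.1.1).

(** The legs of the symbols as they stand in the correlation.  A cluster with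
   x i = y i consists of one symbol at its centre. *)
Definition plain_leg (l : leg d I) : bool :=
  (l.2 == Kcentre) || (l.2 == Kraw) && (x l.1.1 != y l.1.1).

Lemma point_weight_leg l l' : plain_leg l -> plain_leg l' ->
  point_weight phi (leg_point l) (leg_point l') = leg_weight phi N x y l l'.
Proof.
case: l l' => [[i al] K] [[j be] K']; rewrite /plain_leg /leg_point /leg_weight /point_weight /=.
have [<-|ij] := eqVneq i j.
  case/orP=> [/eqP ->|/andP[/eqP -> xy]] /orP[/eqP ->|/andP[/eqP -> xy']] /=; rewrite ?eqxx //.
    rewrite (negbTE xy') dcovC //.
  by rewrite eq_sym (negbTE xy).
have [s1 s2 s3] := sep ij; have [|_ s4 _] := @sep j i; first by rewrite eq_sym.
rewrite /pairing /leg_at /leg_rep /=.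
by case/orP=> [/eqP ->|/andP[/eqP -> _]] /orP[/eqP ->|/andP[/eqP -> _]] /=;
  rewrite !big_seq1 /= !mul1r ?(negbTE s1) ?(negbTE s2) ?(negbTE s3) // eq_sym (negbTE s4).
Qed.

Lemma haf_leg_point L : all plain_leg L ->
  haf (point_weight phi) (map leg_point L) = H L.
Proof.
move=> /allP pL; apply: haf_map; first exact: point_weightC.
by move=> l l' /pL pl /pL pl'; exact: point_weight_leg.
Qed.

Definition monom_legs (i : I) (w : monom R d) : seq (leg d I) :=
  flatten [seq [seq (i, al, if b.2 == x i then Kcentre else Kraw) | al <- enum_mset b.1]
          | b <- w].

Definition cluster_points (i : I) : seq 'rV[R]_d :=
  if x i == y i then [:: x i] else [:: y i; x i].

Lemma monom_legsP i w : subseq [seq b.2 | b <- w] (cluster_points i) ->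
  map leg_point (monom_legs i w) = point_legs w /\ all plain_leg (monom_legs i w).
Proof.
move=> sub; have : forall b, b \in w -> (b.2 == x i) || (b.2 == y i) && (x i != y i).
  move=> b bw; have : b.2 \in cluster_points i by rewrite (mem_subseq sub) // map_f.
  rewrite /cluster_points; case: ifP => [_|_]; first by rewrite inE => ->.
  by rewrite !inE andbT orbC.
elim: w {sub} => //= b w IH wP.
have [|e1 e2] := IH; first by move=> c cw; apply: wP; rewrite inE cw orbT.
have := wP b (mem_head _ _); rewrite /monom_legs /point_legs /= map_cat all_cat.
rewrite -/(monom_legs i w) -/(point_legs w) e1 e2 andbT.
case: (eqVneq b.2 (x i)) => [bE _|_ /= /andP[/eqP bE xy]].
  split; last by apply/allP => _ /mapP[al _ ->]; rewrite /plain_leg /=.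
  by congr (_ ++ _); rewrite -map_comp; apply: eq_map => al; rewrite /leg_point /= bE.
split; last by apply/allP => _ /mapP[al _ ->]; rewrite /plain_leg /= xy.
by congr (_ ++ _); rewrite -map_comp; apply: eq_map => al; rewrite /leg_point /= bE.
Qed.

Lemma cluster_points_uniq (r : seq I) : uniq r -> uniq (flatten (map cluster_points r)).
Proof.
have memP i z : z \in cluster_points i -> z = x i \/ z = y i.
  rewrite /cluster_points; case: ifP => _; rewrite !inE; first by move/eqP; left.
  by case/orP=> /eqP; [right|left].
elim: r => //= i r IH /andP[ir ur]; rewrite cat_uniq IH // andbT.
apply/andP; split.
  by rewrite /cluster_points; case: (eqVneq (x i) (y i)) => //= xy; rewrite inE eq_sym xy.
apply/hasPn => z /flattenP[s /mapP[j jr ->]] /memP zj; apply/negP => /memP zi.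
have ij : i != j by apply: contraNneq ir => ->.
have [s1 s2 s3] := sep ij; have [|_ s4 _] := @sep j i; first by rewrite eq_sym.
by case: zi zj => -> [] e; move: s1 s2 s3 s4; rewrite -?e ?eqxx // e eqxx.
Qed.

(** The factors already multiplied out are w0, with legs L0. *)
Lemma corr_transfer (r : seq I) (G : I -> lincomb R d) w0 L0 :
  uniq ([seq b.2 | b <- w0] ++ flatten (map cluster_points r)) ->
  point_legs w0 = map leg_point L0 -> all plain_leg L0 ->
  (forall i t, i \in r -> t \in G i -> subseq [seq b.2 | b <- t.2] (cluster_points i)) ->
  evalp r G (fun w => corr_monom phi (w0 ++ w)) =
  evalp r (fun i => [seq (t.1, monom_legs i t.2) | t <- G i]) (fun L => H (L0 ++ L)).
Proof.
elim: r w0 L0 => [|i r IH] w0 L0 /=.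
  by rewrite !cats0 => uw wL pL _; rewrite corr_monom_haf // wL haf_leg_point.
move=> uw wL pL GP; rewrite /eval big_map; apply: eq_big_seq => t ti /=; congr (_ * _).
have tsub := GP i t (mem_head _ _) ti.
have [tE tp] := monom_legsP tsub.
have {}IH := IH (w0 ++ t.2) (L0 ++ monom_legs i t.2).
have -> : (fun b => corr_monom phi (w0 ++ t.2 ++ b)) =
          (fun b => corr_monom phi ((w0 ++ t.2) ++ b)).
  by apply/funext => b; rewrite catA.
have -> : (fun b => H (L0 ++ monom_legs i t.2 ++ b)) =
          (fun b => H ((L0 ++ monom_legs i t.2) ++ b)).
  by apply/funext => b; rewrite catA.
apply: IH.
- apply: subseq_uniq uw; rewrite map_cat -catA; apply: cat_subseq => //.
  exact: cat_subseq.
- by rewrite map_cat tE -wL /point_legs map_cat flatten_cat.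
- by rewrite all_cat pL.
- by move=> j u jr; apply: GP; rewrite inE jr orbT.
Qed.

(** The terms left by the operator product expansion. *)
Definition remainder_terms (i : I) (A B : label d) (Delta : R) : seq (R * seq (leg d I)) :=
  flatten [seq [seq (term_coef phi x y i ka, term_legs i ka)
                 | ka <- enum [pred ka : {ffun free1 V -> tindex d N} | ~~ ope_term phi i Delta ka]]
           | V : {set 'I_(lrank A) * 'I_(lrank B)} <-
               enum [pred V : {set 'I_(lrank A) * 'I_(lrank B)} | partial_matching V]].

Lemma eval_remainder i A B Delta F :
  eval (remainder_terms i A B Delta) F =
  \sum_(V : {set 'I_(lrank A) * 'I_(lrank B)} | partial_matching V)
    \sum_(ka : {ffun free1 V -> tindex d N} | ~~ ope_term phi i Delta ka)
       term_coef phi x y i ka * F (term_legs i ka).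
Proof.
rewrite /eval /remainder_terms big_flatten big_map big_enum /=.
by apply: eq_bigr => V _; rewrite big_map big_enum.
Qed.

Lemma ope_remainder i A B Delta L : x i != y i -> Delta < N.+1%:R ->
  (forall l, l \in L -> l.1.1 != i) ->
  eval [seq (t.1, monom_legs i t.2) | t <- OPE phi A B Delta (y i) (x i)]
    (fun a => H (a ++ L)) =
  eval (remainder_terms i A B Delta) (fun a => H (a ++ L)).
Proof.
move=> xy DN HL; rewrite eval_remainder /eval big_map /OPE big_cons big_map /=.
rewrite /monom_legs /= cats0 eqxx eq_sym (negbTE xy) mul1r -catA.
rewrite [X in X + _](cluster_expand phi N sep A B HL).
under [X in _ + X]eq_bigr do rewrite cats0 mulNr.
rewrite sumrN [X in _ - X](ope_sum phi_gt0 sep i A B DN) -sumrB; apply: eq_bigr => V _.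
by rewrite (bigID (fun ka => ope_term phi i Delta ka)) /= addrAC subrr add0r.
Qed.

(** When the second symbol is trivial, the only term without remainder of
   dimension at most [B] is the one that moves every leg to the centre, with
   coefficient 1. *)
Lemma cz_remainder i B L : x i != y i -> scdim phi B < N.+1%:R ->
  (forall l, l \in L -> l.1.1 != i) ->
  eval [seq (t.1, monom_legs i t.2) | t <- CZ B (y i) (x i)] (fun a => H (a ++ L)) =
  eval (remainder_terms i B (seq_mset [::]) (scdim phi B)) (fun a => H (a ++ L)).
Proof.
move=> xy DN HL; rewrite eval_remainder /eval big_map /CZ !big_cons big_nil addr0 /=.
rewrite /monom_legs /= !cats0 eqxx eq_sym (negbTE xy) mul1r mulN1r.
rewrite -/(raw_legs i B) -/(centre_legs i B).
have e0 : enum_mset (seq_mset [::] : label d) = [::].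
  by apply: perm_small_eq => //; exact: perm_eq_seq_mset.
have c0 : centre_legs i (seq_mset [::] : label d) = [::] by rewrite /centre_legs e0.
have r0 : lrank (seq_mset [::] : label d) = 0%N by rewrite /lrank e0.
have := cluster_expand phi N sep B (seq_mset [::]) HL.
rewrite c0 cat0s => E; rewrite [X in X - _]E {E}.
transitivity (\sum_(V : {set 'I_(lrank B) * 'I_(lrank (seq_mset [::] : label d))} | partial_matching V)
    \sum_(ka : {ffun free1 V -> tindex d N}) term_coef phi x y i ka * H (term_legs i ka ++ L) -
 \sum_(V : {set 'I_(lrank B) * 'I_(lrank (seq_mset [::] : label d))} | partial_matching V)
    \sum_(ka : {ffun free1 V -> tindex d N} | ope_term phi i (scdim phi B) ka)
       term_coef phi x y i ka * H (term_legs i ka ++ L)); last first.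
  rewrite -sumrB; apply: eq_bigr => V _.
  by rewrite (bigID (fun ka => ope_term phi i (scdim phi B) ka)) /= addrAC subrr add0r.
congr (_ - _); symmetry.
have nob (b : 'I_(lrank (seq_mset [::] : label d))) : False.
  by case: b => b; rewrite r0.
have V0 (V : {set 'I_(lrank B) * 'I_(lrank (seq_mset [::] : label d))}) : V = finset.set0.
  by apply/finset.setP => -[a b]; case: (nob b).
rewrite (big_pred1 finset.set0) => [|V]; last first.
  rewrite /= [in RHS](V0 V) eqxx; apply/pmatchingP => a b; by case: (nob b).
have dB : scdim phi (seq_mset [::] : label d) = 0 by rewrite scdimE e0 big_nil.
set V := finset.set0.
have pV : partial_matching V by apply/pmatchingP => a b; case: (nob b).
have dimE (ka : {ffun free1 V -> tindex d N}) : legs_dim phi N (term_legs (V := V) i ka) =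
    scdim phi B + \sum_a (tdegree (ka a))%:R.
  by rewrite legs_dim_term // dB addr0 big_set0 subr0.
pose ka0 : {ffun free1 V -> tindex d N} := [ffun => Some (SeqSub (mcomp_le0 d N))].
rewrite (big_pred1 ka0) => [|ka]; last first.
  rewrite /ope_term dimE; apply/andP/eqP => [[/forallP kaS]|->].
    rewrite gerDl -natr_sum lern0 sum_nat_eq0 => /forallP ka_0.
    apply/ffunP => a; rewrite ffunE; have := ka_0 a; have := kaS a; rewrite /tdegree /=.
    case: (ka a) => // be _ /eqP be0; congr Some; apply: val_inj => /=.
    apply/ffunP => k; rewrite ffunE; apply/eqP; rewrite -leqn0 -be0.
    exact: coord_le_mdegree.
  split; first by apply/forallP => a; rewrite ffunE.
  by rewrite big1 ?addr0 // => a _; rewrite ffunE /= mdegree0.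
have -> : term_coef phi x y i ka0 = 1.
  rewrite /term_coef /matching_coef big_set0 mul1r big1 // => a _; rewrite ffunE /=.
  rewrite /taylor_coef mpower0 /mfactorial big1 ?divr1 // => k _; by rewrite ffunE.
rewrite mul1r; apply: haf_perm; first exact: leg_weightC.
rewrite perm_cat2r /term_legs.
have -> : enum (unmatched2 V) = [::].
  by case: (enum _) => // b; case: (nob b).
rewrite cats0 /centre_legs enum_mset_nu -map_comp.
rewrite (_ : [seq _ | a : free1 V] = map ((fun al => (i, al, Kcentre)) \o @nu d B) [seq val a | a : free1 V]).
  apply: perm_map; apply: uniq_perm; rewrite ?enum_uniq //.
    by rewrite map_inj_uniq ?enum_uniq //; exact: val_inj.
  move=> a; rewrite mem_enum; apply/mapP.
  have fa : unmatched1 V a by apply/forallP => b; rewrite inE.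
  by exists (Sub a fa); rewrite ?mem_enum.
by rewrite -map_comp; apply: eq_map => a; rewrite /= ffunE /= addr0.
Qed.

End Transfer.

(** * The surviving terms *)

Section Finiteness.
Variable R : realType.

Lemma finite_pos_lower_bound (T : finType) (P : pred T) (f : T -> R) :
  (forall t, P t -> 0 < f t) -> exists2 g : R, 0 < g & forall t, P t -> g <= f t.
Proof.
move=> f0; exists (\big[Num.min/1]_(t | P t) f t); first exact: lt_bigmin.
by move=> t Pt; exact: bigmin_le_cond.
Qed.

End Finiteness.

Section RemainderBounds.
Variables (R : realType) (d : nat) (phi : R) (N : nat) (I : finType).
Hypothesis phi_gt0 : 0 < phi.
Variables (i : I) (A B : label d) (Delta : R).
Hypothesis Delta_N : Delta < N.+1%:R.
Notation matching := {set 'I_(lrank A) * 'I_(lrank B)}.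

(** A surviving term has dimension larger than Delta, either by definition or
   because it contains a remainder, a leg of dimension at least N + 1; finitely
   many such excesses have a positive lower bound. *)
Lemma dimension_gap : exists2 g : R, 0 < g &
  forall (V : matching) (ka : {ffun free1 V -> tindex d N}),
    ~~ ope_term phi i Delta ka -> Delta + g <= legs_dim phi N (term_legs i ka).
Proof.
pose T : finType := {V : matching & {ffun free1 V -> tindex d N}}.
pose f (t : T) : R := legs_dim phi N (term_legs i (tagged t)) - Delta.
have [|g g0 gP] := @finite_pos_lower_bound R T (fun t => ~~ ope_term phi i Delta (tagged t)) f.
  move=> [V ka] /=; rewrite /f /= negb_and subr_gt0 => /orP[|]; last by rewrite -ltNge.
  rewrite negb_forall => /existsP[a kaN].
  apply: lt_le_trans Delta_N _.
  have la : tleg i (nu (val a)) (ka a) \in term_legs i ka.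
    by rewrite mem_cat; apply/orP; left; apply/mapP; exists a; rewrite ?mem_enum.
  apply: le_trans (ler_sum_mem la (leg_dim_ge0 N phi_gt0)).
  by case: (ka a) kaN => // _; rewrite /leg_dim /= lerDr addr_ge0 // ltW.
exists g => // V ka bad; have := gP (Tagged _ ka) bad.
by rewrite /f /= lerBrDl.
Qed.

(** These legs do not depend on the positions of the points, so constants that
   involve them may be chosen beforehand. *)
Definition all_term_legs : seq (leg d I) :=
  flatten [seq flatten [seq term_legs i ka | ka : {ffun free1 V -> tindex d N}] | V : matching].

Lemma size_flatten_mem (T : eqType) (t : seq T) (ss : seq (seq T)) :
  t \in ss -> (size t <= size (flatten ss))%N /\ {subset t <= flatten ss}.
Proof.
move=> tss; split; last by move=> a at_; apply/flattenP; exists t.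
elim: ss tss => //= u ss IH; rewrite inE size_cat => /orP[/eqP ->|/IH H].
  exact: leq_addr.
exact: leq_trans H (leq_addl _ _).
Qed.

Lemma term_legsP (V : matching) (ka : {ffun free1 V -> tindex d N}) :
  [/\ (size (term_legs i ka) <= size all_term_legs)%N,
      {subset term_legs i ka <= all_term_legs} &
      forall l, l \in term_legs i ka -> l.1.1 = i /\ (l.2 <= 1)%N].
Proof.
have [|s1 u1] := @size_flatten_mem _ (term_legs i ka)
  [seq term_legs i ka | ka : {ffun free1 V -> tindex d N}].
  by apply/mapP; exists ka; rewrite ?mem_enum.
have [|s2 u2] := @size_flatten_mem _ (flatten [seq term_legs i ka | ka : {ffun free1 V -> tindex d N}])
  [seq flatten [seq term_legs i ka | ka : {ffun free1 V -> tindex d N}] | V : matching].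
  by apply/mapP; exists V; rewrite ?mem_enum.
split; first exact: leq_trans s1 s2.
  by move=> l /u1/u2.
move=> l; rewrite mem_cat => /orP[] /mapP[a _ ->] //.
by rewrite /tleg; case: (ka a).
Qed.

Lemma mem_remainder (x y : I -> 'rV[R]_d) t : t \in remainder_terms phi N x y i A B Delta ->
  exists (V : matching) (ka : {ffun free1 V -> tindex d N}), t.2 = term_legs i ka.
Proof.
by move=> /flattenP[_ /mapP[V _ ->] /mapP[ka _ ->]]; exists V, ka.
Qed.

Definition remainder_const (c : R) : R :=
  \sum_(V : matching | partial_matching V)
    \sum_(ka : {ffun free1 V -> tindex d N} | ~~ ope_term phi i Delta ka)
      term_const phi V * c ^+ size (term_legs i ka).

Lemma remainder_const_ge0 c : 0 <= c -> 0 <= remainder_const c.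
Proof.
move=> c0; apply: sumr_ge0 => V _; apply: sumr_ge0 => ka _.
by rewrite mulr_ge0 ?term_const_ge0 ?exprn_ge0.
Qed.

Lemma remainder_bound (x y : I -> 'rV[R]_d) (delta : I -> R) (c D : R) :
  (forall j, 0 < delta j) -> (forall j, enorm (y j - x j) <= delta j / 4) ->
  x i != y i -> 0 <= c ->
  (forall (V : matching) (ka : {ffun free1 V -> tindex d N}),
     ~~ ope_term phi i Delta ka -> D <= legs_dim phi N (term_legs i ka)) ->
  \sum_(t <- remainder_terms phi N x y i A B Delta)
     `|t.1| * \prod_(l <- t.2) leg_bound phi N x y delta c l <=
  remainder_const c *
    (enorm (y i - x i) `^ (D - scdim phi A - scdim phi B) * delta i `^ (- D)).
Proof.
move=> delta0 near xy c0 gap; rewrite /remainder_terms big_flatten big_map big_enum /=.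
rewrite mulr_suml; apply: ler_sum => V pV; rewrite big_map big_enum /= mulr_suml.
by apply: ler_sum => ka bad; apply: term_bound => //; exact: gap.
Qed.

End RemainderBounds.

(** * Bound on a product of clusters *)

(** A factor is an operator product minus its expansion, a difference of two
   symbols, or a single symbol, whose cluster is reduced to its centre. *)
Variant role := Expanded | Difference | Plain.

Section ClusterBound.
Variables (R : realType) (d : nat) (phi : R) (I : finType).
Hypothesis phi_gt0 : 0 < phi.
Variables (rl : I -> role) (lA lB : I -> label d) (Dl : I -> R) (r : seq I).
Hypothesis r_uniq : uniq r.

Definition factor (x y : I -> 'rV[R]_d) (i : I) : lincomb R d :=
  match rl i with
  | Expanded => OPE phi (lA i) (lB i) (Dl i) (y i) (x i)
  | Difference => CZ (lB i) (y i) (x i)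
  | Plain => field_at (lB i) (x i)
  end.

Definition factor_bound (g : R) (x y : I -> 'rV[R]_d) (delta : I -> R) (i : I) : R :=
  match rl i with
  | Expanded => enorm (y i - x i) `^ (Dl i + g - scdim phi (lA i) - scdim phi (lB i))
                * delta i `^ (- Dl i - g)
  | Difference => enorm (y i - x i) `^ g * delta i `^ (- scdim phi (lB i) - g)
  | Plain => delta i `^ (- scdim phi (lB i))
  end.

(* A difference of two symbols is treated as the expansion of the product of
   the symbol with the trivial one, up to its own dimension. *)
Let eA i := if rl i is Expanded then lA i else lB i.
Let eB i := if rl i is Expanded then lB i else seq_mset [::].
Let eD i := if rl i is Expanded then Dl i else scdim phi (lB i).

Lemma scdim_mset0 : scdim phi (seq_mset [::] : label d) = 0.
Proof.
rewrite scdimE (_ : enum_mset _ = [::]) ?big_nil //.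
by apply: perm_small_eq => //; exact: perm_eq_seq_mset.
Qed.

Let N := Num.truncn (\sum_i `|eD i|).

Let eD_N i : eD i < N.+1%:R.
Proof.
apply: le_lt_trans (truncnS_gt _); apply: le_trans (ler_norm _) _.
by rewrite (bigD1 i) //= lerDl; apply: sumr_ge0.
Qed.

Definition cluster_terms (x y : I -> 'rV[R]_d) (i : I) : seq (R * seq (leg d I)) :=
  if rl i is Plain then [:: (1, centre_legs i (lB i))]
  else remainder_terms phi N x y i (eA i) (eB i) (eD i).

Definition cluster_legs (i : I) : seq (leg d I) :=
  centre_legs i (lB i) ++ all_term_legs N i (eA i) (eB i).

Lemma cluster_termsP x y i t : t \in cluster_terms x y i ->
  [/\ (size t.2 <= size (cluster_legs i))%N, {subset t.2 <= cluster_legs i} &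
      forall l, l \in t.2 -> l.1.1 = i /\ (l.2 <= 1)%N].
Proof.
have plain : t \in [:: (1 : R, centre_legs i (lB i))] ->
  [/\ (size t.2 <= size (cluster_legs i))%N, {subset t.2 <= cluster_legs i} &
      forall l, l \in t.2 -> l.1.1 = i /\ (l.2 <= 1)%N].
  rewrite inE => /eqP -> /=; split; first by rewrite size_cat leq_addr.
    by move=> l ll; rewrite mem_cat ll.
  by move=> l /mapP[al _ ->].
have rem : t \in remainder_terms phi N x y i (eA i) (eB i) (eD i) ->
  [/\ (size t.2 <= size (cluster_legs i))%N, {subset t.2 <= cluster_legs i} &
      forall l, l \in t.2 -> l.1.1 = i /\ (l.2 <= 1)%N].
  move=> /mem_remainder[V [ka ->]]; have [s1 s2 s3] := term_legsP i ka; split=> //.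
    by apply: (leq_trans s1); rewrite [leqRHS]size_cat leq_addl.
  by move=> l /s2 ll; rewrite mem_cat ll orbT.
by rewrite /cluster_terms; case: (rl i).
Qed.

(** The exponent g is the least of the dimension gaps, and the constant C is made
   of bounds c on the finitely many edge constants; both are fixed before the
   points are given. *)
Lemma cluster_product_bound : exists2 g : R, 0 < g & exists2 C : R, 0 <= C &
  forall (x y : I -> 'rV[R]_d) (delta : I -> R),
    (forall i j, i != j -> [/\ x i != x j, x i != y j & y i != y j]) ->
    (forall i, if rl i is Plain then y i == x i else x i != y i) ->
    (forall i, 0 < delta i) ->
    (forall i j, i != j -> delta i <= enorm (x i - x j)) ->
    (forall i, enorm (y i - x i) <= delta i / 4) ->
    `|evalp r (factor x y) (corr_monom phi)| <=
      C * \prod_(i <- r) factor_bound g x y delta i.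
Proof.
have /choice[gs gsP] : forall i, exists g : R, 0 < g /\
   forall (V : {set 'I_(lrank (eA i)) * 'I_(lrank (eB i))})
      (ka : {ffun free1 V -> tindex d N}),
      ~~ ope_term phi i (eD i) ka -> eD i + g <= legs_dim phi N (term_legs i ka).
  move=> i; have [g g0 gP] := dimension_gap phi_gt0 i (eA i) (eB i) (eD_N i).
  by exists g.
have [|g g0 gle] := @finite_pos_lower_bound R I xpredT gs.
  by move=> i _; case: (gsP i).
pose Lall := flatten [seq cluster_legs i | i <- r].
pose c : R := 1 + \sum_(l <- Lall) \sum_(l' <- Lall) edge_const phi N l.1.2 l.2 l'.1.2 l'.2.
have c1 : 1 <= c.
  rewrite lerDl; apply: sumr_ge0 => l _; apply: sumr_ge0 => l' _; exact: edge_const_ge0.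
have c0 : 0 <= c by apply: le_trans c1.
have c_edge l l' : l \in Lall -> l' \in Lall -> edge_const phi N l.1.2 l.2 l'.1.2 l'.2 <= c.
  move=> ll ll'; apply: le_trans (_ : \sum_(l <- Lall) \sum_(l' <- Lall)
      edge_const phi N l.1.2 l.2 l'.1.2 l'.2 <= _); last by rewrite lerDr.
  apply: le_trans (ler_sum_mem (F := fun l' => edge_const phi N l.1.2 l.2 l'.1.2 l'.2) ll' _) _.
    by move=> ?; exact: edge_const_ge0.
  apply: (ler_sum_mem (F := fun l => \sum_(l' <- Lall) edge_const phi N l.1.2 l.2 l'.1.2 l'.2) ll).
  by move=> ?; apply: sumr_ge0 => ? _; exact: edge_const_ge0.
pose M := (\sum_(i <- r) size (cluster_legs i))%N.
pose Ki i : R := if rl i is Plain then c ^+ size (centre_legs i (lB i))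
                 else remainder_const phi N i (eA i) (eB i) (eD i) c.
have Ki0 i : 0 <= Ki i.
  by rewrite /Ki; case: (rl i); rewrite ?remainder_const_ge0 ?exprn_ge0.
exists g => //; exists (M`!%:R * \prod_(i <- r) Ki i).
  by rewrite mulr_ge0 // prodr_ge0.
move=> x y delta sep xy delta0 deltaP near.
have wC := leg_weightC phi N sep.
pose H := haf (leg_weight phi N x y).
have xy' i : rl i <> Plain -> x i != y i by move=> ri; have := xy i; case: (rl i) ri.
have sub i t : i \in r -> t \in factor x y i ->
    subseq [seq b.2 | b <- t.2] (cluster_points x y i).
  move=> _; rewrite /factor /cluster_points; have := xy i; case: (rl i).
  - move=> /negbTE ->; rewrite inE => /orP[/eqP -> /=|/mapP[C _ -> /=]]; first by rewrite !eqxx.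
    by case: ifP => _ //=; rewrite eqxx.
  - move=> /negbTE ->; rewrite !inE => /orP[] /eqP -> /=; first by rewrite eqxx.
    by case: ifP => _ //=; rewrite eqxx.
  - by move=> /eqP ->; rewrite eqxx inE => /eqP -> /=; rewrite eqxx.
have -> : evalp r (factor x y) (corr_monom phi) =
   evalp r (fun i => [seq (t.1, monom_legs x i t.2) | t <- factor x y i]) (fun L => H ([::] ++ L)).
  apply: (corr_transfer phi N sep (w0 := [::]) (L0 := [::])) => //.
  exact: cluster_points_uniq.
rewrite (evalp_replace (tagof := fun l => l.1.1) (h := H) (E := cluster_terms x y) (L0 := [::])) //; first last.
- move=> i L ir HL; rewrite /factor /cluster_terms /eA /eB /eD.
  have := eD_N i; have := xy i; rewrite /eD; case: (rl i) => xyi DN.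
  + exact: ope_remainder.
  + exact: cz_remainder.
  + rewrite /field_at /monom_legs /= /eval !big_seq1 /= eqxx cats0 //.
- by move=> i t ir /cluster_termsP[_ _ tl]; apply/allP => l /tl[-> _].
- move=> i _ ir /mapP[t _ ->] /=; apply/allP => l /flattenP[_ /mapP[b _ ->]].
  by move=> /mapP[al _ ->].
- by move=> L L'; exact: haf_perm.
pose P := [pred l : leg d I | (l \in Lall) && (l.2 <= 1)%N].
apply: le_trans (evalp_haf_bound (B := leg_bound phi N x y delta c) (P := P)
   (msz := fun i => size (cluster_legs i)) (M := M) (L0 := [::]) _ _ _ _ _) _ => //.
- by move=> l _; exact: leg_bound_ge0.
- move=> l l' /andP[ll Kl] /andP[ll' Kl'].
  by apply: leg_weight_bound => //; exact: c_edge.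
- move=> i t ir /cluster_termsP[s1 s2 s3]; rewrite s1 andbT; apply/allP => l lt /=.
  rewrite (s3 l lt).2 andbT; apply/flattenP; exists (cluster_legs i); last exact: s2.
  exact: map_f.
rewrite big_nil mulr1 -mulrA ler_wpM2l // -big_split /=.
apply: ler_prod => i _; apply/andP; split.
  apply: sumr_ge0 => t _; rewrite mulr_ge0 //; apply: prodr_ge0 => l _; exact: leg_bound_ge0.
have gap (V : {set 'I_(lrank (eA i)) * 'I_(lrank (eB i))}) (ka : {ffun free1 V -> tindex d N}) :
   ~~ ope_term phi i (eD i) ka -> eD i + g <= legs_dim phi N (term_legs i ka).
  move=> bad; apply: le_trans ((gsP i).2 _ _ bad).
  by rewrite lerD2l gle.
rewrite /cluster_terms /Ki /factor_bound.
case ri : (rl i); last first.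
- rewrite big_seq1 normr1 mul1r (@prod_leg_bound _ _ _ _ _ _ _ _ delta0 c i); last first.
    by move=> l /mapP[al _ ->].
  rewrite legs_dim_centre /= /centre_legs big_map big1 // expr0 mulr1 size_map //.
- apply: le_trans (remainder_bound delta0 near _ c0 gap) _; first by apply: xy'; rewrite ri.
  rewrite /eA /eB /eD ri scdim_mset0 subr0 le_eqVlt; apply/orP; left; apply/eqP.
  by congr (_ * (_ `^ _ * _ `^ _)); ring.
- apply: le_trans (remainder_bound delta0 near _ c0 gap) _; first by apply: xy'; rewrite ri.
  by rewrite /eA /eB /eD ri (opprD (Dl i) g) lexx.
Qed.

End ClusterBound.

(** * Nearest neighbour distances *)

Section NearestNeighbour.
Variables (R : realType) (d M : nat) (x : 'I_M -> 'rV[R]_d).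

Lemma jbracket_ge1 (z : 'rV[R]_d) : 1 <= jbracket z.
Proof.
by rewrite -[leLHS]sqrtr1 ler_wsqrtr // lerDl sqr_ge0.
Qed.

Lemma enorm_le_jbracket (z : 'rV[R]_d) : enorm z <= jbracket z.
Proof.
rewrite -[leLHS](ger0_norm (enorm_ge0 z)) -sqrtr_sqr ler_wsqrtr //.
by rewrite lerDr.
Qed.

Lemma nn_dist_le i j : i != j -> nn_dist x i <= enorm (x i - x j).
Proof.
move=> ij; rewrite /nn_dist; case: pickP => [j0 _|/(_ j)]; last by rewrite eq_sym ij.
by apply: bigmin_le_cond; rewrite eq_sym.
Qed.

Lemma prodr_ge1 (I : finType) (P : pred I) (f : I -> R) :
  (forall j, P j -> 1 <= f j) -> 1 <= \prod_(j | P j) f j.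
Proof.
by move=> f1; elim/big_ind: _ => // u v; exact: mulr_ege1.
Qed.

Hypothesis x_inj : injective x.

Lemma nn_dist_gt0 i : 0 < nn_dist x i.
Proof.
have pos j : j != i -> 0 < enorm (x i - x j).
  move=> ji; rewrite enorm_gt0 // subr_eq0; apply: contraNneq ji => /x_inj ->.
  by rewrite eqxx.
by rewrite /nn_dist; case: pickP => [j0 j0i|_ //]; apply: lt_bigmin; [exact: pos|exact: pos].
Qed.

Lemma nn_dist_growth i : nn_dist x i <= 2 * \prod_j jbracket (x j).
Proof.
have ge1 (P : pred 'I_M) : 1 <= \prod_(j | P j) jbracket (x j).
  by apply: prodr_ge1 => j _; exact: jbracket_ge1.
have le_prod j : enorm (x j) <= \prod_j jbracket (x j).
  rewrite (bigD1 j) //=; apply: le_trans (enorm_le_jbracket _) _.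
  by rewrite ler_peMr // (le_trans ler01) // jbracket_ge1.
have [[j ij]|none] := pselect (exists j, i != j).
  apply: le_trans (nn_dist_le ij) _; apply: le_trans (ler_enormB _ _) _.
  by rewrite mulr_natl mulr2n lerD.
rewrite /nn_dist; case: pickP => [j ji|_].
  by case: none; exists j; rewrite eq_sym.
by apply: le_trans (ge1 xpredT) _; rewrite ler_peMl ?ler1n // (le_trans ler01).
Qed.

(** The nearest neighbour distance is at most a sum of two norms, or 1 when
   there is no other point, so its power e is absorbed by the brackets. *)
Lemma nn_dist_powR i (a e : R) (k0 : nat) : 0 <= e -> e <= k0%:R ->
  nn_dist x i `^ a <=
  nn_dist x i `^ (a - e) * (2 * \prod_j jbracket (x j)) ^+ k0.
Proof.
move=> e0 ek; have d0 := nn_dist_gt0 i.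
have -> : nn_dist x i `^ a = nn_dist x i `^ (a - e) * nn_dist x i `^ e.
  by rewrite -powRD ?subrK // (gt_eqF d0) implybT.
rewrite ler_wpM2l ?powR_ge0 //.
have J1 : 1 <= 2 * \prod_j jbracket (x j).
  rewrite -[leLHS]mulr1; apply: ler_pM; rewrite ?ler1n //.
  by apply: prodr_ge1 => j _; exact: jbracket_ge1.
have J0 := le_trans ler01 J1.
apply: le_trans (_ : (2 * \prod_j jbracket (x j)) `^ e <= _).
  by apply: ge0_ler_powR; rewrite ?nnegrE //; [exact: ltW|exact: nn_dist_growth].
by rewrite -powR_mulrn //; apply: ler_powR.
Qed.

End NearestNeighbour.

(** * The nearest neighbour bound *)

Theorem mainTheorem6 (R : realType) (d : nat) (phi : R)
    (d_ge1 : (1 <= d)%N) (phi_gt0 : 0 < phi)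
    (m n p : nat)
    (A : 'I_m -> label d) (B : 'I_(m + n + p) -> label d) (Delta : 'I_m -> R)
    (Delta_dim : forall i : 'I_m, exists C : label d, Delta i = scdim phi C) :
  (* positions of the OPE, CZ and remaining factors among all m + n + p, and
     of the first two kinds among the m + n points y *)
  let iO (i : 'I_m) : 'I_(m + n + p) := lshift p (lshift n i) in
  let iC (i : 'I_n) : 'I_(m + n + p) := lshift p (rshift m i) in
  let iR (i : 'I_p) : 'I_(m + n + p) := rshift (m + n) i in
  let yO (i : 'I_m) : 'I_(m + n) := lshift n i in
  let yC (i : 'I_n) : 'I_(m + n) := rshift m i in
  exists eta gamma : R, 0 < eta /\ 0 < gamma /\
  forall epsilon : R, 0 < epsilon ->
  exists (k : nat) (K : R), 0 < K /\
  forall (x : 'I_(m + n + p) -> 'rV[R]_d) (y : 'I_(m + n) -> 'rV[R]_d),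
    injective x -> injective y -> (forall i j, x i <> y j) ->
    let delta := nn_dist x in
    (\prod_(i < m + n)
        (enorm (y i - x (lshift p i)) <= eta * delta (lshift p i))%R%:R)
    * `| corr_lin phi
           (lmul (\big[@lmul R d/lone R d]_(i < m)
                    OPE phi (A i) (B (iO i)) (Delta i) (y (yO i)) (x (iO i)))
           (lmul (\big[@lmul R d/lone R d]_(i < n)
                    CZ (B (iC i)) (y (yC i)) (x (iC i)))
                 (\big[@lmul R d/lone R d]_(i < p)
                    field_at (B (iR i)) (x (iR i))))) |
    <= K
       * \prod_(i < m + n + p) jbracket (x i) ^+ k
       * \prod_(i < m + n) jbracket (y i) ^+ k
       * \prod_(i < m)
           (enorm (y (yO i) - x (iO i))
              `^ (Delta i + gamma - scdim phi (A i) - scdim phi (B (iO i)))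
            * delta (iO i) `^ (- Delta i - gamma - epsilon))
       * \prod_(i < n)
           (enorm (y (yC i) - x (iC i)) `^ gamma
            * delta (iC i) `^ (- scdim phi (B (iC i)) - gamma - epsilon))
       * \prod_(i < p)
           delta (iR i) `^ (- scdim phi (B (iR i)) - epsilon).
Proof.
move=> iO iC iR yO yC.
pose I : finType := ('I_m + 'I_n + 'I_p)%type.
pose pos (i : I) : 'I_(m + n + p) :=
  match i with inl (inl a) => iO a | inl (inr b) => iC b | inr c => iR c end.
have pos_inj : injective pos.
  move=> [[a|a]|a] [[b|b]|b] /(congr1 val) /=; rewrite /bump /=;
    have := ltn_ord a; have := ltn_ord b; move=> ? ? ?;
    try (do ?congr inl; do ?congr inr; apply: val_inj => /=; lia); lia.
pose rl (i : I) : role :=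
  match i with inl (inl _) => Expanded | inl (inr _) => Difference | inr _ => Plain end.
pose lA (i : I) : label d := if i is inl (inl a) then A a else seq_mset [::].
pose Dl (i : I) : R := if i is inl (inl a) then Delta a else 0.
pose r : seq I := [seq inl (inl a) | a <- index_enum 'I_m] ++
  [seq inl (inr b) | b <- index_enum 'I_n] ++ [seq inr c | c <- index_enum 'I_p].
have r_uniq : uniq r.
  rewrite !cat_uniq !map_inj_uniq ?index_enum_uniq //=;
    try by move=> a b; case.
  rewrite andbT; apply/andP; split; apply/hasPn => i.
    by rewrite mem_cat => /orP[] /mapP[b _ ->]; apply/mapP => -[].
  by move=> /mapP[b _ ->]; apply/mapP => -[].
have [g g0 [C C0 HC]] := cluster_product_bound phi_gt0 rl lA (B \o pos) Dl r_uniq.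
(* Within a quarter of delta, the points of two clusters stay at distance at
   least half of that of their centres. *)
exists 4^-1, g; split; first by rewrite invr_gt0.
split=> // eps eps0.
(* The power epsilon of each of the M distances costs k0 powers of the brackets. *)
pose M := (m + n + p)%N; pose k0 := (Num.truncn eps).+1; pose k := (k0 * M)%N.
have epsk : eps <= k0%:R by apply: ltW; exact: truncnS_gt.
exists k, (1 + C * 2 ^+ k); split.
  by apply: ltr_pwDl => //; rewrite mulr_ge0 ?exprn_ge0.
move=> x y x_inj y_inj xy; cbv zeta; set delta := nn_dist x.
have delta0 i : 0 < delta i by exact: nn_dist_gt0.
set PO' := \prod_(i < m) (_ * delta (iO i) `^ _).
set PN' := \prod_(i < n) (_ * delta (iC i) `^ _).
set PP' := \prod_(i < p) delta (iR i) `^ _.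
have PO0 : 0 <= PO' by apply: prodr_ge0 => i _; rewrite mulr_ge0 ?powR_ge0.
have PN0 : 0 <= PN' by apply: prodr_ge0 => i _; rewrite mulr_ge0 ?powR_ge0.
have PP0 : 0 <= PP' by apply: prodr_ge0 => i _; rewrite powR_ge0.
have jb0 (z : 'rV[R]_d) : 0 <= jbracket z by exact: sqrtr_ge0.
have X0 : 0 <= \prod_(i < m + n + p) jbracket (x i) ^+ k.
  by apply: prodr_ge0 => i _; rewrite exprn_ge0.
have Y1 : 1 <= \prod_(i < m + n) jbracket (y i) ^+ k.
  by apply: prodr_ge1 => i _; rewrite exprn_ege1 // jbracket_ge1.
have K0 : 0 <= 1 + C * 2 ^+ k by rewrite addr_ge0 // mulr_ge0 ?exprn_ge0.
have [/forallP near|] := boolP [forall i : 'I_(m + n),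
    enorm (y i - x (lshift p i)) <= 4^-1 * delta (lshift p i)]; last first.
  rewrite negb_forall => /existsP[i /negbTE far].
  rewrite (bigD1 i) //= far !mul0r !mulr_ge0 //.
  exact: le_trans ler01 Y1.
rewrite big1 ?mul1r => [|i _]; last by rewrite near.
pose x' (i : I) := x (pos i).
pose y' (i : I) : 'rV[R]_d := match i with
  inl (inl a) => y (yO a) | inl (inr b) => y (yC b) | inr c => x (iR c) end.
have -> : corr_lin phi
           (lmul (\big[@lmul R d/lone R d]_(i < m)
                    OPE phi (A i) (B (iO i)) (Delta i) (y (yO i)) (x (iO i)))
           (lmul (\big[@lmul R d/lone R d]_(i < n)
                    CZ (B (iC i)) (y (yC i)) (x (iC i)))
                 (\big[@lmul R d/lone R d]_(i < p)
                    field_at (B (iR i)) (x (iR i))))) =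
   evalp r (factor phi rl lA (B \o pos) Dl x' y') (corr_monom phi).
  rewrite -[LHS]/(eval _ (corr_monom phi)) eval_lmul eval_big_lmul.
  rewrite /r evalp_cat evalp_map; congr evalp; apply/funext => a.
  rewrite eval_lmul eval_big_lmul evalp_cat evalp_map; congr evalp; apply/funext => b.
  by rewrite eval_big_lmul evalp_map.
have sep (i j : I) : i != j -> [/\ x' i != x' j, x' i != y' j & y' i != y' j].
  move=> ij; have pij : x (pos i) != x (pos j).
    by apply: contraNneq ij => /x_inj/pos_inj ->.
  split=> //.
    by case: j ij pij => [[b|b]|b] ij pij //; apply/eqP; exact: xy.
  case: i j ij pij => [[a|a]|a] [[b|b]|b] ij pij /=.
  - by apply: contraNneq ij => /y_inj/lshift_inj ->.
  - by rewrite (inj_eq y_inj) eq_lrshift.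
  - by apply/eqP => /esym; exact: xy.
  - by rewrite (inj_eq y_inj) eq_rlshift.
  - by apply: contraNneq ij => /y_inj/rshift_inj ->.
  - by apply/eqP => /esym; exact: xy.
  - by apply/eqP; exact: xy.
  - by apply/eqP; exact: xy.
  - exact: pij.
apply: le_trans (HC x' y' (fun i => delta (pos i)) sep _ _ _ _) _.
- move=> [[a|b]|c] /=; last exact: eqxx.
    by apply/eqP; exact: xy.
  by apply/eqP; exact: xy.
- by move=> i; exact: delta0.
- by move=> i j ij; apply: nn_dist_le; rewrite (inj_eq pos_inj).
- move=> [[a|b]|c] /=.
  + by rewrite mulrC; exact: near.
  + by rewrite mulrC; exact: near.
  + by rewrite subrr enorm0 divr_ge0 // ltW.
rewrite /r !big_cat !big_map /factor_bound /=.
pose J := (2 * \prod_j jbracket (x j)) ^+ k0.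
have absorb (q : nat) (f f' : 'I_q -> R) : (forall i, 0 <= f i <= f' i * J) ->
    \prod_(i < q) f i <= \prod_(i < q) f' i * J ^+ q.
  move=> ff; rewrite -[in J ^+ q](card_ord q) -prodr_const -big_split /=.
  by apply: ler_prod.
have J0 : 0 <= J by rewrite exprn_ge0 // mulr_ge0 // prodr_ge0.
have hO : \prod_(i < m) (enorm (y (yO i) - x (iO i))
      `^ (Delta i + g - scdim phi (A i) - scdim phi (B (iO i)))
      * delta (iO i) `^ (- Delta i - g)) <= PO' * J ^+ m.
  apply: absorb => i; rewrite mulr_ge0 ?powR_ge0 //= -mulrA ler_wpM2l ?powR_ge0 //.
  by apply: nn_dist_powR => //; exact: ltW.
have hC : \prod_(i < n) (enorm (y (yC i) - x (iC i)) `^ g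
      * delta (iC i) `^ (- scdim phi (B (iC i)) - g)) <= PN' * J ^+ n.
  apply: absorb => i; rewrite mulr_ge0 ?powR_ge0 //= -mulrA ler_wpM2l ?powR_ge0 //.
  by apply: nn_dist_powR => //; exact: ltW.
have hP : \prod_(i < p) delta (iR i) `^ (- scdim phi (B (iR i))) <= PP' * J ^+ p.
  by apply: absorb => i; rewrite powR_ge0; apply: nn_dist_powR => //; exact: ltW.
have JM : J ^+ m * J ^+ n * J ^+ p = 2 ^+ k * \prod_(i < m + n + p) jbracket (x i) ^+ k.
  rewrite -!exprD /J -exprM -/M -/k exprMn; congr (_ * _).
  by rewrite prodrXl.
apply: le_trans (_ : C * ((PO' * J ^+ m) * ((PN' * J ^+ n) * (PP' * J ^+ p))) <= _).
  rewrite ler_wpM2l //; apply: ler_pM => //.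
  - by apply: prodr_ge0 => i _; rewrite mulr_ge0 ?powR_ge0.
  - rewrite mulr_ge0 //; apply: prodr_ge0 => i _; last exact: powR_ge0.
    by rewrite mulr_ge0 ?powR_ge0.
  - apply: ler_pM => //; apply: prodr_ge0 => i _; last exact: powR_ge0.
    by rewrite mulr_ge0 ?powR_ge0.
have regroup (a b e f u v w : R) : a * ((b * u) * ((e * v) * (f * w))) = a * (u * v * w) * (b * e * f).
  by ring.
rewrite regroup JM.
have final (u X Y a b c : R) : 0 <= u -> 0 <= X -> 1 <= Y -> 0 <= a -> 0 <= b ->
    0 <= c -> C * (u * X) * (a * b * c) <= (1 + C * u) * X * Y * a * b * c.
  move=> u0 hX hY ha hb hc; rewrite !mulrA.
  do 3 (apply: ler_wpM2r => //).
  rewrite -[leLHS]mulr1; apply: ler_pM => //; first by rewrite !mulr_ge0.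
  by apply: ler_wpM2r => //; rewrite lerDr.
by apply: final => //; rewrite exprn_ge0.
Qed.
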